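(* Let $n\ge 2$ be an integer, let $0<\mu<1$, and let $S(x,y)=\sum_{k=1}^{n-1}a_kx^{n-k}y^k$ be a real homogeneous polynomial of degree $n$ on $\mathbb{R}^2$ with $a_1a_{n-1}\neq 0$. Let $\psi\in C_0^\infty(\mathbb{R}^2)$. Let $K(x,y)$ be a function that is $C^2$ away from the diagonal $\{x=y\}$ and satisfies, for some constant $E>0$ and all $x\ne y$, $$|K(x,y)|\le E|x-y|^{-\mu},\qquad |\partial_y^iK(x,y)|\le E|x-y|^{-\mu-i}\quad (i=1,2).$$ For $\lambda\ge 2$ define $$Tf(x)=\int_{\mathbb{R}}e^{i\lambda S(x,y)}K(x,y)\psi(x,y)f(y)\,dy .$$ Then: (1) for every $p$ with $\frac{n-2\mu}{n-1-\mu}<p<\frac{n-2\mu}{1-\mu}$ there is a constant $C=C_{E,S,\psi,\mu,n,p}$, depending only on $E,S,\psi,\mu,n,p$ (not on $\lambda$ or $f$), such that $$\|Tf\|_{L^p(\mathbb{R})}\le C\,\lambda^{-\frac{1-\mu}{n}}\|f\|_{L^p(\mathbb{R})}\qquad\text{for all } f\in L^p(\mathbb{R});$$ (2) for the endpoint $p=\frac{n-2\mu}{n-1-\mu}$ there is a constant $C=C_{E,S,\psi,\mu,n,p}$, depending only on $E,S,\psi,\mu,n,p$ (not on $\lambda$ or $f$), such that $$\|Tf\|_{L^{p}(\mathbb{R})}\le C\,\lambda^{-\frac{1-\mu}{n}}\,|\log_2\lambda|^{\frac{2-2\mu}{n-2\mu}}\,\|f\|_{L^{p}(\mathbb{R})}\qquad\text{for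 all } f\in L^p(\mathbb{R}).$$ *)

(* Defs.v *)
From mathcomp Require Import all_boot all_order all_algebra.
From mathcomp Require Import all_classical all_reals all_analysis.
From mathcomp Require Import complex.
Set Implicit Arguments.
Unset Strict Implicit.
Unset Printing Implicit Defensive.
Import Order.TTheory GRing.Theory Num.Theory.
Import numFieldNormedType.Exports.
Local Open Scope classical_set_scope.
Local Open Scope ring_scope.
Local Open Scope complex_scope.

Section Defs.
Context {R : realType}.
Implicit Types (g K psi : R * R -> R[i]) (f : R -> R[i]) (U : set (R * R)).

Definition cis (t : R) : R[i] := cos t +i* sin t.

Definition dirx : R * R := (1, 0).
Definition diry : R * R := (0, 1).

(* Meaningful at points where the real and imaginary parts are both derivable
   along v. *)
Definition cderive (v : R * R) g : R * R -> R[i] := fun q =>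
  'D_v (fun z => complex.Re (g z)) q +i* 'D_v (fun z => complex.Im (g z)) q.

(* C^k on an open set U; only values of g on U matter since U is open. *)
Fixpoint realCk (k : nat) U (g : R * R -> R) : Prop :=
  {in U, forall q, {for q, continuous g}} /\
  if k is k'.+1 then
    {in U, forall q, derivable g q dirx /\ derivable g q diry} /\
    realCk k' U ('D_dirx g) /\ realCk k' U ('D_diry g)
  else True.

Definition Ck (k : nat) U g : Prop :=
  realCk k U (fun q => complex.Re (g q)) /\
  realCk k U (fun q => complex.Im (g q)).

Definition smooth_compact_support psi : Prop :=
  (forall k, Ck k setT psi) /\ compact (closure [set q | psi q != 0]).

Definition off_diagonal : set (R * R) := [set q | q.1 != q.2].

(* The values of K on the diagonal are unconstrained; they do not affect
   the integral over y defining the operator below. *)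
Definition singular_kernel (mu E : R) K : Prop :=
  Ck 2 off_diagonal K /\
  forall x y : R, x != y ->
    [/\ Normc.normc (K (x, y)) <= E * `|x - y| `^ (- mu),
        Normc.normc (cderive diry K (x, y)) <= E * `|x - y| `^ (- mu - 1) &
        Normc.normc (cderive diry (cderive diry K) (x, y))
          <= E * `|x - y| `^ (- mu - 2)].

Definition phase (n : nat) (a : nat -> R) (x y : R) : R :=
  \sum_(1 <= k < n) a k * x ^+ (n - k) * y ^+ k.

Definition cintegral f : R[i] :=
  (\int[lebesgue_measure]_y complex.Re (f y)) +i*
  (\int[lebesgue_measure]_y complex.Im (f y)).

(* For f in L^p the integral converges absolutely for almost every x; at the
   remaining x the library's total integral returns a default value. *)
Definition osc_op (S : R -> R -> R) K psi (lambda : R) f : R -> R[i] :=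
  fun x => cintegral (fun y => cis (lambda * S x y) * K (x, y) * psi (x, y) * f y).

Definition cLnorm (p : R) f : \bar R :=
  ('N[@lebesgue_measure R]_(p%:E) [EFin \o (@Normc.normc R \o f)])%E.

Definition in_Lp (p : R) f : Prop :=
  [/\ measurable_fun setT (fun x => complex.Re (f x)),
      measurable_fun setT (fun x => complex.Im (f x)) &
      (cLnorm p f < +oo)%E].

Definition log2 (t : R) : R := ln t / ln 2.

End Defs.

(* Main.v *)
Require Import Defs.
From HB Require Import structures.
From mathcomp Require Import all_boot all_order all_algebra.
From mathcomp Require Import all_classical all_reals all_analysis.
From mathcomp Require Import measurable_realfun.
From mathcomp Require Import complex.
From mathcomp Require Import ring lra.
Import Order.TTheory GRing.Theory Num.Theory.
Import numFieldNormedType.Exports.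
Local Open Scope classical_set_scope.
Local Open Scope ring_scope.
Set Implicit Arguments.
Unset Strict Implicit.
Unset Printing Implicit Defensive.

(** Duality reduces the estimate to the bilinear form
    [int int cos (lambda S + c) b f(y) g(x) dy dx] on a square that contains the
    support of [psi]: the real and imaginary parts of [K psi], of [f] and of the
    exponential are separated, which leaves eight real kernels.  Here [b] is
    bounded by [M |x - y|^-mu] and its [y]-derivative by [M |x - y|^(-mu - 1)]
    ([amplitude_pair]).

    The mixed derivative [S_xy] is a binary form of degree [n - 2].  Since
    [a_1 a_(n-1) != 0] it has no factor [x] or [y], and it splits over the complex
    numbers into linear forms [y - z x] with [z != 0] ([phase_structure]).  The
    phase degenerates only on these lines and the kernel is singular only on the
    diagonal, so the square is decomposed dyadically: a box of side [d] is kept as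
    soon as it is at distance at least [d] from the diagonal and from all the
    lines, and is divided into four otherwise.

    On a kept box the amplitude has size [d^-mu] and [|S_xy|] is at least
    [c d^(n-2)].  The [T T^*] method with one integration by parts in [y]
    ([bform_TTstar], [van_der_corput]) bounds the form on [L^2] by
    [M d^(1-mu) (lambda d^n)^(-beta/2)] for any [beta < 1]; interpolation with the
    trivial bound on [L^1 x L^1] ([bform_interpolation]) yields
    [M d^(1-mu) (lambda d^n)^(-beta s)] with [s = min (1/p) (1/q)], [q] being the
    exponent conjugate to [p] ([good_box_bound]).  The division stops at
    [d ~ lambda^(-1/n)], where [lambda d^n ~ 1]; the boxes that remain are
    estimated by Schur's test, which gives [M d^(1-mu)] ([any_box_bound]).

    All lines being transversal to both axes, every row and every column of a grid
    meets boundedly many of the boxes of that grid which occur in the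
    decomposition.  Hence the form restricted to one scale is bounded like a single
    box ([stopping_tree_bound]).  The sum over scales of
    [d^(1-mu) (lambda d^n)^(-beta s)] is geometric and governed by the smallest
    scale, that is by [lambda^(-(1-mu)/n)], as soon as [n beta s > 1 - mu]
    ([dyadic_bilinear_bound]).

    The condition [(n-2mu)/(n-1-mu) <= p <= (n-2mu)/(1-mu)] says that [s] is at
    least [(1-mu)/(n-2mu)].  With [beta = 1 - mu/n] one has
    [n beta s = (n - mu) s > 1 - mu], end points included.  This proves (1), and
    also (2), because [|log2 lambda|] is at least one for [lambda >= 2]. *)

(** * Bounded measurable functions on a finite measure space *)

Section BoundedMeasurable.
Context {R : realType}.

(** For these functions all the integrals over finite measures converge
    absolutely and may be exchanged, so the form estimates are free of
    integrability conditions; general functions are reached by truncation. *)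
Definition bounded_meas d (T : measurableType d) (f : T -> R) :=
  measurable_fun setT f /\ exists M, forall x, `|f x| <= M.

Section Closure.
Context d (T : measurableType d).
Implicit Types f g : T -> R.

Lemma bounded_meas_cst c : bounded_meas (fun _ : T => c).
Proof. by split=> //; exists `|c|. Qed.

Lemma bounded_measD f g : bounded_meas f -> bounded_meas g ->
  bounded_meas (fun x => f x + g x).
Proof.
move=> [mf [M fM]] [mg [N gN]]; split; first exact: measurable_funD.
by exists (M + N) => x; rewrite (le_trans (ler_normD _ _))// lerD.
Qed.

Lemma bounded_measM f g : bounded_meas f -> bounded_meas g ->
  bounded_meas (fun x => f x * g x).
Proof.
move=> [mf [M fM]] [mg [N gN]]; split; first exact: measurable_funM.
by exists (M * N) => x; rewrite normrM ler_pM.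
Qed.

Lemma bounded_measN f : bounded_meas f -> bounded_meas (fun x => - f x).
Proof.
move=> [mf [M fM]]; split; first exact: measurableT_comp.
by exists M => x; rewrite normrN.
Qed.

Lemma bounded_measB f g : bounded_meas f -> bounded_meas g ->
  bounded_meas (fun x => f x - g x).
Proof. by move=> bf bg; apply: bounded_measD => //; exact: bounded_measN. Qed.

Lemma bounded_meas_norm f : bounded_meas f -> bounded_meas (fun x => `|f x|).
Proof.
move=> [mf [M fM]]; split; first exact: measurableT_comp.
by exists M => x; rewrite normr_id.
Qed.

Lemma bounded_meas_sqr f : bounded_meas f -> bounded_meas (fun x => f x ^+ 2).
Proof. by move=> bf; under eq_fun do rewrite expr2; exact: bounded_measM. Qed.

Lemma bounded_meas_powR f (p : R) : 0 <= p -> bounded_meas f ->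
  bounded_meas (fun x => `|f x| `^ p).
Proof.
move=> p0 [mf [M fM]]; split.
  by apply: measurableT_comp (@measurable_powR R p) _; exact: measurableT_comp.
exists (M `^ p) => x; rewrite ger0_norm ?powR_ge0// ge0_ler_powR// nnegrE//.
exact: le_trans (fM x).
Qed.

Lemma bounded_meas_indic (A : set T) : measurable A ->
  bounded_meas (\1_A : T -> R).
Proof.
move=> mA; split; first exact: measurable_indic.
by exists 1 => x; rewrite indicE; case: (_ \in _); rewrite ?normr1 ?normr0.
Qed.

End Closure.

Lemma bounded_meas_comp d d' (T : measurableType d) (U : measurableType d')
    (h : U -> T) (f : T -> R) : measurable_fun setT h -> bounded_meas f ->
  bounded_meas (fun x => f (h x)).
Proof.
by move=> mh [mf [M fM]]; split; [exact: measurableT_comp|exists M => x].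
Qed.

Section Integral.
Context d (T : measurableType d) (m : {finite_measure set T -> \bar R}).
Implicit Types f g : T -> R.

Lemma bounded_meas_integrable f : bounded_meas f ->
  m.-integrable setT (EFin \o f).
Proof.
move=> [mf [M fM]]; apply: measurable_bounded_integrable => //.
  exact: fin_num_fun_lty.
by exists M; split; [exact: num_real|move=> N MN x _ /=; exact: le_trans (ltW MN)].
Qed.

Lemma RintegralDb f g : bounded_meas f -> bounded_meas g ->
  \int[m]_x (f x + g x) = \int[m]_x f x + \int[m]_x g x.
Proof. by move=> bf bg; rewrite RintegralD//; exact: bounded_meas_integrable. Qed.

Lemma RintegralZb c f : bounded_meas f ->
  \int[m]_x (c * f x) = c * \int[m]_x f x.
Proof. by move=> bf; rewrite RintegralZl//; exact: bounded_meas_integrable. Qed.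

Lemma le_Rintegralb f g : bounded_meas f -> bounded_meas g ->
  (forall x, f x <= g x) -> \int[m]_x f x <= \int[m]_x g x.
Proof.
by move=> bf bg fg; apply: le_Rintegral => //; exact: bounded_meas_integrable.
Qed.

Lemma le_norm_Rintegralb f : bounded_meas f ->
  `|\int[m]_x f x| <= \int[m]_x `|f x|.
Proof. by move=> bf; apply: le_normr_Rintegral => //; exact: bounded_meas_integrable. Qed.

Lemma EFin_Rintegralb f : bounded_meas f ->
  (\int[m]_x f x)%:E = (\int[m]_x (f x)%:E)%E.
Proof.
move=> bf; rewrite fineK//; apply: integrable_fin_num => //.
exact: bounded_meas_integrable.
Qed.

(** The quadratic polynomial [t |-> int (f - t g)^2] is nonnegative, so its
    discriminant is not positive. *)
Lemma Rintegral_cauchy_schwarz f g : bounded_meas f -> bounded_meas g ->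
  (\int[m]_x (f x * g x)) ^+ 2 <= (\int[m]_x (f x ^+ 2)) * (\int[m]_x (g x ^+ 2)).
Proof.
move=> bf bg.
set X := \int[m]_x (f x ^+ 2); set Y := \int[m]_x (f x * g x).
set Z := \int[m]_x (g x ^+ 2).
have H t : 0 <= X - 2 * t * Y + t ^+ 2 * Z.
  have <- : \int[m]_x ((f x - t * g x) ^+ 2) = X - 2 * t * Y + t ^+ 2 * Z.
    have -> : \int[m]_x ((f x - t * g x) ^+ 2) =
      \int[m]_x (f x ^+ 2 + ((- (2 * t)) * (f x * g x) + t ^+ 2 * (g x ^+ 2))).
      by apply: eq_Rintegral => x _; ring.
    have bfg := bounded_measM bf bg.
    have bgg := bounded_meas_sqr bg.
    have bt c h : bounded_meas h -> bounded_meas (fun x : T => c * h x).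
      by move=> bh; apply: bounded_measM => //; exact: bounded_meas_cst.
    rewrite RintegralDb; [|exact: bounded_meas_sqr|]; last first.
      by apply: bounded_measD; exact: bt.
    by rewrite RintegralDb ?RintegralZb//; [rewrite /X /Y /Z; ring|exact: bt..].
  by apply: Rintegral_ge0 => x _; exact: sqr_ge0.
have X0 : 0 <= X by apply: Rintegral_ge0 => x _; exact: sqr_ge0.
have Z0 : 0 <= Z by apply: Rintegral_ge0 => x _; exact: sqr_ge0.
have [Z1|Z1] := eqVneq Z 0.
  have [->|Yn] := eqVneq Y 0; first by rewrite expr0n mulr_ge0.
  have := H ((X + 1) / (2 * Y)); rewrite Z1.
  have -> : 2 * ((X + 1) / (2 * Y)) * Y = X + 1 by field.
  by rewrite mulr0; lra.
have Zp : 0 < Z by rewrite lt_def Z1.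
have := H (Y / Z).
have -> : X - 2 * (Y / Z) * Y + (Y / Z) ^+ 2 * Z = (X * Z - Y ^+ 2) / Z by field.
by rewrite pmulr_lge0 ?invr_gt0// subr_ge0.
Qed.

End Integral.

Section Product.
Context d1 d2 (T1 : measurableType d1) (T2 : measurableType d2).
Variables (m1 : {finite_measure set T1 -> \bar R})
          (m2 : {finite_measure set T2 -> \bar R}).
Implicit Types u : T1 * T2 -> R.

Lemma bounded_meas_slice1 u x : bounded_meas u -> bounded_meas (fun y => u (x, y)).
Proof. by apply: bounded_meas_comp; exact: pair1_measurable. Qed.

Lemma bounded_meas_slice2 u y : bounded_meas u -> bounded_meas (fun x => u (x, y)).
Proof. by apply: bounded_meas_comp; exact: pair2_measurable. Qed.

Lemma bounded_meas_fst (f : T1 -> R) : bounded_meas f ->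
  bounded_meas (fun z : T1 * T2 => f z.1).
Proof. by apply: bounded_meas_comp; exact: measurable_fst. Qed.

Lemma bounded_meas_snd (f : T2 -> R) : bounded_meas f ->
  bounded_meas (fun z : T1 * T2 => f z.2).
Proof. by apply: bounded_meas_comp; exact: measurable_snd. Qed.

Lemma bounded_meas_swap u : bounded_meas u ->
  bounded_meas (fun z : T2 * T1 => u (z.2, z.1)).
Proof. by apply: bounded_meas_comp; exact: measurable_swap. Qed.

Lemma bounded_meas_integrable2 (m : {finite_measure set T1 -> \bar R}) u :
  bounded_meas u -> (m \x m2)%E.-integrable setT (EFin \o u).
Proof.
move=> [mu [M uM]]; apply: measurable_bounded_integrable => //.
  rewrite -setXTT /= product_measure1E//.
  by rewrite lte_mul_pinfty ?fin_num_fun_lty//; exact: fin_num_measure.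
by exists M; split; [exact: num_real|move=> N MN x _ /=; exact: le_trans (ltW MN)].
Qed.

Lemma bounded_meas_int u : bounded_meas u ->
  bounded_meas (fun x => \int[m2]_y u (x, y)).
Proof.
move=> bu; split.
  apply/measurable_EFinP.
  have -> : EFin \o (fun x => \int[m2]_y u (x, y)) = fubini_F m2 (EFin \o u).
    apply/funext => x /=; rewrite EFin_Rintegralb//.
    exact: bounded_meas_slice1.
  exact: (measurable_fubini_F (bounded_meas_integrable2 mzero bu)).
have [_ [M uM]] := bu.
exists (M * fine (m2 setT)) => x.
apply: (le_trans (le_norm_Rintegralb _ (bounded_meas_slice1 _ bu))).
rewrite -Rintegral_cst//; apply: le_Rintegralb => //.
  by apply: bounded_meas_norm; exact: bounded_meas_slice1.
exact: bounded_meas_cst.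
Qed.

Lemma RFubini u : bounded_meas u ->
  \int[m1]_x \int[m2]_y u (x, y) = \int[m2]_y \int[m1]_x u (x, y).
Proof.
move=> bu.
have : (\int[m1]_x \int[m2]_y ((EFin \o u) (x, y)) =
        \int[m2]_y \int[m1]_x ((EFin \o u) (x, y)))%E.
  by apply: Fubini; exact: (bounded_meas_integrable2 m1).
move=> /(congr1 fine) H.
rewrite /Rintegral; move: H; congr (fine _ = fine _).
  by apply: eq_integral => x _; rewrite fineK// -EFin_Rintegralb//; exact: bounded_meas_slice1.
by apply: eq_integral => x _; rewrite fineK// -EFin_Rintegralb//; exact: bounded_meas_slice2.
Qed.

End Product.

End BoundedMeasurable.

(** * Bilinear forms and the method of squaring the adjoint *)

Section TTstar.
Context {R : realType} d1 d2 (T1 : measurableType d1) (T2 : measurableType d2).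
Variables (m1 : {finite_measure set T1 -> \bar R})
          (m2 : {finite_measure set T2 -> \bar R}).
Implicit Types u : T1 * T2 -> R.

Definition bform u (f : T2 -> R) (g : T1 -> R) : R :=
  \int[m1]_x \int[m2]_y (u (x, y) * f y * g x).

Let bounded_meas_form u f g : bounded_meas u -> bounded_meas f ->
  bounded_meas g -> bounded_meas (fun z : T1 * T2 => u z * f z.2 * g z.1).
Proof.
move=> bu bf bg; apply: bounded_measM; last exact: bounded_meas_fst.
by apply: bounded_measM => //; exact: bounded_meas_snd.
Qed.

Lemma bformDr u f g1 g2 : bounded_meas u -> bounded_meas f ->
  bounded_meas g1 -> bounded_meas g2 ->
  bform u f (fun x => g1 x + g2 x) = bform u f g1 + bform u f g2.
Proof.
move=> bu bf bg1 bg2.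
rewrite /bform -RintegralDb; last 2 first.
- exact: (bounded_meas_int m2 (bounded_meas_form bu bf bg1)).
- exact: (bounded_meas_int m2 (bounded_meas_form bu bf bg2)).
apply: eq_Rintegral => x _; rewrite -RintegralDb; last 2 first.
- exact: (bounded_meas_slice1 x (bounded_meas_form bu bf bg1)).
- exact: (bounded_meas_slice1 x (bounded_meas_form bu bf bg2)).
by apply: eq_Rintegral => y _; rewrite mulrDr.
Qed.

Lemma bform_scale u f g s t : bounded_meas u -> bounded_meas f ->
  bounded_meas g ->
  bform u (fun y => s * f y) (fun x => t * g x) = s * t * bform u f g.
Proof.
move=> bu bf bg.
rewrite /bform -RintegralZb; last first.
  exact: (bounded_meas_int m2 (bounded_meas_form bu bf bg)).
apply: eq_Rintegral => x _; rewrite -RintegralZb; last first.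
  exact: (bounded_meas_slice1 x (bounded_meas_form bu bf bg)).
by apply: eq_Rintegral => y _; ring.
Qed.

Lemma bform_le_norm1 u f g M : bounded_meas u -> bounded_meas f ->
  bounded_meas g -> (forall z, `|u z| <= M) ->
  `|bform u f g| <= M * (\int[m2]_y `|f y|) * (\int[m1]_x `|g x|).
Proof.
move=> bu bf bg uM; have bz := bounded_meas_form bu bf bg.
have bF := bounded_meas_norm bf; have bG := bounded_meas_norm bg.
apply: (le_trans (le_norm_Rintegralb _ (bounded_meas_int m2 bz))).
rewrite -RintegralZb//; apply: le_Rintegralb.
- exact/bounded_meas_norm/(bounded_meas_int m2 bz).
- by apply: bounded_measM => //; exact: bounded_meas_cst.
move=> x; apply: (le_trans (le_norm_Rintegralb _ (bounded_meas_slice1 x bz))).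
rewrite mulrAC -RintegralZb//; apply: le_Rintegralb.
- exact/bounded_meas_norm/(bounded_meas_slice1 x bz).
- by apply: bounded_measM => //; exact: bounded_meas_cst.
by move=> y /=; rewrite !normrM mulrAC ler_wpM2r// ler_wpM2r.
Qed.

Lemma bform_swap u f g : bounded_meas u -> bounded_meas f -> bounded_meas g ->
  bform u f g = \int[m2]_y \int[m1]_x (u (x, y) * g x * f y).
Proof.
move=> bu bf bg; rewrite /bform (RFubini m1 m2 (bounded_meas_form bu bf bg)).
by apply: eq_Rintegral => y _; apply: eq_Rintegral => x _ /=; ring.
Qed.

Variables (uc us : T1 * T2 -> R).
Hypotheses (buc : bounded_meas uc) (bus : bounded_meas us).

Let L (z : T1 * T1) : R :=
  \int[m2]_y (uc (z.1, y) * uc (z.2, y) + us (z.1, y) * us (z.2, y)).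

Let adj u g y := \int[m1]_x (u (x, y) * g x).

Let bounded_meas_adj u g : bounded_meas u -> bounded_meas g ->
  bounded_meas (adj u g).
Proof.
move=> bu bg.
apply: (bounded_meas_int m1 (u := fun z : T2 * T1 => u (z.2, z.1) * g z.2)).
apply: bounded_measM; first exact: bounded_meas_swap.
exact: bounded_meas_snd.
Qed.

Let bounded_meas_prod (u : T1 * T2 -> R) : bounded_meas u ->
  bounded_meas (fun w : (T1 * T1) * T2 => u (w.1.1, w.2) * u (w.1.2, w.2)).
Proof.
move=> bu; apply: bounded_measM.
- apply: (bounded_meas_comp (h := fun w : (T1 * T1) * T2 => (w.1.1, w.2)) _ bu).
  by apply: measurable_fun_pair => //; apply: measurableT_comp.
- apply: (bounded_meas_comp (h := fun w : (T1 * T1) * T2 => (w.1.2, w.2)) _ bu).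
  by apply: measurable_fun_pair => //; apply: measurableT_comp.
Qed.

Let bounded_meas_L : bounded_meas L.
Proof.
apply: (bounded_meas_int m2 (u := fun w : (T1 * T1) * T2 =>
  uc (w.1.1, w.2) * uc (w.1.2, w.2) + us (w.1.1, w.2) * us (w.1.2, w.2))).
by apply: bounded_measD; exact: bounded_meas_prod.
Qed.

Let bounded_meas_row u x : bounded_meas u ->
  bounded_meas (fun z : T1 * T2 => u (x, z.2)).
Proof.
by move=> bu; exact: (bounded_meas_snd T1 (bounded_meas_slice1 x bu)).
Qed.

Let bounded_meas_pair u g x : bounded_meas u -> bounded_meas g ->
  bounded_meas (fun z : T1 * T2 => u (x, z.2) * u z * 1 * g z.1).
Proof.
move=> bu bg.
apply: (@bounded_meas_form (fun z => u (x, z.2) * u z) (fun=> 1)) => //.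
  by apply: bounded_measM => //; exact: bounded_meas_row.
exact: bounded_meas_cst.
Qed.

Let adj_sqr u g : bounded_meas u -> bounded_meas g ->
  \int[m2]_y (adj u g y ^+ 2) =
  \int[m1]_x \int[m1]_x' ((\int[m2]_y (u (x, y) * u (x', y))) * (g x * g x')).
Proof.
move=> bu bg; have bh := bounded_meas_adj bu bg.
transitivity (\int[m2]_y \int[m1]_x (u (x, y) * g x * adj u g y)).
  apply: eq_Rintegral => y _; rewrite expr2 -RintegralZb.
    by apply: eq_Rintegral => x _; ring.
  by apply: bounded_measM => //; exact: bounded_meas_slice2.
rewrite -bform_swap//; apply: eq_Rintegral => x _.
transitivity (g x * bform (fun z => u (x, z.2) * u z) (fun=> 1) g).
  rewrite /bform -RintegralZb; last first.
    exact: (bounded_meas_int m2 (bounded_meas_pair x bu bg)).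
  transitivity (g x * \int[m2]_y (u (x, y) * adj u g y)).
    rewrite -RintegralZb; last first.
      by apply: bounded_measM => //; exact: bounded_meas_slice1.
    by apply: eq_Rintegral => y _; ring.
  rewrite RintegralZb; last first.
    exact: (bounded_meas_int m2 (bounded_meas_pair x bu bg)).
  congr (_ * _).
  have := @bform_swap (fun z => u (x, z.2) * u z) (fun=> 1) g.
  rewrite {1}/bform => -> //; first last.
  - exact: bounded_meas_cst.
  - by apply: bounded_measM => //; exact: bounded_meas_row.
  apply: eq_Rintegral => y _; rewrite -RintegralZb; last first.
    by apply: bounded_measM => //; exact: bounded_meas_slice2.
  by apply: eq_Rintegral => x' _ /=; ring.
rewrite /bform -RintegralZb; last first.
  exact: (bounded_meas_int m2 (bounded_meas_pair x bu bg)).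
apply: eq_Rintegral => x' _ /=.
have -> : \int[m2]_y (u (x, y) * u (x', y) * 1 * g x') =
    g x' * \int[m2]_y (u (x, y) * u (x', y)).
  rewrite -RintegralZb; last by apply: bounded_measM; exact: bounded_meas_slice1.
  by apply: eq_Rintegral => y _ /=; ring.
by ring.
Qed.

(** The form with kernel [uc] alone is controlled by the pair [(uc, us)]: for a
    real [g] the integral of the sum of the two squared adjoints has kernel [L],
    in which the products of sines and cosines combine into the cosine of a
    phase difference.  As [L] is symmetric, one bound on the integrals of its
    rows suffices for Schur's test. *)
Lemma bform_TTstar B f g : 0 <= B -> bounded_meas f -> bounded_meas g ->
  (forall x, \int[m1]_x' `|\int[m2]_y (uc (x, y) * uc (x', y) + us (x, y) * us (x', y))| <= B) ->
  bform uc f g ^+ 2 <= B * (\int[m2]_y (f y ^+ 2)) * (\int[m1]_x (g x ^+ 2)).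
Proof.
move=> B0 bf bg LB.
have bhc := bounded_meas_adj buc bg; have bhs := bounded_meas_adj bus bg.
have -> : bform uc f g = \int[m2]_y (f y * adj uc g y).
  rewrite bform_swap//; apply: eq_Rintegral => y _; rewrite -RintegralZb.
    by apply: eq_Rintegral => x _; ring.
  by apply: bounded_measM => //; exact: bounded_meas_slice2.
apply: (le_trans (Rintegral_cauchy_schwarz _ bf bhc)).
rewrite [B * _]mulrC -mulrA ler_wpM2l//.
  by apply: Rintegral_ge0 => y _; exact: sqr_ge0.
have bg2 := bounded_meas_sqr bg.
have bgg : bounded_meas (fun z : T1 * T1 => g z.1 * g z.2).
  by apply: bounded_measM; [exact: bounded_meas_fst|exact: bounded_meas_snd].
have bLgg : bounded_meas (fun z : T1 * T1 => L z * (g z.1 * g z.2)).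
  by apply: bounded_measM.
have bL2 : bounded_meas (fun z : T1 * T1 => `|L z| * (g z.1 ^+ 2)).
  apply: bounded_measM; first exact: bounded_meas_norm.
  exact: (bounded_meas_fst T1 bg2).
have bint2 u x x' : bounded_meas u ->
    bounded_meas (fun y => u (x, y) * u (x', y) : R).
  by move=> bu; apply: bounded_measM; exact: bounded_meas_slice1.
have -> : \int[m2]_y (adj uc g y ^+ 2) =
  \int[m2]_y (adj uc g y ^+ 2 + adj us g y ^+ 2) - \int[m2]_y (adj us g y ^+ 2).
  by rewrite RintegralDb ?addrK//; exact: bounded_meas_sqr.
apply: (@le_trans _ _ (\int[m2]_y (adj uc g y ^+ 2 + adj us g y ^+ 2))).
  by rewrite lerBlDr lerDl; apply: Rintegral_ge0 => y _; exact: sqr_ge0.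
rewrite RintegralDb; [|exact: bounded_meas_sqr..].
rewrite !adj_sqr// -RintegralDb; last 2 first.
- apply: (bounded_meas_int m1 (u := fun z : T1 * T1 =>
   (\int[m2]_y (uc (z.1, y) * uc (z.2, y))) * (g z.1 * g z.2))).
  apply: bounded_measM => //.
  exact: (bounded_meas_int m2 (bounded_meas_prod buc)).
- apply: (bounded_meas_int m1 (u := fun z : T1 * T1 =>
   (\int[m2]_y (us (z.1, y) * us (z.2, y))) * (g z.1 * g z.2))).
  apply: bounded_measM => //.
  exact: (bounded_meas_int m2 (bounded_meas_prod bus)).
apply: (@le_trans _ _ (\int[m1]_x \int[m1]_x' (L (x, x') * (g x * g x')))).
  rewrite le_eqVlt; apply/orP; left; apply/eqP.
  apply: eq_Rintegral => x _; rewrite -RintegralDb; last 2 first.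
  - apply: (bounded_meas_slice1 x (u := fun z : T1 * T1 =>
     (\int[m2]_y (uc (z.1, y) * uc (z.2, y))) * (g z.1 * g z.2))).
    apply: bounded_measM => //.
    exact: (bounded_meas_int m2 (bounded_meas_prod buc)).
  - apply: (bounded_meas_slice1 x (u := fun z : T1 * T1 =>
     (\int[m2]_y (us (z.1, y) * us (z.2, y))) * (g z.1 * g z.2))).
    apply: bounded_measM => //.
    exact: (bounded_meas_int m2 (bounded_meas_prod bus)).
  apply: eq_Rintegral => x' _; rewrite -mulrDl; congr (_ * _).
  by rewrite -RintegralDb//; exact: bint2.
have L_sym x x' : L (x, x') = L (x', x).
  by apply: eq_Rintegral => y _ /=; ring.
have bLx : bounded_meas (fun x => \int[m1]_x' (`|L (x, x')| * g x ^+ 2)).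
  exact: (bounded_meas_int m1 bL2).
have bL2' : bounded_meas (fun z : T1 * T1 => `|L z| * (g z.2 ^+ 2)).
  apply: bounded_measM; first exact: bounded_meas_norm.
  exact: (bounded_meas_snd T1 bg2).
have H1 : \int[m1]_x \int[m1]_x' (`|L (x, x')| * g x ^+ 2) <= B * \int[m1]_x (g x ^+ 2).
  rewrite -RintegralZb//; apply: le_Rintegralb => //.
    by apply: bounded_measM => //; exact: bounded_meas_cst.
  move=> x; under eq_Rintegral do rewrite mulrC.
  rewrite RintegralZb; last exact/bounded_meas_norm/bounded_meas_slice1.
  by rewrite mulrC ler_wpM2r ?sqr_ge0//; exact: LB.
have H2 : \int[m1]_x \int[m1]_x' (`|L (x, x')| * g x' ^+ 2) <= B * \int[m1]_x (g x ^+ 2).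
  rewrite (RFubini m1 m1 bL2').
  apply: le_trans H1; rewrite le_eqVlt; apply/orP; left; apply/eqP.
  by apply: eq_Rintegral => x _; apply: eq_Rintegral => x' _ /=; rewrite L_sym.
apply: (@le_trans _ _ (2^-1 * (\int[m1]_x \int[m1]_x' (`|L (x, x')| * g x ^+ 2) +
   \int[m1]_x \int[m1]_x' (`|L (x, x')| * g x' ^+ 2)))); last by lra.
rewrite -RintegralDb//; last exact: (bounded_meas_int m1 bL2').
have bsum : bounded_meas (fun z : T1 * T1 => 2^-1 * (`|L z| * g z.1 ^+ 2 + `|L z| * g z.2 ^+ 2)).
  by apply: bounded_measM; [exact: bounded_meas_cst|exact: bounded_measD].
have -> : 2^-1 * \int[m1]_x (\int[m1]_x' (`|L (x, x')| * g x ^+ 2) +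
     \int[m1]_x' (`|L (x, x')| * g x' ^+ 2)) =
  \int[m1]_x \int[m1]_x' (2^-1 * (`|L (x, x')| * g x ^+ 2 + `|L (x, x')| * g x' ^+ 2)).
  rewrite -RintegralZb; last first.
    by apply: bounded_measD => //; exact: (bounded_meas_int m1 bL2').
  apply: eq_Rintegral => x _; rewrite -RintegralDb; last 2 first.
  - exact: (bounded_meas_slice1 x bL2).
  - exact: (bounded_meas_slice1 x bL2').
  rewrite -RintegralZb//.
  exact: (bounded_meas_slice1 x (bounded_measD bL2 bL2')).
apply: le_Rintegralb.
- exact: (bounded_meas_int m1 bLgg).
- exact: (bounded_meas_int m1 bsum).
move=> x; apply: le_Rintegralb.
- exact: (bounded_meas_slice1 x bLgg).
- exact: (bounded_meas_slice1 x bsum).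
move=> x'; rewrite -mulrDr [2^-1 * _]mulrCA.
apply: (le_trans (ler_norm _)); rewrite normrM ler_wpM2l//.
have := sqr_ge0 (`|g x| - `|g x'|); rewrite -[g x ^+ 2]real_normK ?num_real//.
rewrite -[g x' ^+ 2]real_normK ?num_real// normrM; nra.
Qed.

End TTstar.

(** * Interpolation between a sup bound on the kernel and a square-integral bound *)

Section Interpolation.
Context {R : realType}.

Lemma powR_pred (t x q : R) : 0 < t -> t <= x -> 1 <= q -> x <= t `^ (1 - q) * x `^ q.
Proof.
move=> t0 tx q1; have x0 : 0 < x by exact: lt_le_trans tx.
have -> : x = x `^ (1 - q) * x `^ q :> R.
  by rewrite -powRD ?(gt_eqF x0) ?implybT// subrK powRr1// ltW.
rewrite -powRD ?(gt_eqF x0) ?implybT// subrK powRr1 ?(ltW x0)//.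
have {1}-> : x = x `^ (1 - q) * x `^ q :> R.
  by rewrite -powRD ?(gt_eqF x0) ?implybT// subrK powRr1// ltW.
rewrite ler_wpM2r ?powR_ge0//.
have E z : z `^ (1 - q) = (z `^ (q - 1))^-1 by rewrite -powRN opprB.
rewrite !E lef_pV2 ?posrE ?powR_gt0//.
by rewrite ge0_ler_powR// ?subr_ge0// nnegrE ltW.
Qed.

Lemma sqr_le_powR (t x q : R) : 0 < t -> 0 <= x -> x <= t -> 0 < q -> q <= 2 ->
  x ^+ 2 <= t `^ (2 - q) * x `^ q.
Proof.
move=> t0; rewrite le_eqVlt => /predU1P[<-|x0] xt q0 q2.
  by rewrite expr0n/= mulr_ge0// powR_ge0.
have -> : x ^+ 2 = x `^ (2 - q) * x `^ q :> R.
  by rewrite -powRD ?(gt_eqF x0) ?implybT// subrK powR_mulrn// ltW.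
by rewrite ler_wpM2r ?powR_ge0// ge0_ler_powR ?subr_ge0// nnegrE ltW.
Qed.

Lemma ler_1powR (x p : R) : 0 <= x -> 1 <= p -> x <= 1 + x `^ p.
Proof.
move=> x0 p1; have [x1|x1] := leP x 1.
  by rewrite (le_trans x1)// lerDl powR_ge0.
rewrite (@le_trans _ _ (x `^ p))// ?lerDr//.
by rewrite -{1}[x]powRr1// ler_powR// ltW.
Qed.

Section Abstract.
Context d1 d2 (T1 : measurableType d1) (T2 : measurableType d2).
Variables (m1 : {finite_measure set T1 -> \bar R})
          (m2 : {finite_measure set T2 -> \bar R}).
Variables (b : (T2 -> R) -> (T1 -> R) -> R) (del M C theta p q : R).
Hypotheses (del0 : 0 < del) (M0 : 0 <= M) (C0 : 0 <= C)
  (theta0 : 0 < theta) (theta1 : theta <= 1).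
Hypotheses (m2del : fine (m2 setT) <= del).
Hypothesis bD : forall f g1 g2, bounded_meas f -> bounded_meas g1 ->
  bounded_meas g2 -> b f (fun x => g1 x + g2 x) = b f g1 + b f g2.
Hypothesis bZ : forall f g s t, bounded_meas f -> bounded_meas g ->
  b (fun y => s * f y) (fun x => t * g x) = s * t * b f g.
Hypothesis b1 : forall f g, bounded_meas f -> bounded_meas g ->
  `|b f g| <= M * (\int[m2]_y `|f y|) * (\int[m1]_x `|g x|).
Hypothesis b2 : forall f g, bounded_meas f -> bounded_meas g ->
  b f g ^+ 2 <= (C * M * del) ^+ 2 * theta *
    (\int[m2]_y (f y ^+ 2)) * (\int[m1]_x (g x ^+ 2)).
Hypotheses (p2 : 2 <= p) (q1 : 1 < q) (q2 : q <= 2) (pq : p^-1 + q^-1 = 1).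

(* [g] is split at the height [t] at which both parts give [theta ^ (1 / p)]:
   the part below [t] is measured in [L^2], the part above it in [L^1]. *)
Let normalized f g : bounded_meas f -> bounded_meas g ->
  \int[m2]_y (`|f y| `^ p) <= del -> \int[m1]_x (`|g x| `^ q) <= del ->
  `|b f g| <= (2 + 2 * C) * M * del ^+ 2 * theta `^ p^-1.
Proof.
move=> bf bg Fd Gd.
have q0 : 0 < q by exact: lt_trans q1.
have p0 : 0 < p by exact: lt_le_trans p2.
have p1 : 1 <= p by rewrite (le_trans _ p2)// ler1n.
pose t := theta `^ (- q^-1).
have t0 : 0 < t by rewrite powR_gt0.
pose A := [set x | `|g x| <= t].
have mA : measurable A.
  rewrite -[A]setTI; have [mg _] := bounded_meas_norm bg.
  rewrite (_ : A = (fun x => `|g x|) @^-1` `]-oo, t]); first exact: mg.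
  by apply/seteqP; split => x /=; rewrite in_itv.
pose g1 x := \1_A x * g x; pose g2 x := (1 - \1_A x) * g x.
have bA : bounded_meas (\1_A : T1 -> R) by exact: bounded_meas_indic.
have bg1 : bounded_meas g1 by exact: bounded_measM.
have bg2 : bounded_meas g2.
  by apply: bounded_measM => //; apply: bounded_measB => //; exact: bounded_meas_cst.
have gE : g = (fun x => g1 x + g2 x).
  by apply/funext => x; rewrite /g1 /g2 -mulrDl addrCA subrr addr0 mul1r.
have bfp : bounded_meas (fun y => `|f y| `^ p) by apply: bounded_meas_powR => //; exact: ltW.
have bgq : bounded_meas (fun x => `|g x| `^ q) by apply: bounded_meas_powR => //; exact: ltW.
have bf1 : bounded_meas (fun y => 1 + `|f y| `^ p).
  by apply: bounded_measD => //; exact: bounded_meas_cst.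
have int1f : \int[m2]_y (1 + `|f y| `^ p) <= 2 * del.
  rewrite RintegralDb//; last exact: bounded_meas_cst.
  by rewrite Rintegral_cst// mul1r mulr_natl mulr2n lerD.
have intf : \int[m2]_y `|f y| <= 2 * del.
  apply: le_trans int1f; apply: le_Rintegralb => //; first exact: bounded_meas_norm.
  by move=> y; exact: ler_1powR.
have intf2 : \int[m2]_y (f y ^+ 2) <= 2 * del.
  apply: le_trans int1f; apply: le_Rintegralb => //; first exact: bounded_meas_sqr.
  move=> y; have -> : `|f y| `^ p = (f y ^+ 2) `^ (p / 2).
    rewrite -[f y ^+ 2]real_normK ?num_real// -powR_mulrn// -powRrM.
    by rewrite mulrCA divff ?mulr1.
  by apply: ler_1powR; rewrite ?sqr_ge0// ler_pdivlMr// mul1r.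
have intg2 : \int[m1]_x `|g2 x| <= t `^ (1 - q) * del.
  apply: le_trans (_ : t `^ (1 - q) * \int[m1]_x (`|g x| `^ q) <= _); last first.
    by rewrite ler_wpM2l// powR_ge0.
  rewrite -RintegralZb//; apply: le_Rintegralb; first exact: bounded_meas_norm.
    by apply: bounded_measM => //; exact: bounded_meas_cst.
  move=> x; rewrite /g2 indicE; case: (boolP (x \in A)).
    by move=> /= _; rewrite subrr mul0r normr0 mulr_ge0// powR_ge0.
  rewrite notin_setE /A/= => /negP; rewrite -ltNge => tg.
  by rewrite subr0 mul1r powR_pred// ltW.
have intg1 : \int[m1]_x (g1 x ^+ 2) <= t `^ (2 - q) * del.
  apply: le_trans (_ : t `^ (2 - q) * \int[m1]_x (`|g x| `^ q) <= _); last first.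
    by rewrite ler_wpM2l// powR_ge0.
  rewrite -RintegralZb//; apply: le_Rintegralb; first exact: bounded_meas_sqr.
    by apply: bounded_measM => //; exact: bounded_meas_cst.
  move=> x; rewrite /g1 indicE; case: (boolP (x \in A)); last first.
    by move=> /= _; rewrite mul0r expr0n/= mulr_ge0// powR_ge0.
  rewrite inE /A/= => tg; rewrite mul1r -[g x ^+ 2]real_normK ?num_real//.
  exact: sqr_le_powR.
have th1 : t `^ (1 - q) = theta `^ p^-1.
  rewrite -powRrM; congr (_ `^ _).
  have -> : p^-1 = 1 - q^-1 by rewrite -pq addrK.
  by field; rewrite gt_eqF.
have th2 : theta * t `^ (2 - q) = (theta `^ p^-1) ^+ 2.
  rewrite -powR_mulrn ?powR_ge0// -powRrM -{1}[theta]powRr1 ?ltW// -powRrM.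
  rewrite -powRD ?(gt_eqF theta0) ?implybT//; congr (_ `^ _).
  have -> : p^-1 = 1 - q^-1 by rewrite -pq addrK.
  by field; rewrite gt_eqF.
rewrite [in b f g]gE bD//; apply: (le_trans (ler_normD _ _)).
have T0 : 0 <= theta `^ p^-1 by exact: powR_ge0.
set T := theta `^ p^-1 in th1 th2 T0 *.
have B2 : `|b f g2| <= 2 * M * del ^+ 2 * T.
  apply: (le_trans (b1 bf bg2)).
  have -> : 2 * M * del ^+ 2 * T = M * (2 * del) * (T * del) by ring.
  rewrite -th1; apply: ler_pM => //.
  - by rewrite mulr_ge0//; apply: Rintegral_ge0.
  - by apply: Rintegral_ge0.
  - by rewrite ler_wpM2l.
have B1 : `|b f g1| <= 2 * C * M * del ^+ 2 * T.
  have del1 := ltW del0.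
  rewrite -ler_sqr ?nnegrE ?mulr_ge0 ?sqr_ge0//.
  rewrite real_normK ?num_real//; apply: (le_trans (b2 bf bg1)).
  apply: (@le_trans _ _ ((C * M * del) ^+ 2 * theta * (2 * del) * (t `^ (2 - q) * del))).
    apply: ler_pM => //.
    - apply: mulr_ge0; first by rewrite mulr_ge0 ?sqr_ge0// ltW.
      by apply: Rintegral_ge0 => ? _; rewrite sqr_ge0.
    - by apply: Rintegral_ge0 => ? _; rewrite sqr_ge0.
    - by rewrite ler_wpM2l// mulr_ge0 ?sqr_ge0// ltW.
  have -> : (C * M * del) ^+ 2 * theta * (2 * del) * (t `^ (2 - q) * del) =
     2 * ((C * M * del ^+ 2) ^+ 2) * (theta * t `^ (2 - q)) by ring.
  rewrite th2.
  have -> : (2 * C * M * del ^+ 2 * T) ^+ 2 = 4 * ((C * M * del ^+ 2) ^+ 2) * T ^+ 2 by ring.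
  rewrite ler_wpM2r ?sqr_ge0// ler_wpM2r ?sqr_ge0//; lra.
have -> : (2 + 2 * C) * M * del ^+ 2 * T = 2 * C * M * del ^+ 2 * T + 2 * M * del ^+ 2 * T by ring.
exact: lerD.
Qed.

(** The normalized case applied to [s f] and [t g], where [s ^ p] and [t ^ q] both
    equal [del / (F + G)].  If [F + G = 0] the choice of [s] is free, and letting
    it grow forces [b f g = 0].  The form is abstract here because the case
    [p < 2] applies the result to the transposed form. *)
Lemma interpolation_ge2 f g : bounded_meas f -> bounded_meas g ->
  `|b f g| <= (2 + 2 * C) * M * del * theta `^ p^-1 *
    (\int[m2]_y (`|f y| `^ p) + \int[m1]_x (`|g x| `^ q)).
Proof.
move=> bf bg.
have q0 : 0 < q by exact: lt_trans q1.
have p0 : 0 < p by exact: lt_le_trans p2.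
have p1 : 1 <= p by rewrite (le_trans _ p2)// ler1n.
set F := \int[m2]_y _; set G := \int[m1]_x _.
have F0 : 0 <= F by apply: Rintegral_ge0 => ? _; exact: powR_ge0.
have G0 : 0 <= G by apply: Rintegral_ge0 => ? _; exact: powR_ge0.
set N := (2 + 2 * C) * M.
have N0 : 0 <= N by rewrite mulr_ge0// addr_ge0// mulr_ge0.
have T0 : 0 <= theta `^ p^-1 by exact: powR_ge0.
have bfp : bounded_meas (fun y => `|f y| `^ p) by apply: bounded_meas_powR => //; exact: ltW.
have bgq : bounded_meas (fun x => `|g x| `^ q) by apply: bounded_meas_powR => //; exact: ltW.
have key s t : 0 <= s -> 0 <= t -> s `^ p * F <= del -> t `^ q * G <= del ->
    s * t * `|b f g| <= N * del ^+ 2 * theta `^ p^-1.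
  move=> s0 t0 sF tG.
  have -> : s * t * `|b f g| = `|b (fun y => s * f y) (fun x => t * g x)|.
    by rewrite bZ// normrM ger0_norm// mulr_ge0.
  apply: normalized.
  - by apply: bounded_measM => //; exact: bounded_meas_cst.
  - by apply: bounded_measM => //; exact: bounded_meas_cst.
  - apply: le_trans sF; rewrite -RintegralZb//.
    rewrite le_eqVlt; apply/orP; left; apply/eqP; apply: eq_Rintegral => y _.
    by rewrite normrM powRM// (ger0_norm s0).
  - apply: le_trans tG; rewrite -RintegralZb//.
    rewrite le_eqVlt; apply/orP; left; apply/eqP; apply: eq_Rintegral => y _.
    by rewrite normrM powRM// (ger0_norm t0).
have [W0|W0] := eqVneq (F + G) 0.
  have [F1 G1] : F = 0 /\ G = 0 by split; lra.
  have [->|bn] := eqVneq (b f g) 0; first by rewrite normr0 W0 mulr0.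
  exfalso; have nb : 0 < `|b f g| by rewrite normr_gt0.
  have := key ((N * del ^+ 2 * theta `^ p^-1 + 1) / `|b f g|) 1.
  rewrite F1 G1 !mulr0 mulr1 divfK ?normr_eq0// => H.
  have : N * del ^+ 2 * theta `^ p^-1 + 1 <= N * del ^+ 2 * theta `^ p^-1.
    apply: H => //; try exact: ltW.
    by rewrite divr_ge0// addr_ge0// mulr_ge0// mulr_ge0// sqr_ge0.
  by lra.
have Wp : 0 < F + G by rewrite lt_def W0 addr_ge0.
have := key ((del / (F + G)) `^ p^-1) ((del / (F + G)) `^ q^-1).
have dW : 0 < del / (F + G) by rewrite divr_gt0.
rewrite -!powRrM !mulVf ?gt_eqF// !powRr1 ?(ltW dW)// => H.
have {}H := H (powR_ge0 _ _) (powR_ge0 _ _).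
rewrite -powRD ?(gt_eqF dW) ?implybT// pq powRr1 ?(ltW dW)// in H.
have {}H : del / (F + G) * `|b f g| <= N * del ^+ 2 * theta `^ p^-1.
  apply: H.
  - by rewrite mulrAC ler_pdivrMr// ler_wpM2l ?(ltW del0)// lerDl.
  - by rewrite mulrAC ler_pdivrMr// ler_wpM2l ?(ltW del0)// lerDr.
have -> : `|b f g| = (del / (F + G) * `|b f g|) * ((F + G) / del).
  by field; rewrite W0 gt_eqF.
have -> : N * del * theta `^ p^-1 * (F + G) =
  (N * del ^+ 2 * theta `^ p^-1) * ((F + G) / del) by field; rewrite gt_eqF.
by rewrite ler_wpM2r// divr_ge0// ltW.
Qed.

End Abstract.

Lemma bform_interpolation d1 d2 (T1 : measurableType d1) (T2 : measurableType d2)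
    (m1 : {finite_measure set T1 -> \bar R})
    (m2 : {finite_measure set T2 -> \bar R})
    (u : T1 * T2 -> R) (del M C theta p q : R) f g :
  0 < del -> 0 <= M -> 0 <= C -> 0 < theta -> theta <= 1 ->
  fine (m1 setT) <= del -> fine (m2 setT) <= del ->
  bounded_meas u -> (forall z, `|u z| <= M) ->
  (forall f g, bounded_meas f -> bounded_meas g ->
    bform m1 m2 u f g ^+ 2 <= (C * M * del) ^+ 2 * theta *
    (\int[m2]_y (f y ^+ 2)) * (\int[m1]_x (g x ^+ 2))) ->
  1 < p -> 1 < q -> p^-1 + q^-1 = 1 ->
  bounded_meas f -> bounded_meas g ->
  `|bform m1 m2 u f g| <= (2 + 2 * C) * M * del * theta `^ (Num.min p^-1 q^-1) *
    (\int[m2]_y (`|f y| `^ p) + \int[m1]_x (`|g x| `^ q)).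
Proof.
move=> d0 M0 C0 th0 th1 m1d m2d bu uM H2 p1 q1 pq bf bg.
have p0 : 0 < p by exact: lt_trans p1.
have q0 : 0 < q by exact: lt_trans q1.
have [p2|p2] := leP 2 p.
  have pV : p^-1 <= 2^-1 by rewrite lef_pV2 ?posrE.
  have -> : Num.min p^-1 q^-1 = p^-1 by apply/min_idPl; lra.
  apply: interpolation_ge2 => //.
  - by move=> *; exact: bformDr.
  - by move=> *; exact: bform_scale.
  - by move=> *; exact: bform_le_norm1.
  - by rewrite -[leRHS]invrK -[leLHS]invrK lef_pV2 ?posrE ?invr_gt0//; lra.
have pV : 2^-1 < p^-1 by rewrite ltf_pV2 ?posrE.
have -> : Num.min p^-1 q^-1 = q^-1 by apply/min_idPr; lra.
rewrite [_ + \int[m1]_x _]addrC.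
pose u' (z : T2 * T1) := u (z.2, z.1).
have bu' : bounded_meas u' by exact: bounded_meas_swap.
have swapE f' g' : bounded_meas f' -> bounded_meas g' ->
    bform m1 m2 u f' g' = bform m2 m1 u' g' f'.
  by move=> bf' bg'; rewrite bform_swap.
rewrite swapE//; apply: (interpolation_ge2 (b := bform m2 m1 u')) => //.
- by move=> *; exact: bformDr.
- by move=> *; exact: bform_scale.
- by move=> *; apply: bform_le_norm1 => // z; exact: uM.
- move=> f' g' bf' bg'; rewrite -swapE//.
  by apply: (le_trans (H2 _ _ bg' bf')); rewrite mulrAC.
- by rewrite -[leRHS]invrK -[leLHS]invrK lef_pV2 ?posrE ?invr_gt0//; lra.
- exact: ltW.
- by rewrite addrC.
Qed.

End Interpolation.

(** * An oscillatory integral without stationary points *)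

Section VanDerCorput.
Context {R : realType}.
Local Notation mu := (@lebesgue_measure R).

Lemma is_derive1_continuous (f : R -> R) (x df : R) :
  is_derive x 1 f df -> {for x, continuous f}.
Proof.
move=> fx; apply: differentiable_continuous; apply/derivable1_diffP.
by case: fx.
Qed.

(** One integration by parts against [sin phi / phi'].  The amplitude is not
    assumed to vanish at the end points, hence the boundary term [2 * M]. *)
Lemma van_der_corput (phi phi1 phi2 A A1 : R -> R) (y0 y1 rho kappa M M1 : R) :
  y0 < y1 -> 0 < rho -> 0 <= kappa ->
  (forall y, y0 <= y <= y1 -> is_derive y 1 phi (phi1 y)) ->
  (forall y, y0 <= y <= y1 -> is_derive y 1 phi1 (phi2 y)) ->
  (forall y, y0 <= y <= y1 -> is_derive y 1 A (A1 y)) ->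
  (forall y, y0 <= y <= y1 -> {for y, continuous phi2}) ->
  (forall y, y0 <= y <= y1 -> {for y, continuous A1}) ->
  (forall y, y0 <= y <= y1 -> rho <= `|phi1 y|) ->
  (forall y, y0 <= y <= y1 -> `|phi2 y| <= kappa * `|phi1 y|) ->
  (forall y, y0 <= y <= y1 -> `|A y| <= M) ->
  (forall y, y0 <= y <= y1 -> `|A1 y| <= M1) ->
  `|\int[mu]_(y in `[y0, y1]) (cos (phi y) * A y)| <=
    (2 * M + (y1 - y0) * (M1 + kappa * M)) / rho.
Proof.
move=> y01 rho0 kappa0 dphi dphi1 dA cphi2 cA1 phi1rho phi2k AM A1M.
have nz y : y0 <= y <= y1 -> phi1 y != 0.
  by move=> yy; rewrite -normr_gt0 (lt_le_trans rho0)// phi1rho.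
pose F y := sin (phi y) * A y * (phi1 y)^-1.
pose r y := sin (phi y) * (A1 y / phi1 y - A y * phi2 y / (phi1 y) ^+ 2).
pose h y := cos (phi y) * A y.
have dF y : y0 <= y <= y1 -> is_derive y 1 F (h y + r y).
  move=> yy; have := dphi _ yy; have := dphi1 _ yy; have := dA _ yy.
  move=> dAy dp1 dp; have nzy := nz _ yy.
  have dsin : is_derive y 1 (sin \o phi) (cos (phi y) * phi1 y).
    exact: is_derive1_comp.
  have dinv : is_derive y 1 (fun y => (phi1 y)^-1) (- phi1 y ^- 2 *: phi2 y).
    exact: (is_deriveV nzy dp1).
  apply: (is_derive_eq (is_deriveM (is_deriveM dsin dAy) dinv)).
  rewrite /h /r /GRing.scale/=.
  have -> : ((sin \o phi) * A) y = sin (phi y) * A y by [].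
  by field.
have cphi y : y0 <= y <= y1 -> {for y, continuous phi}.
  by move=> yy; exact: is_derive1_continuous (dphi _ yy).
have cphi1 y : y0 <= y <= y1 -> {for y, continuous phi1}.
  by move=> yy; exact: is_derive1_continuous (dphi1 _ yy).
have cA y : y0 <= y <= y1 -> {for y, continuous A}.
  by move=> yy; exact: is_derive1_continuous (dA _ yy).
have ch y : y0 <= y <= y1 -> {for y, continuous h}.
  move=> yy; apply: continuousM; last exact: cA.
  by apply: continuous_comp; [exact: cphi|exact: continuous_cos].
have cr y : y0 <= y <= y1 -> {for y, continuous r}.
  move=> yy; apply: continuousM.
    by apply: continuous_comp; [exact: cphi|exact: continuous_sin].
  apply: continuousB.
    apply: continuousM; first exact: cA1.
    by apply: continuousV; [exact: nz|exact: cphi1].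
  apply: continuousM; first by apply: continuousM; [exact: cA|exact: cphi2].
  apply: continuousV; first by rewrite expf_neq0// nz.
  by apply: continuousM; exact: cphi1.
have wc (f : R -> R) : (forall y, y0 <= y <= y1 -> {for y, continuous f}) ->
    {within `[y0, y1], continuous f}.
  move=> cf; have H : {in `[y0, y1]%classic, continuous f}.
    by move=> y; rewrite inE/= in_itv/=; exact: cf.
  exact: continuous_in_subspaceT.
have int (f : R -> R) : (forall y, y0 <= y <= y1 -> {for y, continuous f}) ->
    mu.-integrable `[y0, y1] (EFin \o f).
  move=> cf; apply: continuous_compact_integrable; first exact: segment_compact.
  exact: wc.
have FTC : \int[mu]_(y in `[y0, y1]) (h y + r y) = F y1 - F y0.
  rewrite /Rintegral (@continuous_FTC2 _ (fun y => h y + r y) F)//.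
  - by apply: wc => y yy; apply: continuousD; [exact: ch|exact: cr].
  - split.
    + move=> y; rewrite in_itv/= => /andP[yy yy']; have := dF y.
      by rewrite !ltW//= => /(_ isT) [].
    + apply: cvg_at_right_filter; apply: (is_derive1_continuous (dF _ _)).
      by rewrite lexx ltW.
    + apply: cvg_at_left_filter; apply: (is_derive1_continuous (dF _ _)).
      by rewrite lexx ltW.
  - move=> y; rewrite in_itv/= => /andP[yy yy']; rewrite derive1E.
    by apply: derive_val; apply: dF; rewrite !ltW.
have bF y : y0 <= y <= y1 -> `|F y| <= M / rho.
  move=> yy; rewrite /F !normrM normfV.
  have p1 := phi1rho _ yy; have p2 := AM _ yy.
  have p3 : 0 < `|phi1 y| by exact: lt_le_trans p1.
  apply: ler_pM => //.
  - rewrite -[M]mul1r; apply: ler_pM => //.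
    by rewrite ler_norml sin_geN1 sin_le1.
  - by rewrite lef_pV2 ?posrE.
have br y : y0 <= y <= y1 -> `|r y| <= (M1 + kappa * M) / rho.
  move=> yy; rewrite /r normrM.
  have p1 := phi1rho _ yy; have p2 := AM _ yy; have p4 := A1M _ yy.
  have p5 := phi2k _ yy.
  have p3 : 0 < `|phi1 y| by exact: lt_le_trans p1.
  have nzy := nz _ yy.
  have M0 : 0 <= M by exact: le_trans p2.
  have M10 : 0 <= M1 by exact: le_trans p4.
  rewrite -[leRHS]mul1r; apply: ler_pM => //.
    by rewrite ler_norml sin_geN1 sin_le1.
  have -> : A1 y / phi1 y - A y * phi2 y / phi1 y ^+ 2 =
      (A1 y - A y * (phi2 y / phi1 y)) / phi1 y by field.
  rewrite normrM normfV; apply: ler_pM => //.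
    apply: (le_trans (ler_normB _ _)); apply: lerD => //.
    rewrite normrM mulrC; apply: ler_pM => //.
    by rewrite normrM normfV ler_pdivrMr.
  by rewrite lef_pV2 ?posrE.
have -> : \int[mu]_(y in `[y0, y1]) (cos (phi y) * A y) =
    F y1 - F y0 - \int[mu]_(y in `[y0, y1]) r y.
  by rewrite -FTC RintegralD ?addrK//; exact: int.
have yy0 : y0 <= y0 <= y1 by rewrite lexx ltW.
have yy1 : y0 <= y1 <= y1 by rewrite lexx ltW.
have Ir : `|\int[mu]_(y in `[y0, y1]) r y| <= (y1 - y0) * ((M1 + kappa * M) / rho).
  apply: (le_trans (le_normr_Rintegral _ (int _ cr))) => //.
  apply: (@le_trans _ _ (\int[mu]_(y in `[y0, y1]) ((M1 + kappa * M) / rho))).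
    apply: le_Rintegral => //.
    - by exact: (integrable_norm (int _ cr)).
    - by apply: int => y _; exact: cst_continuous.
  by rewrite Rintegral_cst//= lebesgue_measure_itv/= lte_fin y01/= mulrC.
apply: (le_trans (ler_normB _ _)).
have -> : (2 * M + (y1 - y0) * (M1 + kappa * M)) / rho =
  (M / rho + M / rho) + (y1 - y0) * ((M1 + kappa * M) / rho) by ring.
apply: lerD => //; apply: (le_trans (ler_normB _ _)).
by apply: lerD; exact: bF.
Qed.

End VanDerCorput.

(** * Factorization of the mixed derivative of the phase *)

Section PhaseStructure.
Context {R : realType}.
Local Open Scope complex_scope.
Local Notation normc := (@Normc.normc R).
Local Notation C := R[i].

Lemma normcD (z w : C) : normc (z + w) <= normc z + normc w.
Proof. exact: (@le_normcD R z w). Qed.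

Lemma normc_opp (z : C) : normc (- z) = normc z.
Proof. exact: (@normcN R z). Qed.

Lemma normcB (z w : C) : normc (z - w) <= normc z + normc w.
Proof. by rewrite (le_trans (normcD _ _))// normc_opp. Qed.

Lemma normc_ge0 (z : C) : 0 <= normc z.
Proof. by case: z => x y; exact: sqrtr_ge0. Qed.

Lemma normc_real (x : R) : normc x%:C = `|x|.
Proof. by rewrite /Normc.normc/= expr0n/= addr0 sqrtr_sqr. Qed.

Lemma real_complexB (x y : R) : x%:C - y%:C = (x - y)%:C.
Proof. by rewrite rmorphB. Qed.

Lemma normc_Re (z : C) : `|complex.Re z| <= normc z.
Proof.
case: z => x y; rewrite /Normc.normc/= -sqrtr_sqr ler_sqrt ?addr_ge0 ?sqr_ge0//.
by rewrite lerDl sqr_ge0.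
Qed.

Lemma normc_Im (z : C) : `|complex.Im z| <= normc z.
Proof.
case: z => x y; rewrite /Normc.normc/= -sqrtr_sqr ler_sqrt ?addr_ge0 ?sqr_ge0//.
by rewrite lerDr sqr_ge0.
Qed.

Lemma normc_le_ReIm (z : C) : normc z <= `|complex.Re z| + `|complex.Im z|.
Proof.
case: z => x y.
have -> : x +i* y = (x +i* 0) + (0 +i* y).
  by apply/eqP; rewrite eq_complex /= addr0 add0r !eqxx.
apply: (le_trans (normcD _ _)).
by rewrite /Normc.normc/= !expr0n/= !addr0 !add0r !sqrtr_sqr.
Qed.

Section Homogenization.
Variable F : comNzRingType.

(** The homogenization of [p], its second variable being kept formal: [S_xy] and
    [S_xyy] are then a value of this polynomial and of its derivative. *)
Definition homog m (p : {poly F}) (x : F) : {poly F} :=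
  \poly_(k < m.+1) (p`_k * x ^+ (m - k)).

Lemma homog_linear_factor m z (q : {poly F}) x : (size q <= m.+1)%N ->
  homog m.+1 (('X - z%:P) * q) x = ('X - (z * x)%:P) * homog m q x.
Proof.
move=> sq; apply/polyP => k.
rewrite coef_poly !mulrBl !coefB !coefXM !coefCM !coef_poly.
case: k => [|k] /=.
  rewrite !sub0r ?subn0 ?exprS.
  by ring.
rewrite !ltnS; have [km|mk] := leqP k m.
  rewrite subSS; have [km'|mk'] := ltnP k m; last first.
    have -> : k = m by apply/eqP; rewrite eqn_leq km.
    by rewrite subnn (nth_default 0 sq); ring.
  by rewrite -(subnSK km') exprS; ring.
by rewrite ltnNge (ltnW mk)/= mulr0 subr0.
Qed.

Lemma homog_prod (r : seq F) x :
  homog (size r) (\prod_(z <- r) ('X - z%:P)) x =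
  \prod_(z <- r) ('X - (z * x)%:P).
Proof.
elim: r => [|z r ih].
  rewrite !big_nil; apply/polyP => k; rewrite coef_poly/= ltnS leqn0 !coef1.
  by case: eqP => // ->; rewrite expr0 mulr1.
by rewrite !big_cons /= homog_linear_factor ?ih// size_prod_XsubC.
Qed.

End Homogenization.

(** The logarithmic derivative of a product of [size r] linear factors, none
    smaller than [del], is at most [size r / del]. *)
Lemma deriv_prod_bound (r : seq C) (x y del : R) : 0 < del ->
  (forall z, z \in r -> del <= normc (y%:C - z * x%:C)) ->
  let w := \prod_(z <- r) ('X - (z * x%:C)%:P) in
  del * normc w^`().[y%:C] <= (size r)%:R * normc w.[y%:C].
Proof.
move=> del0; elim: r => [|z r ih] H /=.
  by rewrite big_nil derivC hornerC Normc.normc0 !(mulr0, mul0r).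
rewrite big_cons derivM derivXsubC mul1r hornerD !hornerM !hornerXsubC.
set w := \prod_(_ <- _) _ in ih *.
have Hz : del <= normc (y%:C - z * x%:C) by apply: H; rewrite mem_head.
have {}ih : del * normc w^`().[y%:C] <= (size r)%:R * normc w.[y%:C].
  by apply: ih => t tr; apply: H; rewrite inE tr orbT.
apply: (@le_trans _ _ (del * (normc w.[y%:C] +
    normc (y%:C - z * x%:C) * normc w^`().[y%:C]))).
  by rewrite ler_pM2l// (le_trans (normcD _ _))// Normc.normcM.
rewrite Normc.normcM -natr1 mulrDr mulrDl mul1r addrC.
apply: lerD; last by rewrite ler_wpM2r// normc_ge0.
by rewrite mulrCA [leRHS]mulrCA ler_wpM2l// normc_ge0.
Qed.

(** Moving [x] by [del] changes the factor of slope [z] by at most [|z| del], hence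
    by a factor of at most [1 + |z|] when it is not smaller than [del]. *)
Lemma prod_ratio_bound (r : seq C) (x x' y del : R) : 0 < del ->
  `|x - x'| <= del ->
  (forall z, z \in r -> del <= normc (y%:C - z * x%:C)) ->
  normc (\prod_(z <- r) ('X - (z * x'%:C)%:P)).[y%:C] <=
  \prod_(z <- r) (1 + normc z) * normc (\prod_(z <- r) ('X - (z * x%:C)%:P)).[y%:C].
Proof.
move=> del0 xx'; elim: r => [|z r ih] H.
  by rewrite !big_nil mul1r.
rewrite !big_cons !hornerM !hornerXsubC !Normc.normcM mulrACA.
have Hz : del <= normc (y%:C - z * x%:C) by apply: H; rewrite mem_head.
apply: ler_pM; rewrite ?normc_ge0//; last first.
  by apply: ih => t tr; apply: H; rewrite inE tr orbT.
have -> : y%:C - z * x'%:C = (y%:C - z * x%:C) + z * (x - x')%:C.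
  by rewrite rmorphB/=; ring.
apply: (le_trans (normcD _ _)); rewrite mulrDl mul1r lerD2l.
rewrite Normc.normcM ler_wpM2l ?normc_ge0// normc_real.
exact: le_trans Hz.
Qed.

Lemma prod_lower_bound (r : seq C) (x y del : R) : 0 < del ->
  (forall z, z \in r -> del <= normc (y%:C - z * x%:C)) ->
  del ^+ size r <= normc (\prod_(z <- r) ('X - (z * x%:C)%:P)).[y%:C].
Proof.
move=> del0; elim: r => [|z r ih] H.
  by rewrite big_nil hornerC Normc.normc1.
rewrite big_cons hornerM hornerXsubC Normc.normcM/= exprS.
apply: ler_pM; [exact: ltW|by rewrite exprn_ge0// ltW|..].
  by apply: H; rewrite mem_head.
by apply: ih => t tr; apply: H; rewrite inE tr orbT.
Qed.

Section Phase.
Variables (m : nat) (a : nat -> R).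
Local Notation n := m.+2.

(** The partial derivatives [S_y], [S_yy], [S_xy] and [S_xyy] of the phase. *)
Definition phase_y (x y : R) : R :=
  \sum_(j < m.+1) (a j.+1 * j.+1%:R * y ^+ j) * x ^+ (m.+1 - j).
Definition phase_yy (x y : R) : R :=
  \sum_(j < m.+1) (a j.+1 * j.+1%:R * (j%:R * y ^+ j.-1)) * x ^+ (m.+1 - j).
Definition phase_xy (x y : R) : R :=
  \sum_(j < m.+1) (a j.+1 * j.+1%:R * y ^+ j) * ((m.+1 - j)%:R * x ^+ (m - j)).
Definition phase_xyy (x y : R) : R :=
  \sum_(j < m.+1) (a j.+1 * j.+1%:R * (j%:R * y ^+ j.-1)) *
    ((m.+1 - j)%:R * x ^+ (m - j)).

Let is_derive_Xn k (x : R) : is_derive x 1 (fun t : R => t ^+ k) (k%:R * x ^+ k.-1).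
Proof.
by apply: DeriveDef; [exact: exprn_derivable|rewrite exp_derive /GRing.scale/= mulr1].
Qed.

Let is_derive_powsum (N : nat) (e : 'I_N -> R) (k : 'I_N -> nat) (x : R) :
  is_derive x 1 (fun t => \sum_(j < N) e j * t ^+ k j)
    (\sum_(j < N) e j * ((k j)%:R * x ^+ (k j).-1)).
Proof.
have H j : is_derive x 1 (fun t : R => e j * t ^+ k j) (e j * ((k j)%:R * x ^+ (k j).-1)).
  exact: (is_deriveZ (e j) (is_derive_Xn (k j) x)).
have := is_derive_sum H.
by rewrite fct_sumE.
Qed.

Lemma is_derive_phase (x y : R) : is_derive y 1 (phase n a x) (phase_y x y).
Proof.
have -> : phase n a x = fun y => \sum_(j < m.+1) (a j.+1 * x ^+ (m.+1 - j)) * y ^+ j.+1.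
  apply/funext => t; rewrite /phase big_add1/= big_mkord.
  by apply: eq_bigr => j _; rewrite subSS.
apply: (is_derive_eq (is_derive_powsum (fun j => a j.+1 * x ^+ (m.+1 - j)) (fun j => j.+1) y)).
by apply: eq_bigr => j _ /=; ring.
Qed.

Lemma is_derive_phase_y (x y : R) : is_derive y 1 (phase_y x) (phase_yy x y).
Proof.
have -> : phase_y x = fun y => \sum_(j < m.+1)
    (a j.+1 * j.+1%:R * x ^+ (m.+1 - j)) * y ^+ j.
  by apply/funext => t; apply: eq_bigr => j _; ring.
apply: (is_derive_eq (is_derive_powsum
  (fun j => a j.+1 * j.+1%:R * x ^+ (m.+1 - j)) (fun j => j) y)).
by apply: eq_bigr => j _ /=; ring.
Qed.

Lemma continuous_phase_yy (x : R) : continuous (phase_yy x).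
Proof.
move=> y; have -> : phase_yy x = fun y => \sum_(j < m.+1)
    (a j.+1 * j.+1%:R * x ^+ (m.+1 - j) * j%:R) * y ^+ j.-1.
  by apply/funext => t; apply: eq_bigr => j _; ring.
apply: differentiable_continuous; apply/derivable1_diffP.
by have [] := is_derive_powsum (fun j : 'I_m.+1 => a j.+1 * j.+1%:R * x ^+ (m.+1 - j) * j%:R)
  (fun j => j.-1) y.
Qed.

Let is_derive_x_phase_y (x y : R) : is_derive x 1 (phase_y ^~ y) (phase_xy x y).
Proof.
apply: (is_derive_eq (is_derive_powsum (fun j => a j.+1 * j.+1%:R * y ^+ j)
  (fun j => m.+1 - j)%N x)).
by apply: eq_bigr => j _ /=; rewrite subSKn.
Qed.

Let is_derive_x_phase_yy (x y : R) : is_derive x 1 (phase_yy ^~ y) (phase_xyy x y).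
Proof.
apply: (is_derive_eq (is_derive_powsum
  (fun j => a j.+1 * j.+1%:R * (j%:R * y ^+ j.-1)) (fun j => m.+1 - j)%N x)).
by apply: eq_bigr => j _ /=; rewrite subSKn.
Qed.

Let mvt (f f' : R -> R) x x' : (forall x : R, is_derive x 1 f (f' x)) ->
  exists2 c, Num.min x x' <= c <= Num.max x x' & f x - f x' = f' c * (x - x').
Proof.
move=> ff'; wlog xx' : x x' / x <= x'.
  move=> H; case/orP: (le_total x x') => [/H//|/H[c cc E]].
  by exists c; [rewrite minC maxC|rewrite -opprB E; ring].
have cf : {within `[x, x'], continuous f}.
  apply: continuous_subspaceT => t; apply: differentiable_continuous.
  by apply/derivable1_diffP; case: (ff' t).
have [c] := MVT_segment xx' (fun t _ => ff' t) cf.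
rewrite in_itv/= => cc E; exists c; first by rewrite (min_idPl xx') (max_idPr xx').
by rewrite -opprB E; ring.
Qed.

Let pC : {poly C} := \poly_(j < m.+1) (a j.+1 * j.+1%:R * (m.+1 - j)%:R)%:C.

Let phase_xy_homog x y : (phase_xy x y)%:C = (homog m pC x%:C).[y%:C].
Proof.
rewrite /homog horner_poly rmorph_sum/=; apply: eq_bigr => j _.
rewrite coef_poly ltn_ord -rmorphXn -rmorphM -rmorphXn/= -rmorphM/=.
by congr (_%:C); ring.
Qed.

Let phase_xyy_homog x y : (phase_xyy x y)%:C = (homog m pC x%:C)^`().[y%:C].
Proof.
have -> : (homog m pC x%:C)^`() =
    \poly_(k < m) ((pC`_k.+1 * x%:C ^+ (m - k.+1)) *+ k.+1).
  apply/polyP => k; rewrite coef_deriv !coef_poly ltnS.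
  by case: ltnP => // _; rewrite mul0rn.
rewrite horner_poly rmorph_sum/= big_ord_recl/= mul0r mulr0 mul0r add0r.
apply: eq_bigr => j _; rewrite coef_poly /bump/= add1n ltnS ltn_ord.
rewrite -rmorphXn -rmorphM/= -rmorphMn/= -rmorphXn -rmorphM/=; congr (_%:C).
by rewrite -mulr_natr subSS; ring.
Qed.

(** [phase_xy] is a product of linear forms [y - c x] with [c <> 0], so a lower
    bound on all of them bounds it from below and, through the logarithmic
    derivative, compares it with [phase_xyy]. *)
Lemma phase_structure : a 1%N * a m.+1 != 0 ->
  exists (cs : seq C) (c0 C1 : R), [/\ 0 < c0, 0 <= C1, 0 \notin cs &
   forall (del x x' y : R), 0 < del -> `|x - x'| <= del ->
   (forall t c, Num.min x x' <= t <= Num.max x x' -> c \in cs ->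
      del <= normc (y%:C - c * t%:C)) ->
   c0 * del ^+ m * `|x - x'| <= `|phase_y x y - phase_y x' y| /\
   `|phase_yy x y - phase_yy x' y| <= C1 / del * `|phase_y x y - phase_y x' y|].
Proof.
rewrite mulf_eq0 negb_or => /andP[a1 am].
have pCm : pC`_m != 0.
  rewrite coef_poly ltnSn subSnn mulr1; apply/eqP => -[] /eqP.
  by rewrite mulf_eq0 (negPf am) pnatr_eq0.
have szp : size pC = m.+1.
  apply/eqP; rewrite eqn_leq size_poly ltnNge /=; apply/negP => H.
  by rewrite nth_default ?eqxx in pCm.
have [cs pE] := closed_field_poly_normal pC.
have lead0 : lead_coef pC != 0 by rewrite lead_coefE szp.
have scs : size cs = m.
  apply/eqP; rewrite -eqSS -szp pE size_scale// size_prod_XsubC.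
  by rewrite eqxx.
have homogE (x : C) : homog m pC x = lead_coef pC *: \prod_(z <- cs) ('X - (z * x)%:P).
  rewrite -homog_prod scs {1}pE; apply/polyP => k; rewrite coefZ.
  rewrite 2!(coef_poly m.+1) coefZ.
  by case: ifP => _; rewrite ?mulr0// mulrA.
set L := lead_coef pC in lead0 homogE.
have nL0 : 0 < normc L.
  rewrite lt_def normc_ge0 andbT; apply: contra lead0 => /eqP.
  by move=> /(@Normc.eq0_normc R) ->.
pose K := \prod_(z <- cs) (1 + normc z).
have K0 : 0 <= K by apply: prodr_ge0 => z _; rewrite addr_ge0// normc_ge0.
exists cs, (normc L), (m%:R * K); split => //.
- by rewrite mulr_ge0.
- apply: contra pCm => cs0.
  have : pC.[0] = 0.
    rewrite pE hornerZ horner_prod (big_rem _ cs0)/= hornerXsubC subrr mul0r.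
    by rewrite mulr0.
  rewrite horner_coef0 coef_poly/= subn0 => /(congr1 (@complex.Re R))/= /eqP.
  by rewrite !mulf_eq0 (negPf a1) !pnatr_eq0.
move=> del x x' y del0 xx' sep.
have [c cc E1] := @mvt (phase_y ^~ y) (phase_xy ^~ y) x x' (is_derive_x_phase_y^~ y).
have [d dd E2] := @mvt (phase_yy ^~ y) (phase_xyy ^~ y) x x' (is_derive_x_phase_yy^~ y).
have sepc z : z \in cs -> del <= normc (y%:C - z * c%:C) by exact: sep.
have sepd z : z \in cs -> del <= normc (y%:C - z * d%:C) by exact: sep.
have cd : `|c - d| <= del.
  apply: le_trans xx'; move: cc dd; have [h|h] := leP x x'.
    by move=> /andP[? ?] /andP[? ?]; rewrite (ler0_norm (_ : x - x' <= 0)) ?subr_le0// ler_norml; apply/andP; split; lra.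
  by move=> /andP[? ?] /andP[? ?]; rewrite (gtr0_norm (_ : 0 < x - x')) ?subr_gt0// ler_norml; apply/andP; split; lra.
pose w (t : R) := \prod_(z <- cs) ('X - (z * t%:C)%:P).
have nxy t : `|phase_xy t y| = normc L * normc (w t).[y%:C].
  by rewrite -normc_real phase_xy_homog homogE hornerZ Normc.normcM.
have nxyy t : `|phase_xyy t y| = normc L * normc (w t)^`().[y%:C].
  by rewrite -normc_real phase_xyy_homog homogE derivZ hornerZ Normc.normcM.
rewrite E1 E2 !normrM nxy nxyy; split.
  by rewrite ler_wpM2r// ler_wpM2l ?(ltW nL0)// -scs; exact: prod_lower_bound.
rewrite [leRHS]mulrA ler_wpM2r// mulrCA ler_wpM2l ?(ltW nL0)//.
rewrite mulrAC ler_pdivlMr// mulrC.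
apply: (le_trans (deriv_prod_bound del0 sepd)).
rewrite scs -mulrA ler_wpM2l//.
exact: (prod_ratio_bound del0 cd sepc).
Qed.

End Phase.
End PhaseStructure.

(** * Lebesgue measure on an interval and integrals of negative powers *)

Section IntervalMeasure.
Context {R : realType}.
Local Notation mu := (@lebesgue_measure R).

Lemma lebesgue_itv_fin (x0 x1 : R) : (mu `[x0, x1[%classic < +oo)%E.
Proof. by rewrite lebesgue_measure_itv/=; case: ifP => _; rewrite ?ltry// -EFinB ltry. Qed.

Lemma measurable_itv_co (x0 x1 : R) : measurable (`[x0, x1[%classic : set (measurableTypeR R)).
Proof. exact: measurable_itv. Qed.

(** A finite measure on the whole line, so that one bilinear form, with one kernel
    and unrestricted functions, serves for all the boxes. *)
Definition leb_itv (x0 x1 : R) : {finite_measure set (measurableTypeR R) -> \bar R} :=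
  mfrestr (measurable_itv_co x0 x1) (lebesgue_itv_fin x0 x1).

Lemma leb_itvE (x0 x1 : R) A : leb_itv x0 x1 A = mu (A `&` `[x0, x1[%classic).
Proof. by []. Qed.

Lemma leb_itv_setT (x0 x1 : R) : x0 <= x1 -> fine (leb_itv x0 x1 setT) = x1 - x0.
Proof.
move=> x01; rewrite [X in fine X](leb_itvE _ _ _) setTI lebesgue_measure_itv/= lte_fin.
move: x01; rewrite le_eqVlt => /predU1P[->|->//].
by rewrite ltxx subrr.
Qed.

Lemma ge0_integral_leb_itv (x0 x1 : R) (f : R -> \bar R) :
  measurable_fun setT f -> (forall x, 0 <= f x)%E ->
  (\int[leb_itv x0 x1]_x f x = \int[mu]_(x in `[x0, x1[) f x)%E.
Proof.
move=> mf f0; rewrite (@ge0_negligible_integral _ _ _ (leb_itv x0 x1) setT (~` `[x0, x1[%classic))//.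
- rewrite setTD setCK; apply: eq_measure_integral => A mA AI.
  by rewrite /leb_itv/= /mfrestr /mrestr setIidl.
- exact: measurableC.
- by apply: etrans (leb_itvE _ _ _) _; rewrite setICl measure0.
Qed.

Lemma Rintegral_leb_itv (x0 x1 : R) (f : R -> R) : bounded_meas f ->
  \int[leb_itv x0 x1]_x f x = \int[mu]_(x in `[x0, x1[) f x.
Proof.
move=> bf; rewrite /Rintegral; congr fine.
rewrite (@negligible_integral _ _ _ (leb_itv x0 x1) setT (~` `[x0, x1[%classic))//.
- rewrite setTD setCK; apply: eq_measure_integral => A mA AI.
  by rewrite /leb_itv/= /mfrestr /mrestr setIidl.
- exact: measurableC.
- exact: bounded_meas_integrable.
- by apply: etrans (leb_itvE _ _ _) _; rewrite setICl measure0.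
Qed.

Lemma bounded_meas_integrable_itv (x0 x1 : R) (f : R -> R) : bounded_meas f ->
  mu.-integrable `[x0, x1[%classic (EFin \o f).
Proof.
move=> [mf [M fM]]; apply: measurable_bounded_integrable => //.
- exact: lebesgue_itv_fin.
- exact: measurable_funTS.
by exists M; split; [exact: num_real|move=> N MN x _ /=; exact: le_trans (ltW MN)].
Qed.

Lemma Rintegral_leb_itv_split (x0 x1 x2 : R) (f : R -> R) :
  x0 <= x1 -> x1 <= x2 -> bounded_meas f ->
  \int[leb_itv x0 x2]_x f x = \int[leb_itv x0 x1]_x f x + \int[leb_itv x1 x2]_x f x.
Proof.
move=> x01 x12 bf; rewrite !Rintegral_leb_itv//.
have E : `[x0, x2[%classic = `[x0, x1[%classic `|` `[x1, x2[%classic :> set R.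
  apply/seteqP; split => x /=; rewrite !in_itv/=.
    move=> /andP[a b]; have [c|c] := ltP x x1; [left|right]; first by rewrite a.
    by rewrite b.
  by move=> [|] /andP[a b]; rewrite ?a ?b ?andbT//= ?(le_trans _ a)// ?(lt_le_trans b).
rewrite E Rintegral_setU//.
- by rewrite -E; exact: bounded_meas_integrable_itv.
- apply/disj_setPS => x [] /=; rewrite !in_itv/= => /andP[_ a] /andP[b _].
  by move: (lt_le_trans a b); rewrite ltxx.
Qed.

Section PowerIntegral.
Variable b : R.
Hypotheses (b0 : 0 < b) (b1 : b < 1).
Local Notation w y := (fun x : R => (`|x - y| `^ (- b))%R).

Lemma measurable_abs_powR (y : R) : measurable_fun setT (w y).
Proof.
apply: measurableT_comp (@measurable_powR R (- b)) _.
by apply: measurableT_comp => //; exact: measurable_funB.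
Qed.

Let seg (s y x1 x2 del : R) : s = 1 \/ s = -1 -> x1 < x2 ->
  (forall x, x1 <= x <= x2 -> 0 < s * (x - y) <= del) ->
  (\int[mu]_(x in `[x1, x2]) (w y x)%:E <= (del `^ (1 - b) / (1 - b))%:E)%E.
Proof.
move=> s1 x12 H.
pose F x := s * (s * (x - y)) `^ (1 - b) / (1 - b).
have ss : s * s = 1 by case: s1 => ->; ring.
have b1' : 0 < 1 - b by rewrite subr_gt0.
have wE x : x1 <= x <= x2 -> w y x = (s * (x - y)) `^ (- b).
  move=> /H /andP[p _]; congr (_ `^ _).
  rewrite -(gtr0_norm p) normrM; case: s1 => ->; rewrite ?normrN normr1 mul1r//.
have dF x : x1 <= x <= x2 -> is_derive x 1 F (w y x).
  move=> xx; have /andP[p _] := H _ xx.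
  have d1 : is_derive x 1 (fun x => s * (x - y)) s.
    have d0 : is_derive x 1 (fun x : R => x - y) 1.
      by have := is_derive_shift x 1 (- y).
    by apply: (is_derive_eq (is_deriveZ s d0)); rewrite /GRing.scale/= mulr1.
  have d2 := @is_derive1_comp _ (@powR R ^~ (1 - b)) (fun x => s * (x - y)) x _ _
    (is_derive1_powR (1 - b) p) d1.
  have d3 := is_deriveZ (s / (1 - b)) d2.
  have -> : F = (s / (1 - b)) *: ((@powR R ^~ (1 - b)) \o (fun x => s * (x - y))).
    by apply/funext => t; rewrite /F fctE/= /GRing.scale/= mulrAC.
  apply: (is_derive_eq d3); rewrite /GRing.scale/= wE//.
  have -> : 1 - b - 1 = - b by ring.
  have -> : s / (1 - b) * ((1 - b) * (s * (x - y)) `^ (- b) * s) =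
    (s * s) * (s * (x - y)) `^ (- b) by field; rewrite gt_eqF.
  by rewrite ss mul1r.
have cF x : x1 <= x <= x2 -> {for x, continuous F}.
  by move=> xx; exact: is_derive1_continuous (dF _ xx).
have cw x : x1 <= x <= x2 -> {for x, continuous (w y)}.
  move=> xx; have /andP[p _] := H _ xx.
  apply: (continuous_comp (g := @powR R ^~ (- b))).
    apply: (continuous_comp (g := @Num.norm R R)); last exact: norm_continuous.
    by apply: continuousB; [exact: cvg_id|exact: cst_continuous].
  apply: differentiable_continuous; apply/derivable1_diffP.
  have nz : 0 < `|x - y|.
    by rewrite normr_gt0; apply: contraL p => /eqP ->; rewrite mulr0 ltxx.
  by case: (is_derive1_powR (- b) nz).
rewrite (@continuous_FTC2 _ (w y) F)//.
- rewrite -EFinB lee_fin.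
  have /andP[p1 q1] : 0 < s * (x1 - y) <= del by apply: H; rewrite lexx ltW.
  have /andP[p2 q2] : 0 < s * (x2 - y) <= del by apply: H; rewrite lexx ltW.
  have P z : 0 < z -> z <= del -> 0 <= z `^ (1 - b) <= del `^ (1 - b).
    move=> z0 zd; rewrite powR_ge0/= ge0_ler_powR// ?nnegrE ltW//.
    exact: lt_le_trans zd.
  have /andP[P1 Q1] := P _ p1 q1; have /andP[P2 Q2] := P _ p2 q2.
  rewrite /F -mulrBl ler_wpM2r// ?invr_ge0 ?(ltW b1')//.
  by case: s1 => E; rewrite E in P1 Q1 P2 Q2 *; lra.
- have H' : {in `[x1, x2]%classic, continuous (w y)}.
    by move=> x; rewrite inE/= in_itv/=; exact: cw.
  exact: continuous_in_subspaceT.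
- split.
  + move=> x; rewrite in_itv/= => /andP[a c]; have := dF x.
    by rewrite !ltW//= => /(_ isT) [].
  + by apply: cvg_at_right_filter; apply: cF; rewrite lexx ltW.
  + by apply: cvg_at_left_filter; apply: cF; rewrite lexx ltW.
- move=> x; rewrite in_itv/= => /andP[a c]; rewrite derive1E.
  by apply: derive_val; apply: dF; rewrite !ltW.
Qed.

Let half (s y del : R) : s = 1 \/ s = -1 -> 0 < del ->
  (\int[mu]_(x in [set x | (0 < s * (x - y) <= del)%R]) (w y x)%:E
    <= (del `^ (1 - b) / (1 - b))%:E)%E.
Proof.
move=> s1 del0.
pose e (i : nat) : R := del / i.+2%:R.
have e0 i : 0 < e i by rewrite divr_gt0.
have e1 i : e i < del by rewrite ltr_pdivrMr// ltr_pMr// ltr1n.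
pose F (i : nat) := [set x : R | e i <= s * (x - y) <= del].
have segE i : exists x1 x2 : R, [/\ x1 < x2, F i = `[x1, x2]%classic &
   forall x, x1 <= x <= x2 -> 0 < s * (x - y) <= del].
  have e0' := e0 i; have e1' := e1 i.
  case: s1 => sE.
  - exists (y + e i), (y + del); split; first lra.
      apply/seteqP; split => x; rewrite /F/= in_itv/= sE => /andP[? ?].
        by apply/andP; split; lra.
      by apply/andP; split; lra.
    by move=> x /andP[? ?]; rewrite sE; apply/andP; split; lra.
  - exists (y - del), (y - e i); split; first lra.
      apply/seteqP; split => x; rewrite /F/= in_itv/= sE => /andP[? ?].
        by apply/andP; split; lra.
      by apply/andP; split; lra.
    by move=> x /andP[? ?]; rewrite sE; apply/andP; split; lra.
have mF i : measurable (F i).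
  by have [x1 [x2 [_ -> _]]] := segE i; exact: measurable_itv.
have UF : [set x | (0 < s * (x - y) <= del)%R] = \bigcup_i F i.
  apply/seteqP; split => x /=; last first.
    by move=> [i _] /= /andP[a ->]; rewrite (lt_le_trans (e0 i) a).
  move=> /andP[p q]; exists (Num.truncn (del / (s * (x - y)))) => //=.
  rewrite /F/= q andbT /e ler_pdivrMr// mulrC -ler_pdivrMr//.
  apply: ltW; apply: lt_trans (truncnS_gt _) _.
  by rewrite ltr_nat.
have nd : nondecreasing_seq F.
  move=> i j ij; apply/subsetPset => x /andP[a q]; rewrite /F/= q andbT.
  apply: le_trans a; rewrite /e ler_pM2l// lef_pV2 ?posrE// ler_nat ltnS ltnS//.
rewrite UF.
have cv := @ge0_nondecreasing_set_cvg_integral _ (measurableTypeR R) _ F (EFin \o w y) mu nd mF.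
have mw : measurable_fun setT (EFin \o w y).
  by apply/measurable_EFinP; exact: measurable_abs_powR.
have {}cv := cv (fun i => measurable_funTS mw) (fun i x _ => powR_ge0 _ _).
rewrite -(cvg_lim _ cv)//; apply: lime_le; first by apply/cvg_ex; eexists; exact: cv.
apply: nearW => i; have [x1 [x2 [x12 -> Hx]]] := segE i.
exact: (@seg s y x1 x2 del).
Qed.

(** Away from [y] the weight is at most [del ^ - b]; near [y] the two
    half-intervals are exhausted from the inside, where an antiderivative is
    available. *)
Lemma integral_abs_powR (x0 y del : R) : 0 < del ->
  (\int[mu]_(x in `[x0, (x0 + del)%R[) (w y x)%:E
    <= ((1 + 2 / (1 - b)) * del `^ (1 - b))%:E)%E.
Proof.
move=> del0.
have mw : measurable_fun setT (EFin \o w y).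
  by apply/measurable_EFinP; exact: measurable_abs_powR.
have w0 (x : R) : (0 <= (w y x)%:E)%E by rewrite lee_fin powR_ge0.
pose Hf (s : R) := [set x | 0 < s * (x - y) <= del].
have mH s : measurable (Hf s : set (measurableTypeR R)).
  have mf : measurable_fun setT (fun x : R => s * (x - y)).
    by apply: measurable_funM => //; exact: measurable_funB.
  rewrite -[X in measurable X]setTI (_ : Hf s = (fun x : R => s * (x - y)) @^-1` `]0, del]).
    by apply: mf => //; exact: measurable_itv.
  by apply/seteqP; split => x /=; rewrite in_itv.
have mHi s : measurable_fun setT (\1_(Hf s) : measurableTypeR R -> R).
  exact: measurable_indic.
pose h s x := (w y x * \1_(Hf s) x)%:E.
have mh s : measurable_fun setT (h s).
  apply/measurable_EFinP.
  by apply: measurable_funM; [exact: measurable_abs_powR|exact: mHi].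
have h0 (t x : R) : (0 <= h t x)%E.
  by rewrite lee_fin mulr_ge0 ?powR_ge0// indicE.
have hint s : s = 1 \/ s = -1 -> (\int[mu]_(x in `[x0, (x0 + del)%R[) h s x <=
    (del `^ (1 - b) / (1 - b))%:E)%E.
  move=> s1; apply: le_trans (half y s1 del0).
  apply: (@le_trans _ _ (\int[mu]_x h s x)%E).
    by apply: ge0_subset_integral => //; exact: mh.
  rewrite [leRHS]integral_mkcond.
  rewrite le_eqVlt; apply/orP; left; apply/eqP.
  apply: eq_integral => x _; rewrite /h patchE indicE /Hf.
  by case: (_ \in _); rewrite ?mulr1 ?mulr0.
have cint : (\int[mu]_(x in `[x0, (x0 + del)%R[) (del `^ (- b))%:E <= (del `^ (1 - b))%:E)%E.
  rewrite integral_cst//= lebesgue_measure_itv/= lte_fin ltrDl del0 -EFinB -EFinM lee_fin.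
  by rewrite addrAC subrr add0r -{2}[del]powRr1 ?(ltW del0)// -powRD ?(gt_eqF del0) ?implybT// addrC.
have mhh : measurable_fun setT (fun x => h 1%R x + h (-1)%R x)%E.
  by apply: emeasurable_funD; exact: mh.
pose g x := ((del `^ (- b))%:E + (h 1%R x + h (-1)%R x))%E.
apply: (@le_trans _ _ (\int[mu]_(x in `[x0, (x0 + del)%R[) g x)%E); rewrite /g.
  apply: ge0_le_integral => //.
  - exact: measurable_funTS.
  - by apply: emeasurable_funD => //; exact: measurable_funTS.
  move=> x _; rewrite /h -!EFinD lee_fin.
  have [->|nz] := eqVneq x y.
    by rewrite subrr normr0 powR0 ?oppr_eq0 ?(gt_eqF b0)// !mul0r !addr0 powR_ge0.
  have nz' : 0 < `|x - y| by rewrite normr_gt0 subr_eq0.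
  have ind0 t : 0 <= `|x - y| `^ (- b) * \1_(Hf t) x.
    by rewrite mulr_ge0 ?powR_ge0// indicE.
  have p0 := ind0 1; have q0 := ind0 (-1).
  have D0 : 0 <= del `^ (- b) by exact: powR_ge0.
  have [lt_d|d_le] := ltP del `|x - y|.
    suff : `|x - y| `^ (- b) <= del `^ (- b) by lra.
    rewrite !powRN lef_pV2 ?posrE ?powR_gt0//.
    by rewrite ge0_ler_powR ?nnegrE ?(ltW b0) ?(ltW del0) ?(ltW lt_d).
  have [xy|xy] := ltP 0 (x - y).
    have E : \1_(Hf 1) x = 1 :> R.
      rewrite indicE mem_set// /Hf/= mul1r xy/=.
      by rewrite ger0_norm ?(ltW xy)// in d_le.
    by rewrite E mulr1 in p0 *; lra.
  have E : \1_(Hf (-1)) x = 1 :> R.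
    rewrite indicE mem_set// /Hf/= mulN1r.
    rewrite ler0_norm// in d_le; rewrite d_le andbT oppr_gt0 lt_def xy andbT.
    by rewrite eq_sym subr_eq0.
  by rewrite E mulr1 in q0 *; lra.
rewrite ge0_integralD//; last 3 first.
- by move=> x _; rewrite lee_fin powR_ge0.
- by move=> x _; rewrite adde_ge0.
- exact: measurable_funTS.
rewrite ge0_integralD//; [|exact: measurable_funTS (mh _)..].
have -> : ((1 + 2 / (1 - b)) * del `^ (1 - b))%:E = ((del `^ (1 - b))%:E +
   ((del `^ (1 - b) / (1 - b))%:E + (del `^ (1 - b) / (1 - b))%:E))%E :> \bar R.
  by rewrite -!EFinD; congr (_%:E); ring.
by rewrite leeD// leeD//; apply: hint; [left|right].
Qed.

End PowerIntegral.
End IntervalMeasure.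

(** * Oscillatory bound on a box away from the singular lines *)

Section BoxBounds.
Context {R : realType}.
Local Notation leb := (@lebesgue_measure R).

(** The [y]-derivative is carried as a function [b1] of its own, because [b] need
    not be derivable on the diagonal; there the bound forces [b] to vanish, since
    [0 `^ (- mu) = 0]. *)
Record amplitude (mu M : R) (b : R * R -> R) (b1 : R -> R -> R) : Prop := Amplitude {
  amp_meas : measurable_fun setT b ;
  amp_bound : forall x y, `|b (x, y)| <= M * `|x - y| `^ (- mu) ;
  amp_derive : forall x y : R, x != y -> is_derive y 1 (fun t => b (x, t)) (b1 x y) ;
  amp_derive_bound : forall x y, x != y -> `|b1 x y| <= M * `|x - y| `^ (- mu - 1) ;
  amp_derive_continuous : forall x y : R, x != y -> {for y, continuous (b1 x)} }.

Lemma measurable_phase n a : measurable_fun setT (fun z : R * R => phase n a z.1 z.2).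
Proof.
apply: measurable_sum => k; apply: measurable_funM; last exact: measurable_funX.
by apply: measurable_funM => //; exact: measurable_funX.
Qed.

Lemma measurable_cos_phase n a lam c :
  measurable_fun setT (fun z : R * R => cos (lam * phase n a z.1 z.2 + c)).
Proof.
apply: (measurableT_comp (f := @cos R)).
  by apply: continuous_measurable_fun; exact: continuous_cos.
apply: measurable_funD => //; apply: measurable_funM => //.
exact: measurable_phase.
Qed.

Lemma measurable_sin_phase n a lam c :
  measurable_fun setT (fun z : R * R => sin (lam * phase n a z.1 z.2 + c)).
Proof.
apply: (measurableT_comp (f := @sin R)).
  by apply: continuous_measurable_fun; exact: continuous_sin.
apply: measurable_funD => //; apply: measurable_funM => //.
exact: measurable_phase.
Qed.

Lemma powR_inv (x e : R) : 0 < x -> x^-1 `^ e = x `^ (- e).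
Proof. by move=> x0; rewrite -powR_inv1 ?(ltW x0)// -powRrM mulN1r. Qed.

Lemma powR_le1 (z s : R) : 0 <= z -> z <= 1 -> 0 <= s -> z `^ s <= 1.
Proof.
move=> z0 z1 s0; apply: (@le_trans _ _ (1 `^ s)); last by rewrite powR1.
by rewrite ge0_ler_powR ?nnegrE.
Qed.

Lemma powR_ge1 (z s : R) : 1 <= z -> 0 <= s -> 1 <= z `^ s.
Proof.
move=> z1 s0; apply: (@le_trans _ _ (1 `^ s)); first by rewrite powR1.
by rewrite ge0_ler_powR ?nnegrE// (le_trans _ z1).
Qed.

Lemma sin_max (x : R) : `|sin x| <= 1.
Proof. by rewrite ler_norml sin_geN1 sin_le1. Qed.

Section GoodBox.
Variables (m : nat) (a : nat -> R) (mu M beta c0 C1 : R) (cs : seq R[i]).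
Local Notation n := m.+2.
Local Notation S := (phase n a).
Hypotheses (mu0 : 0 < mu) (beta0 : 0 < beta) (beta1 : beta < 1)
  (c00 : 0 < c0) (C10 : 0 <= C1) (M0 : 0 <= M).
Hypothesis structure : forall (del x x' y : R), 0 < del -> `|x - x'| <= del ->
  (forall t c, Num.min x x' <= t <= Num.max x x' -> c \in cs ->
    del <= Normc.normc (y%:C - c * t%:C)%C) ->
  c0 * del ^+ m * `|x - x'| <= `|phase_y m a x y - phase_y m a x' y| /\
  `|phase_yy m a x y - phase_yy m a x' y| <=
    C1 / del * `|phase_y m a x y - phase_y m a x' y|.
Variables (b : R * R -> R) (b1 : R -> R -> R).
Hypothesis ampb : amplitude mu M b b1.
Variables (x0 y0 del lam c : R).
Hypotheses (del0 : 0 < del) (lam0 : 0 < lam).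
Let in_box (x y : R) := x0 <= x <= x0 + del /\ y0 <= y <= y0 + del.
Hypothesis sep : forall x y z, in_box x y -> z \in cs ->
  del <= Normc.normc (y%:C - z * x%:C)%C.
Hypothesis sepd : forall x y, in_box x y -> del <= `|x - y|.

Let N0 : R := M * del `^ (- mu).
Let N00 : 0 <= N0. Proof. by rewrite mulr_ge0// powR_ge0. Qed.

Let amp_le x y : in_box x y -> `|b (x, y)| <= N0.
Proof.
move=> /sepd dxy; apply: (le_trans (amp_bound ampb x y)).
have xy0 : 0 < `|x - y| by exact: lt_le_trans dxy.
rewrite /N0 ler_wpM2l// !powRN lef_pV2 ?posrE ?powR_gt0//.
by rewrite ge0_ler_powR ?nnegrE ?(ltW mu0) ?(ltW del0).
Qed.

Let neq_box x y : in_box x y -> x != y.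
Proof.
by move=> /sepd dxy; rewrite -subr_eq0 -normr_gt0 (lt_le_trans del0).
Qed.

Let amp1_le x y : in_box x y -> `|b1 x y| <= N0 / del.
Proof.
move=> bxy; have dxy := sepd bxy.
apply: (le_trans (amp_derive_bound ampb (neq_box bxy))).
have xy0 : 0 < `|x - y| by exact: lt_le_trans dxy.
rewrite /N0 -mulrA ler_wpM2l//.
have -> : del `^ (- mu) / del = del `^ (- mu - 1).
  by rewrite powRD ?(gt_eqF del0) ?implybT// powR_inv1// ltW.
rewrite -opprD !powRN lef_pV2 ?posrE ?powR_gt0//.
by rewrite ge0_ler_powR ?nnegrE ?(ltW del0)// addr_ge0// ltW.
Qed.

Let rho (x x' : R) : R := lam * (c0 * del ^+ m * `|x - x'|).

(* The integration by parts in [y].  For the phase [lam (S x y - S x' y)] the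
   derivative in [y] is bounded below by [rho x x'], by [structure]. *)
Let osc_le (x x' : R) : x0 <= x <= x0 + del -> x0 <= x' <= x0 + del -> x != x' ->
  `|\int[leb]_(y in `[y0, y0 + del]) (cos (lam * (S x y - S x' y)) * (b (x, y) * b (x', y)))|
    <= N0 ^+ 2 * (4 + C1) / rho x x'.
Proof.
move=> xI x'I xx'.
have hst y : y0 <= y <= y0 + del -> c0 * del ^+ m * `|x - x'| <= `|phase_y m a x y - phase_y m a x' y| /\
    `|phase_yy m a x y - phase_yy m a x' y| <=
    C1 / del * `|phase_y m a x y - phase_y m a x' y|.
  move=> yJ; apply: structure => //.
    move: xI x'I => /andP[? ?] /andP[? ?]; rewrite ler_norml; apply/andP; split; lra.
  move=> t z tI; apply: sep; split=> //.
  move: xI x'I => /andP[? ?] /andP[? ?].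
  by move: tI; have [h|h] := leP x x' => /andP[? ?]; apply/andP; split; lra.
have y01 : y0 < y0 + del by rewrite ltrDl.
have r0 : 0 < rho x x'.
  by rewrite !mulr_gt0// ?exprn_gt0// normr_gt0 subr_eq0.
have k0 : 0 <= C1 / del by rewrite divr_ge0// ltW.
apply: (@le_trans _ _ ((2 * N0 ^+ 2 + (y0 + del - y0) *
   (2 * (N0 ^+ 2 / del) + C1 / del * N0 ^+ 2)) / rho x x')); last first.
  rewrite ler_wpM2r ?invr_ge0 ?(ltW r0)// le_eqVlt; apply/orP; left; apply/eqP.
  by field; rewrite gt_eqF.
apply: (@van_der_corput _ _ (fun y => lam * (phase_y m a x y - phase_y m a x' y))
  (fun y => lam * (phase_yy m a x y - phase_yy m a x' y)) _
  (fun y => b (x, y) * b1 x' y + b (x', y) * b1 x y)) => //.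
- move=> y yJ; apply: (is_derive_eq (is_deriveZ lam
    (is_deriveB (is_derive_phase m a x y) (is_derive_phase m a x' y)))).
  by [].
- move=> y yJ; apply: (is_derive_eq (is_deriveZ lam
    (is_deriveB (is_derive_phase_y m a x y) (is_derive_phase_y m a x' y)))).
  by [].
- move=> y yJ.
  by apply: (is_derive_eq (is_deriveM (amp_derive ampb (neq_box (conj xI yJ)))
    (amp_derive ampb (neq_box (conj x'I yJ))))).
- move=> y yJ; apply: continuousM; first exact: cst_continuous.
  by apply: continuousB; exact: continuous_phase_yy.
- move=> y yJ; have nx := neq_box (conj xI yJ); have nx' := neq_box (conj x'I yJ).
  apply: continuousD; apply: continuousM.
  + exact: is_derive1_continuous (amp_derive ampb nx).
  + by case: ampb => _ _ _ _; apply; exact: nx'.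
  + exact: is_derive1_continuous (amp_derive ampb nx').
  + by case: ampb => _ _ _ _; apply; exact: nx.
- move=> y yJ; rewrite normrM (ger0_norm (ltW lam0)) ler_wpM2l ?(ltW lam0)//.
  by have [] := hst _ yJ.
- move=> y yJ; rewrite !normrM mulrCA ler_wpM2l//.
  by have [] := hst _ yJ.
- move=> y yJ; have bx : in_box x y by [].
  have bx' : in_box x' y by [].
  by rewrite normrM expr2; apply: ler_pM => //; exact: amp_le.
- move=> y yJ; have bx : in_box x y by [].
  have bx' : in_box x' y by [].
  apply: (le_trans (ler_normD _ _)).
  rewrite mulr_natl mulr2n !normrM expr2 -[N0 * N0 / del]mulrA.
  by apply: lerD; apply: ler_pM => //; (exact: amp_le || exact: amp1_le).
Qed.

Let boxI : set R := `[x0, x0 + del[%classic.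
Let boxJ : set R := `[y0, y0 + del[%classic.
Let chi (z : R * R) : R := \1_boxI z.1 * \1_boxJ z.2.
Let uc (z : R * R) : R := cos (lam * S z.1 z.2 + c) * b z * chi z.
Let us (z : R * R) : R := sin (lam * S z.1 z.2 + c) * b z * chi z.

Let chi_in z : chi z != 0 -> in_box z.1 z.2.
Proof.
rewrite /chi !indicE.
have [+|_] := boolP (z.1 \in boxI); last by rewrite mul0r eqxx.
rewrite inE /boxI/= in_itv/= => /andP[a1 /ltW a2].
have [+|_] := boolP (z.2 \in boxJ); last by rewrite mulr0 eqxx.
rewrite inE /boxJ/= in_itv/= => /andP[a3 /ltW a4] _.
by split; apply/andP.
Qed.

Let chi01 z : 0 <= chi z <= 1.
Proof.
by rewrite /chi !indicE; case: (_ \in _); case: (_ \in _); rewrite !(mulr0, mulr1) ?ler01 ?lexx.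
Qed.

Let mchi : measurable_fun setT chi.
Proof.
have mI (x : R) : measurable_fun setT (\1_(`[x, x + del[%classic) : measurableTypeR R -> R).
  exact: measurable_indic.
by apply: measurable_funM; apply: (measurableT_comp (mI _)).
Qed.

Let bm_trig (trig : R * R -> R) : measurable_fun setT trig -> (forall z, `|trig z| <= 1) ->
  bounded_meas (fun z => trig z * b z * chi z) /\ forall z, `|trig z * b z * chi z| <= N0.
Proof.
move=> mt t1.
have H z : `|trig z * b z * chi z| <= N0.
  have [->|/chi_in bx] := eqVneq (chi z) 0; first by rewrite mulr0 normr0.
  have /andP[h0 h1] := chi01 z.
  rewrite normrM (ger0_norm h0) -[N0]mulr1; apply: ler_pM => //.
  rewrite normrM -[N0]mul1r; apply: ler_pM => //.
  by rewrite [z]surjective_pairing; exact: amp_le.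
split=> //; split; last by exists N0.
apply: measurable_funM; last exact: mchi.
by apply: measurable_funM => //; exact: amp_meas ampb.
Qed.

Let buc : bounded_meas uc /\ forall z, `|uc z| <= N0.
Proof.
apply: bm_trig; first exact: measurable_cos_phase.
by move=> z; exact: cos_max.
Qed.

Let bus : bounded_meas us /\ forall z, `|us z| <= N0.
Proof.
apply: bm_trig; first exact: measurable_sin_phase.
by move=> z; exact: sin_max.
Qed.

Let K := (4 + C1) / c0.
Let Lam := lam * del ^+ n.
Let Cb := 1 + 2 / (1 - beta).
Let L (x x' : R) : R := \int[leb_itv y0 (y0 + del)]_y (uc (x, y) * uc (x', y) + us (x, y) * us (x', y)).

Let LE x x' : x \in boxI -> x' \in boxI -> L x x' =
  \int[leb]_(y in `[y0, y0 + del]) (cos (lam * (S x y - S x' y)) * (b (x, y) * b (x', y))).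
Proof.
move=> xI x'I.
have bm : bounded_meas (fun y => uc (x, y) * uc (x', y) + us (x, y) * us (x', y)).
  have [buc' _] := buc; have [bus' _] := bus.
  by apply: bounded_measD; apply: bounded_measM; exact: bounded_meas_slice1.
have E y : y \in boxJ -> uc (x, y) * uc (x', y) + us (x, y) * us (x', y) =
   cos (lam * (S x y - S x' y)) * (b (x, y) * b (x', y)).
  move=> yJ; rewrite /uc /us /chi/= !indicE xI x'I yJ !mulr1.
  have -> : lam * (S x y - S x' y) = (lam * S x y + c) - (lam * S x' y + c) by ring.
  by rewrite cosB; ring.
rewrite /L Rintegral_leb_itv//.
transitivity (\int[leb]_(y in boxJ) (cos (lam * (S x y - S x' y)) * (b (x, y) * b (x', y)))).
  by apply: eq_Rintegral => y yJ; exact: E.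
rewrite Rintegral_itv_bndo_bndc//.
have bi := bounded_meas_integrable_itv y0 (y0 + del) bm.
by apply: eq_integrable bi => // y yJ /=; rewrite E.
Qed.

Let L_triv x x' : `|L x x'| <= 2 * N0 ^+ 2 * del.
Proof.
have [buc' ucN] := buc; have [bus' usN] := bus.
have bm : bounded_meas (fun y => uc (x, y) * uc (x', y) + us (x, y) * us (x', y)).
  by apply: bounded_measD; apply: bounded_measM; exact: bounded_meas_slice1.
apply: (le_trans (le_norm_Rintegralb (leb_itv y0 (y0 + del)) bm)).
have -> : 2 * N0 ^+ 2 * del = \int[leb_itv y0 (y0 + del)]_y (2 * N0 ^+ 2).
  rewrite Rintegral_cst// leb_itv_setT ?lerDl ?ltW//.
  by congr (_ * _); rewrite addrAC subrr add0r.
apply: le_Rintegralb; [exact: bounded_meas_norm|exact: bounded_meas_cst|].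
move=> y; apply: (le_trans (ler_normD _ _)).
have P (v w : R) : `|v| <= N0 -> `|w| <= N0 -> `|v * w| <= N0 ^+ 2.
  by move=> vN wN; rewrite normrM expr2; exact: ler_pM.
by rewrite mulr_natl mulr2n; apply: lerD; exact: P.
Qed.

(* With [Z = Lam |x' - x| / del], the trivial bound and the oscillatory one combine
   into [min 1 (1 / Z) <= Z ^ (- beta)].  As [beta < 1], the right-hand side is
   integrable in [x']. *)
Let L_le x x' : x != x' ->
  `|L x x'| <= N0 ^+ 2 * (2 + K) * Lam `^ (- beta) * del `^ (1 + beta) * `|x' - x| `^ (- beta).
Proof.
move=> xx'.
have K0 : 0 <= K by rewrite divr_ge0 ?addr_ge0// ltW.
have rhs0 : 0 <= N0 ^+ 2 * (2 + K) * Lam `^ (- beta) * del `^ (1 + beta) * `|x' - x| `^ (- beta).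
  rewrite mulr_ge0 ?powR_ge0// mulr_ge0 ?powR_ge0// mulr_ge0 ?powR_ge0//.
  by rewrite mulr_ge0 ?sqr_ge0// addr_ge0.
have Lz : (x \notin boxI) || (x' \notin boxI) -> L x x' = 0.
  move=> h; transitivity (\int[leb_itv y0 (y0 + del)]_y (0 : R)).
    2: by rewrite Rintegral_cst// mul0r.
  apply: eq_Rintegral => y _.
  rewrite /uc /us /chi/= !indicE.
  by case/orP: h => /negPf ->; rewrite mulr0n !(mul0r, mulr0) addr0.
have [xI|xI] := boolP (x \in boxI); last by rewrite Lz ?xI// normr0.
have [x'I|x'I] := boolP (x' \in boxI); last by rewrite Lz ?x'I ?orbT// normr0.
have nxx : 0 < `|x' - x| by rewrite normr_gt0 subr_eq0 eq_sym.
have Lam0 : 0 < Lam by rewrite mulr_gt0// exprn_gt0.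
pose Z := Lam * (`|x' - x| / del).
have Z0 : 0 < Z by rewrite mulr_gt0// divr_gt0.
have -> : N0 ^+ 2 * (2 + K) * Lam `^ (- beta) * del `^ (1 + beta) * `|x' - x| `^ (- beta) =
    N0 ^+ 2 * del * ((2 + K) * Z `^ (- beta)).
  have dV : del^-1 `^ (- beta) = del `^ beta.
    by rewrite powR_inv// opprK.
  have -> : Z `^ (- beta) = Lam `^ (- beta) * (`|x' - x| `^ (- beta) * del `^ beta).
    by rewrite -dV -powRM ?invr_ge0 ?(ltW del0)// -powRM ?(ltW Lam0)// divr_ge0 ?(ltW del0).
  have -> : del `^ (1 + beta) = del * del `^ beta.
    by rewrite powRD ?(gt_eqF del0) ?implybT// powRr1 ?(ltW del0).
  by ring.
have nd0 : 0 <= N0 ^+ 2 * del by exact: mulr_ge0 (sqr_ge0 _) (ltW del0).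
have [Z1|Z1] := leP Z 1.
  apply: (le_trans (L_triv x x')).
  have -> : 2 * N0 ^+ 2 * del = N0 ^+ 2 * del * 2 by ring.
  rewrite (ler_wpM2l nd0)//.
  have : 1 <= Z `^ (- beta).
    rewrite powRN -[leLHS]invr1 lef_pV2 ?posrE ?powR_gt0//.
    by rewrite powR_le1 ?(ltW beta0) ?(ltW Z0).
  have h2 : 2 <= 2 + K by rewrite lerDl.
  by move=> h; rewrite -[leLHS]mulr1; apply: ler_pM.
rewrite LE//; apply: le_trans (osc_le _ _ xx') _.
- by move: xI; rewrite inE /boxI/= in_itv/= => /andP[-> /ltW ->].
- by move: x'I; rewrite inE /boxI/= in_itv/= => /andP[-> /ltW ->].
have -> : N0 ^+ 2 * (4 + C1) / rho x x' = N0 ^+ 2 * del * (K * Z^-1).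
  rewrite /rho /K /Z /Lam [`|x - x'|]distrC !exprS; field.
  by rewrite !gt_eqF ?exprn_gt0.
rewrite (ler_wpM2l nd0)//; apply: ler_pM => //.
- by rewrite invr_ge0 ltW.
- by rewrite lerDr.
rewrite powRN lef_pV2 ?posrE ?powR_gt0// -[leRHS]powRr1 ?(ltW Z0)//.
by rewrite ler_powR// ltW.
Qed.

Let theta := Lam `^ (- beta).
Let Cf := 1 + (2 + K) * Cb.

Let L_schur x : \int[leb_itv x0 (x0 + del)]_x' `|L x x'| <= (Cf * N0 * del) ^+ 2 * theta.
Proof.
have [buc' _] := buc; have [bus' _] := bus.
have bL : bounded_meas (fun x' => L x x').
  apply: (bounded_meas_int (leb_itv y0 (y0 + del))
    (u := fun z : R * R => uc (x, z.2) * uc z + us (x, z.2) * us z)).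
  have row u : bounded_meas u -> bounded_meas (fun z : R * R => u (x, z.2) : R).
    by move=> bu; exact: (bounded_meas_snd _ (bounded_meas_slice1 x bu)).
  by apply: bounded_measD; apply: bounded_measM => //; exact: row.
have K0 : 0 <= K by rewrite divr_ge0 ?addr_ge0// ltW.
have Cb0 : 0 <= Cb by rewrite addr_ge0// divr_ge0// subr_ge0 ltW.
pose H := N0 ^+ 2 * (2 + K) * Lam `^ (- beta) * del `^ (1 + beta).
have H0 : 0 <= H.
  rewrite /H mulr_ge0 ?powR_ge0// mulr_ge0 ?powR_ge0//.
  by rewrite mulr_ge0 ?sqr_ge0// addr_ge0.
have bnL := bounded_meas_norm bL.
have mw := measurable_abs_powR beta x.
rewrite -lee_fin EFin_Rintegralb// ge0_integral_leb_itv//; last first.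
  by apply/measurable_EFinP; case: bnL.
apply: (@le_trans _ _ (\int[leb]_(x' in `[x0, (x0 + del)%R[) (H%:E * (`|x' - x| `^ (- beta))%:E))%E).
  apply: ae_ge0_le_integral => //.
  - by apply: measurable_funTS; apply/measurable_EFinP; case: bnL.
  - by move=> x' _; rewrite -EFinM lee_fin mulr_ge0 ?powR_ge0.
  - apply: measurable_funTS; apply/measurable_EFinP.
    by apply: measurable_funM => //; exact: measurable_abs_powR.
  exists [set x]; split => //; first exact: lebesgue_measure_set1.
  move=> x' /=; apply: contra_notP => /eqP xx' _.
  by rewrite -EFinM lee_fin; apply: L_le; rewrite eq_sym.
rewrite ge0_integralZl_EFin//; last first.
  by apply: measurable_funTS; apply/measurable_EFinP; exact: measurable_abs_powR.
apply: (@le_trans _ _ (H%:E * (Cb * del `^ (1 - beta))%:E)%E).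
  by apply: lee_wpmul2l; rewrite ?lee_fin//; exact: integral_abs_powR.
rewrite -EFinM lee_fin.
have -> : H * (Cb * del `^ (1 - beta)) = (N0 * del) ^+ 2 * ((2 + K) * Cb) * theta.
  have dd : del `^ (1 + beta) * del `^ (1 - beta) = del ^+ 2.
    rewrite -powRD ?(gt_eqF del0) ?implybT// -powR_mulrn ?(ltW del0)//; congr (_ `^ _).
    by ring.
  transitivity (N0 ^+ 2 * ((2 + K) * Cb) * theta * (del `^ (1 + beta) * del `^ (1 - beta))).
    by rewrite /H /theta; ring.
  by rewrite dd; ring.
have -> : (Cf * N0 * del) ^+ 2 * theta = (N0 * del) ^+ 2 * Cf ^+ 2 * theta by ring.
apply: ler_wpM2r; first exact: powR_ge0.
apply: ler_wpM2l; first exact: sqr_ge0.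
rewrite /Cf; set q := (2 + K) * Cb.
have q0 : 0 <= q by rewrite mulr_ge0// addr_ge0.
by nra.
Qed.

(** [Lam] measures the oscillation of [lam * S] at the scale [del].  The square-integral bound
    with [theta = Lam ^ (- beta)] comes from Schur's test for [L]; interpolation
    turns it into the power [min (1 / p) (1 / q)] of [theta]. *)
Lemma good_box_bound (u : R * R -> R) (p q : R) (f g : R -> R) :
  1 <= Lam -> bounded_meas u ->
  (forall x y, in_box x y -> u (x, y) = cos (lam * S x y + c) * b (x, y)) ->
  1 < p -> 1 < q -> p^-1 + q^-1 = 1 -> bounded_meas f -> bounded_meas g ->
  `|bform (leb_itv x0 (x0 + del)) (leb_itv y0 (y0 + del)) u f g| <=
  (2 + 2 * Cf) * N0 * del * theta `^ (Num.min p^-1 q^-1) *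
    (\int[leb_itv y0 (y0 + del)]_y (`|f y| `^ p) +
     \int[leb_itv x0 (x0 + del)]_x (`|g x| `^ q)).
Proof.
move=> Lam1 bu uE p1 q1 pq bf bg.
have [buc' ucN] := buc; have [bus' usN] := bus.
have K0 : 0 <= K by rewrite divr_ge0 ?addr_ge0// ltW.
have Cb0 : 0 <= Cb by rewrite addr_ge0// divr_ge0// subr_ge0 ltW.
have Lam0 : 0 < Lam by exact: lt_le_trans Lam1.
have -> : bform (leb_itv x0 (x0 + del)) (leb_itv y0 (y0 + del)) u f g =
          bform (leb_itv x0 (x0 + del)) (leb_itv y0 (y0 + del)) uc f g.
  have bfm v : bounded_meas v -> bounded_meas (fun z : R * R => v z * f z.2 * g z.1).
    move=> bv; apply: bounded_measM; last exact: (bounded_meas_fst _ bg).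
    by apply: bounded_measM => //; exact: (bounded_meas_snd _ bf).
  rewrite /bform !Rintegral_leb_itv; last 2 first.
  - exact: (bounded_meas_int (leb_itv y0 (y0 + del)) (bfm _ buc')).
  - exact: (bounded_meas_int (leb_itv y0 (y0 + del)) (bfm _ bu)).
  apply: eq_Rintegral => x xI; rewrite !Rintegral_leb_itv; last 2 first.
  - exact: (bounded_meas_slice1 x (bfm _ buc')).
  - exact: (bounded_meas_slice1 x (bfm _ bu)).
  apply: eq_Rintegral => y yJ; congr (_ * _ * _).
  rewrite /uc /chi/= !indicE xI yJ !mulr1 uE//; split.
  - by move: xI; rewrite inE/= in_itv/= => /andP[-> /ltW ->].
  - by move: yJ; rewrite inE/= in_itv/= => /andP[-> /ltW ->].
apply: bform_interpolation => //.
- by rewrite /Cf addr_ge0// mulr_ge0// addr_ge0.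
- by rewrite powR_gt0.
- rewrite /theta powRN invf_le1 ?powR_gt0//.
  by rewrite powR_ge1 ?(ltW beta0).
- by rewrite leb_itv_setT ?lerDl ?(ltW del0)// addrAC subrr add0r.
- by rewrite leb_itv_setT ?lerDl ?(ltW del0)// addrAC subrr add0r.
move=> f' g' bf' bg'; apply: (@bform_TTstar _ _ _ _ _ (leb_itv x0 (x0 + del))
  (leb_itv y0 (y0 + del)) uc us buc' bus') => //.
- by rewrite mulr_ge0 ?sqr_ge0 ?powR_ge0.
Qed.

End GoodBox.
End BoxBounds.

(** * Summation over a dyadic stopping tree *)

Section StoppingTree.
Context {R : realType}.
Variables (b : nat -> nat -> nat -> R) (F G : nat -> nat -> R).
Variables (bad near : nat -> nat -> nat -> bool) (D N : nat).
Variables (w : nat -> R) (W : R).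
Hypothesis bS : forall k r s, b k r s =
  b k.+1 r.*2 s.*2 + b k.+1 r.*2 s.*2.+1 + (b k.+1 r.*2.+1 s.*2 + b k.+1 r.*2.+1 s.*2.+1).
Hypothesis FS : forall k s, F k s = F k.+1 s.*2 + F k.+1 s.*2.+1.
Hypothesis GS : forall k r, G k r = G k.+1 r.*2 + G k.+1 r.*2.+1.
Hypotheses (F0 : forall k s, 0 <= F k s) (G0 : forall k r, 0 <= G k r).
Hypotheses (w0 : forall k, 0 <= w k) (W0 : 0 <= W).
Hypothesis bad0 : bad 0 0 0.
Hypothesis bad_near : forall k r s, bad k r s -> near k r s.
Hypothesis bad_near_child : forall k r s, bad k r s ->
  [&& near k.+1 r.*2 s.*2, near k.+1 r.*2 s.*2.+1,
      near k.+1 r.*2.+1 s.*2 & near k.+1 r.*2.+1 s.*2.+1].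
Hypothesis near_row : forall k r, (\sum_(s < 2 ^ k) near k r s <= D)%N.
Hypothesis near_col : forall k s, (\sum_(r < 2 ^ k) near k r s <= D)%N.
Hypothesis good_bound : forall k r s, (k <= N)%N -> ~~ bad k r s ->
  `|b k r s| <= w k * (F k s + G k r).
Hypothesis bad_bound : forall r s, `|b N r s| <= W * (F N s + G N r).

Let sum_double n (f : nat -> R) :
  \sum_(i < n.*2) f i = \sum_(i < n) (f i.*2 + f i.*2.+1).
Proof.
elim: n => [|n ih]; first by rewrite !big_ord0.
by rewrite doubleS !big_ord_recr/= ih addrA.
Qed.

Let sumF k : \sum_(s < 2 ^ k) F k s = F 0 0.
Proof.
elim: k => [|k <-]; first by rewrite expn0 big_ord1.
by rewrite expnS mul2n (sum_double _ (F k.+1)); apply: eq_bigr => s _; rewrite -FS.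
Qed.

Let sumG k : \sum_(s < 2 ^ k) G k s = G 0 0.
Proof.
elim: k => [|k <-]; first by rewrite expn0 big_ord1.
by rewrite expnS mul2n (sum_double _ (G k.+1)); apply: eq_bigr => s _; rewrite -GS.
Qed.

Let sumN k : \sum_(r < 2 ^ k) \sum_(s < 2 ^ k) (near k r s)%:R * (F k s + G k r)
  <= D%:R * (F 0 0 + G 0 0).
Proof.
under eq_bigr do (under eq_bigr do rewrite mulrDr; rewrite big_split).
rewrite big_split mulrDr /=; apply: lerD.
  rewrite exchange_big/= -(sumF k) mulr_sumr; apply: ler_sum => s _.
  by rewrite -mulr_suml -natr_sum ler_wpM2r// ler_nat; exact: near_col.
rewrite -(sumG k) mulr_sumr; apply: ler_sum => r _.
by rewrite -mulr_suml -natr_sum ler_wpM2r// ler_nat; exact: near_row.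
Qed.

Let U k := \sum_(r < 2 ^ k) \sum_(s < 2 ^ k) (bad k r s)%:R * `|b k r s|.
Let V k := \sum_(r < 2 ^ k) \sum_(s < 2 ^ k) (near k r s && ~~ bad k r s)%:R * `|b k r s|.

Let U_step k : U k <= V k.+1 + U k.+1.
Proof.
pose h r s := (near k.+1 r s)%:R * `|b k.+1 r s|.
have h0 r s : 0 <= h r s by rewrite mulr_ge0.
apply: (@le_trans _ _ (\sum_(r < 2 ^ k.+1) \sum_(s < 2 ^ k.+1) h r s)).
  rewrite expnS mul2n (sum_double _ (fun r => \sum_(s < (2 ^ k).*2) h r s)).
  apply: ler_sum => r _; rewrite !sum_double -big_split/=.
  apply: ler_sum => s _.
  case: (boolP (bad k r s)) => [/bad_near_child/and4P[n1 n2 n3 n4]|_]; last first.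
    by rewrite mul0r !addr_ge0.
  rewrite /h n1 n2 n3 n4 !mul1r bS.
  by apply: (le_trans (ler_normD _ _)); apply: lerD; exact: ler_normD.
rewrite /V /U -big_split/=; apply: ler_sum => r _.
rewrite -big_split/=; apply: ler_sum => s _.
rewrite /h -mulrDl ler_wpM2r//.
by case: (boolP (bad _ _ _)) => [/bad_near ->|_]; case: (near _ _ _); rewrite /= ?addr0 ?add0r.
Qed.

Let V_le k : (k <= N)%N -> V k <= w k * (D%:R * (F 0 0 + G 0 0)).
Proof.
move=> kN; apply: le_trans (_ : w k * (\sum_(r < 2 ^ k) \sum_(s < 2 ^ k)
  (near k r s)%:R * (F k s + G k r)) <= _); last by rewrite ler_wpM2l.
rewrite mulr_sumr; apply: ler_sum => r _; rewrite mulr_sumr; apply: ler_sum => s _.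
have FG0 : 0 <= F k s + G k r by exact: addr_ge0.
case: (boolP (bad k r s)) => [_|nb]; rewrite ?andbF ?andbT/=.
  by rewrite mul0r !mulr_ge0.
by rewrite mulrCA ler_wpM2l// good_bound.
Qed.

Let U_le : U N <= W * (D%:R * (F 0 0 + G 0 0)).
Proof.
apply: le_trans (_ : W * (\sum_(r < 2 ^ N) \sum_(s < 2 ^ N)
  (near N r s)%:R * (F N s + G N r)) <= _); last by rewrite ler_wpM2l.
rewrite mulr_sumr; apply: ler_sum => r _; rewrite mulr_sumr; apply: ler_sum => s _.
have FG0 : 0 <= F N s + G N r by exact: addr_ge0.
case: (boolP (bad N r s)) => [/bad_near ->|nb]; last first.
  by rewrite mul0r !mulr_ge0.
by rewrite !mul1r bad_bound.
Qed.

(** Descending from a bad box to its four children, each level only leaves the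
    good children of bad boxes, of which every row and column meets at most
    [D]; the boxes still bad at level [N] are estimated by absolute values. *)
Lemma stopping_tree_bound :
  `|b 0 0 0| <= (\sum_(k < N.+1) w k + W) * D%:R * (F 0 0 + G 0 0).
Proof.
have H k : (k <= N)%N -> U 0 <= \sum_(j < k) V j.+1 + U k.
  elim: k => [_|k ih kN]; first by rewrite big_ord0 add0r.
  apply: (le_trans (ih (ltnW kN))); rewrite big_ord_recr/= -addrA lerD2l.
  exact: U_step.
have U00 : U 0 = `|b 0 0 0|.
  by rewrite /U expn0 !big_ord1/= bad0 mul1r.
rewrite -U00; apply: (le_trans (H N (leqnn N))).
rewrite -mulrA mulrDl; apply: lerD; last exact: U_le.
rewrite big_ord_recl mulrDl -[leLHS]add0r; apply: lerD.
  by rewrite mulr_ge0// mulr_ge0// addr_ge0.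
rewrite mulr_suml; apply: ler_sum => j _; exact: V_le.
Qed.

End StoppingTree.

Lemma count_near (P : pred nat) (D n : nat) :
  (forall s t, P s -> P t -> (s <= t)%N -> (t <= s + D)%N) ->
  (\sum_(s < n) P s <= D.+1)%N.
Proof.
move=> H; rewrite -(big_mkord xpredT (fun s => nat_of_bool (P s))).
rewrite /index_iota subn0 -big_mkcond sum1_count -size_filter.
have [/hasP[s _ Ps]|] := boolP (has P (iota 0 n)); last first.
  by rewrite has_filter negbK => /eqP ->.
have exP : exists s, P s by exists s.
case: (ex_minnP exP) => s0 Ps0 mins0.
rewrite -(size_iota s0 D.+1); apply: uniq_leq_size.
  by rewrite filter_uniq// iota_uniq.
move=> t; rewrite mem_filter [in X in _ -> X]mem_iota => /andP[Pt _].
by rewrite mins0//= addnS ltnS H// mins0.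
Qed.

(** * Schur's test on an arbitrary box *)

Section AnyBox.
Context {R : realType}.
Local Notation leb := (@lebesgue_measure R).

Lemma young_powR (x y p q : R) : 0 <= x -> 0 <= y -> 1 < p -> 1 < q ->
  p^-1 + q^-1 = 1 -> x * y <= x `^ p + y `^ q.
Proof.
move=> x0 y0 p1 q1 pq.
have p0 : 0 < p by exact: lt_trans p1.
have q0 : 0 < q by exact: lt_trans q1.
apply: (le_trans (conjugate_powR x0 y0 p0 q0 pq)).
apply: lerD; rewrite ler_pdivrMr// ler_peMr ?powR_ge0//; exact: ltW.
Qed.

Lemma integral_singular_le (mu M x0 del : R) (v : R -> R) (y : R) :
  0 < mu < 1 -> 0 <= M -> 0 < del -> measurable_fun setT v ->
  (forall x, `|v x| <= M * `|x - y| `^ (- mu)) ->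
  (\int[leb_itv x0 (x0 + del)]_x (`|v x|)%:E <=
    (M * ((1 + 2 / (1 - mu)) * del `^ (1 - mu)))%:E)%E.
Proof.
move=> /andP[mu0 mu1] M0 del0 mv vM.
have mnv : measurable_fun setT (fun x => `|v x|) by exact: measurableT_comp.
rewrite ge0_integral_leb_itv//; last exact/measurable_EFinP.
have mw := measurable_abs_powR mu y.
apply: (@le_trans _ _ (\int[leb]_(x in `[x0, (x0 + del)%R[) (M%:E * (`|x - y| `^ (- mu))%:E))%E).
  apply: ge0_le_integral => //.
  - by apply: measurable_funTS; exact/measurable_EFinP.
  - apply: measurable_funTS; apply/measurable_EFinP.
    by apply: measurable_funM => //; exact: measurable_abs_powR.
  - by move=> x _; rewrite -EFinM lee_fin.
rewrite ge0_integralZl_EFin//; last first.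
  by apply: measurable_funTS; apply/measurable_EFinP; exact: measurable_abs_powR.
rewrite EFinM; apply: lee_wpmul2l; rewrite ?lee_fin//; exact: integral_abs_powR.
Qed.

Lemma Rintegral_singular_le (mu M x0 del : R) (v : R -> R) (y : R) :
  0 < mu < 1 -> 0 <= M -> 0 < del -> bounded_meas v ->
  (forall x, `|v x| <= M * `|x - y| `^ (- mu)) ->
  \int[leb_itv x0 (x0 + del)]_x `|v x| <= M * ((1 + 2 / (1 - mu)) * del `^ (1 - mu)).
Proof.
move=> mu01 M0 del0 bv vM; rewrite -lee_fin EFin_Rintegralb.
  exact: (@integral_singular_le mu M x0 del v y mu01 M0 del0 (proj1 bv) vM).
exact: bounded_meas_norm.
Qed.

(** Schur's test: Young's inequality separates [f] from [g], and the weight is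
    integrable in either variable. *)
Lemma any_box_bound (mu M x0 y0 del p q : R) (u : R * R -> R) (f g : R -> R) :
  0 < mu < 1 -> 0 <= M -> 0 < del -> bounded_meas u ->
  (forall x y, `|u (x, y)| <= M * `|x - y| `^ (- mu)) ->
  1 < p -> 1 < q -> p^-1 + q^-1 = 1 -> bounded_meas f -> bounded_meas g ->
  `|bform (leb_itv x0 (x0 + del)) (leb_itv y0 (y0 + del)) u f g| <=
  M * ((1 + 2 / (1 - mu)) * del `^ (1 - mu)) *
    (\int[leb_itv y0 (y0 + del)]_y (`|f y| `^ p) +
     \int[leb_itv x0 (x0 + del)]_x (`|g x| `^ q)).
Proof.
move=> mu01 M0 del0 bu uM p1 q1 pq bf bg.
set mx := leb_itv x0 (x0 + del); set my := leb_itv y0 (y0 + del).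
set B := M * _.
have p0 : 0 <= p by exact: ltW (lt_trans _ p1).
have q0 : 0 <= q by exact: ltW (lt_trans _ q1).
have bfp := bounded_meas_powR p0 bf; have bgq := bounded_meas_powR q0 bg.
have bnu := bounded_meas_norm bu.
have b1 : bounded_meas (fun z : R * R => `|u z| * `|f z.2| `^ p).
  by apply: bounded_measM => //; exact: (bounded_meas_snd _ bfp).
have b2 : bounded_meas (fun z : R * R => `|u z| * `|g z.1| `^ q).
  by apply: bounded_measM => //; exact: (bounded_meas_fst _ bgq).
have b3 : bounded_meas (fun z : R * R => u z * f z.2 * g z.1).
  apply: bounded_measM; last exact: (bounded_meas_fst _ bg).
  by apply: bounded_measM => //; exact: (bounded_meas_snd _ bf).
have I1 : \int[mx]_x \int[my]_y (`|u (x, y)| * `|f y| `^ p) <= B * \int[my]_y (`|f y| `^ p).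
  rewrite (RFubini mx my b1) -RintegralZb//; apply: le_Rintegralb.
  - exact: (bounded_meas_int mx (bounded_meas_swap b1)).
  - by apply: bounded_measM => //; exact: bounded_meas_cst.
  move=> y /=; under eq_Rintegral do rewrite mulrC.
  rewrite RintegralZb; last exact: (bounded_meas_slice2 y bnu).
  rewrite mulrC ler_wpM2r ?powR_ge0//; apply: Rintegral_singular_le => //.
  exact: (bounded_meas_slice2 y bu).
have I2 : \int[mx]_x \int[my]_y (`|u (x, y)| * `|g x| `^ q) <= B * \int[mx]_x (`|g x| `^ q).
  rewrite -RintegralZb//; apply: le_Rintegralb.
  - exact: (bounded_meas_int my b2).
  - by apply: bounded_measM => //; exact: bounded_meas_cst.
  move=> x /=; under eq_Rintegral do rewrite mulrC.
  rewrite RintegralZb; last exact: (bounded_meas_slice1 x bnu).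
  rewrite mulrC ler_wpM2r ?powR_ge0//; apply: (@Rintegral_singular_le _ _ _ _ _ x) => //.
    exact: (bounded_meas_slice1 x bu).
  by move=> y; rewrite distrC.
rewrite mulrDr; apply: le_trans (lerD I1 I2).
apply: (le_trans (le_norm_Rintegralb mx (bounded_meas_int my b3))).
rewrite -RintegralDb; last 2 first.
- exact: (bounded_meas_int my b1).
- exact: (bounded_meas_int my b2).
apply: le_Rintegralb.
- exact: (bounded_meas_norm (bounded_meas_int my b3)).
- exact: (bounded_measD (bounded_meas_int my b1) (bounded_meas_int my b2)).
move=> x /=; apply: (le_trans (le_norm_Rintegralb my (bounded_meas_slice1 x b3))).
rewrite -RintegralDb; last 2 first.
- exact: (bounded_meas_slice1 x b1).
- exact: (bounded_meas_slice1 x b2).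
apply: le_Rintegralb.
- exact: (bounded_meas_norm (bounded_meas_slice1 x b3)).
- exact: (bounded_measD (bounded_meas_slice1 x b1) (bounded_meas_slice1 x b2)).
move=> y /=; rewrite -mulrDr !normrM -mulrA ler_wpM2l//.
exact: young_powR.
Qed.

Lemma bform_split1 (x0 x1 x2 y0 y1 : R) (u : R * R -> R) (f g : R -> R) :
  x0 <= x1 -> x1 <= x2 -> bounded_meas u -> bounded_meas f -> bounded_meas g ->
  bform (leb_itv x0 x2) (leb_itv y0 y1) u f g =
  bform (leb_itv x0 x1) (leb_itv y0 y1) u f g + bform (leb_itv x1 x2) (leb_itv y0 y1) u f g.
Proof.
move=> x01 x12 bu bf bg.
have b3 : bounded_meas (fun z : R * R => u z * f z.2 * g z.1).
  apply: bounded_measM; last exact: (bounded_meas_fst _ bg).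
  by apply: bounded_measM => //; exact: (bounded_meas_snd _ bf).
by rewrite /bform (@Rintegral_leb_itv_split _ x0 x1 x2)//; exact: (bounded_meas_int (leb_itv y0 y1) b3).
Qed.

Lemma bform_split2 (x0 x1 y0 y1 y2 : R) (u : R * R -> R) (f g : R -> R) :
  y0 <= y1 -> y1 <= y2 -> bounded_meas u -> bounded_meas f -> bounded_meas g ->
  bform (leb_itv x0 x1) (leb_itv y0 y2) u f g =
  bform (leb_itv x0 x1) (leb_itv y0 y1) u f g + bform (leb_itv x0 x1) (leb_itv y1 y2) u f g.
Proof.
move=> y01 y12 bu bf bg.
have b3 : bounded_meas (fun z : R * R => u z * f z.2 * g z.1).
  apply: bounded_measM; last exact: (bounded_meas_fst _ bg).
  by apply: bounded_measM => //; exact: (bounded_meas_snd _ bf).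
rewrite /bform -RintegralDb; last 2 first.
- exact: (bounded_meas_int (leb_itv y0 y1) b3).
- exact: (bounded_meas_int (leb_itv y1 y2) b3).
apply: eq_Rintegral => x _; apply: Rintegral_leb_itv_split => //.
exact: (bounded_meas_slice1 x b3).
Qed.

End AnyBox.

(** * Dyadic grids and strips around lines *)

Section DyadicGrid.
Context {R : realType}.
Local Open Scope complex_scope.
Local Notation normc := (@Normc.normc R).
Variables (slopes : seq R[i]) (A : R).
Hypothesis A0 : 0 < A.
Hypothesis slopes0 : 0 \notin slopes.

Definition mesh k : R := 2 * A / 2 ^+ k.
Definition node k (r : nat) : R := - A + r%:R * mesh k.
Let K : R := \sum_(z <- slopes) normc z.
Let Kinv : R := \sum_(z <- slopes) (normc z)^-1.

(** Proximity to the lines is tested at the lower left corner of a box, in units of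
    the mesh size. *)
Definition within_strip (t : R) k r s : bool :=
  has (fun z => normc ((node k s)%:C - z * (node k r)%:C) < t * mesh k) slopes.

(** Within a box, and from a box to its children, [y - z x] varies by at most
    [1 + K] mesh sizes.  With the threshold [2 (1 + K)] the boxes that are not bad
    are separated from the lines by a full mesh size.  A child of a bad box is
    within [2 * 2 (1 + K) + (1 + K)] of its own mesh sizes, whence the second
    threshold. *)
Definition bad_box := within_strip (2 * (1 + K)).
Definition near_box := within_strip (5 * (1 + K)).
Definition strip_count : nat :=
  (size slopes * (Num.truncn (10 * (1 + K) * (1 + Kinv))).+2)%N.

Lemma mesh_gt0 k : 0 < mesh k.
Proof. by rewrite divr_gt0 ?mulr_gt0// exprn_gt0. Qed.

Lemma meshS k : mesh k = mesh k.+1 + mesh k.+1.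
Proof. by rewrite /mesh exprS; field; rewrite expf_neq0. Qed.

Lemma node_double k r : node k.+1 r.*2 = node k r.
Proof. by rewrite /node [mesh k]meshS -muln2 natrM; ring. Qed.

Lemma node_doubleS k r : node k.+1 r.*2.+1 = node k r + mesh k.+1.
Proof. by rewrite -(node_double k r) /node -[r.*2.+1%:R]natr1; ring. Qed.

Lemma nodeS k r : node k r + mesh k = node k.+1 r.*2.+1 + mesh k.+1.
Proof. by rewrite node_doubleS [mesh k]meshS addrA. Qed.

Let K0 : 0 <= K. Proof. by apply: sumr_ge0 => z _; exact: normc_ge0. Qed.

Let le_K z : z \in slopes -> normc z <= K.
Proof.
move=> zs; rewrite /K (big_rem _ zs)/= lerDl.
by apply: sumr_ge0 => t _; exact: normc_ge0.
Qed.

Let Kinv0 : 0 <= Kinv.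
Proof. by apply: sumr_ge0 => z _; rewrite invr_ge0 normc_ge0. Qed.

Let le_Kinv z : z \in slopes -> (normc z)^-1 <= Kinv.
Proof.
move=> zs; rewrite /Kinv (big_rem _ zs)/= lerDl.
by apply: sumr_ge0 => t _; rewrite invr_ge0 normc_ge0.
Qed.

Let normc_gt0 z : z \in slopes -> 0 < normc z.
Proof.
move=> zs; rewrite lt_def normc_ge0 andbT; apply: contra slopes0 => /eqP.
by move=> /(@Normc.eq0_normc R) <-.
Qed.

Let strip_move (x y x' y' d : R) z : z \in slopes -> 0 <= d -> `|x' - x| <= d -> `|y' - y| <= d ->
  normc (y'%:C - z * x'%:C) <= normc (y%:C - z * x%:C) + (1 + K) * d.
Proof.
move=> zs d0 xd yd.
have -> : y'%:C - z * x'%:C = (y%:C - z * x%:C) + ((y' - y)%:C - z * (x' - x)%:C).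
  by rewrite !rmorphB/=; ring.
apply: (le_trans (normcD _ _)); rewrite lerD2l mulrDl mul1r.
apply: (le_trans (normcB _ _)); rewrite Normc.normcM !normc_real.
apply: lerD => //; apply: ler_pM => //; rewrite ?normc_ge0//.
exact: le_K.
Qed.

Lemma good_box_separated k r s x y z : ~~ bad_box k r s -> z \in slopes ->
  node k r <= x <= node k r + mesh k -> node k s <= y <= node k s + mesh k ->
  mesh k <= normc (y%:C - z * x%:C).
Proof.
move=> /hasPn/(_ z) + zs => /(_ zs); rewrite -leNgt => h /andP[x1 x2] /andP[y1 y2].
have m0 := mesh_gt0 k.
have := @strip_move x y (node k r) (node k s) (mesh k) z zs (ltW m0).
rewrite !ler_norml => H.
have {H} : normc ((node k s)%:C - z * (node k r)%:C) <=
    normc (y%:C - z * x%:C) + (1 + K) * mesh k.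
  by apply: H; apply/andP; split; lra.
have : 0 <= K * mesh k by rewrite mulr_ge0// ltW.
move: h; lra.
Qed.

Lemma bad_box_root : 1 \in slopes -> bad_box 0 0 0.
Proof.
move=> s1; apply/hasP; exists 1 => //.
rewrite mul1r subrr Normc.normc0 mulr_gt0 ?mesh_gt0// mulr_gt0//.
by rewrite ltr_wpDr.
Qed.

Lemma bad_box_near k r s : bad_box k r s -> near_box k r s.
Proof.
apply: sub_has => z h; apply: (lt_le_trans h); rewrite ler_wpM2r ?(ltW (mesh_gt0 k))//.
by have := K0; lra.
Qed.

Lemma bad_box_near_child k r s : bad_box k r s ->
  [&& near_box k.+1 r.*2 s.*2, near_box k.+1 r.*2 s.*2.+1,
      near_box k.+1 r.*2.+1 s.*2 & near_box k.+1 r.*2.+1 s.*2.+1].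
Proof.
move=> /hasP[z zs h]; have m0 := mesh_gt0 k.+1.
have H r' s' : `|node k.+1 r' - node k r| <= mesh k.+1 ->
    `|node k.+1 s' - node k s| <= mesh k.+1 -> near_box k.+1 r' s'.
  move=> hr hs; apply/hasP; exists z => //.
  apply: (le_lt_trans (strip_move zs (ltW m0) hr hs)).
  rewrite [mesh k]meshS in h.
  by move: h; lra.
have E1 t : `|node k.+1 t.*2 - node k t| <= mesh k.+1.
  by rewrite node_double subrr normr0 ltW.
have E2 t : `|node k.+1 t.*2.+1 - node k t| <= mesh k.+1.
  by rewrite node_doubleS addrAC subrr add0r gtr0_norm.
by rewrite !H.
Qed.

Let has_count (f : nat -> R[i] -> bool) D n :
  (forall z, z \in slopes -> (\sum_(s < n) f s z <= D)%N) ->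
  (\sum_(s < n) has (f s) slopes <= size slopes * D)%N.
Proof.
elim: slopes => [|z l ih] H.
  by rewrite mul0n leqn0 sum_nat_eq0; apply/forallP.
rewrite mulSn; apply: (@leq_trans (\sum_(s < n) (f s z + has (f s) l))%N).
  by apply: leq_sum => s _ /=; case: (f s z); case: has.
rewrite big_split/=; apply: leq_add; first by apply: H; rewrite mem_head.
by apply: ih => t tl; apply: H; rewrite inE tl orbT.
Qed.

Let gap_le (D : R) (s t : nat) : t%:R - s%:R < D -> (t <= s + (Num.truncn D).+1)%N.
Proof.
move=> h; rewrite -(ler_nat R) natrD -lerBlDl.
by apply: ltW; apply: (lt_trans h); exact: truncnS_gt.
Qed.

Let T : R := 5 * (1 + K).

Let T0 : 0 <= T. Proof. by rewrite mulr_ge0// addr_ge0. Qed.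

Let DE : 2 * T * (1 + Kinv) = 10 * (1 + K) * (1 + Kinv).
Proof. by rewrite /T; ring. Qed.

Lemma near_box_row k r : (\sum_(s < 2 ^ k) near_box k r s <= strip_count)%N.
Proof.
have m0 := mesh_gt0 k.
apply: (@has_count (fun s z => normc ((node k s)%:C - z * (node k r)%:C) < T * mesh k)) => z zs.
apply: (@count_near (fun s => normc ((node k s)%:C - z * (node k r)%:C) < T * mesh k)).
move=> s t hs ht st; apply: gap_le; rewrite -DE.
have : normc ((node k t)%:C - (node k s)%:C) < 2 * T * mesh k.
  have -> : (node k t)%:C - (node k s)%:C = ((node k t)%:C - z * (node k r)%:C) -
    ((node k s)%:C - z * (node k r)%:C) by ring.
  by apply: (le_lt_trans (normcB _ _)); move: hs ht; lra.
rewrite real_complexB normc_real /node => h.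
have {}h : (t%:R - s%:R) * mesh k < 2 * T * mesh k.
  by apply: le_lt_trans h; rewrite (le_trans _ (ler_norm _))// le_eqVlt; apply/orP; left; apply/eqP; ring.
rewrite ltr_pM2r// in h.
apply: (lt_le_trans h); apply: ler_peMr; first by rewrite mulr_ge0.
by rewrite lerDl.
Qed.

(** In a column the number of boxes near the line of slope [z] is proportional to
    [1 / |z|]; this is where the slopes must not vanish. *)
Lemma near_box_col k s : (\sum_(r < 2 ^ k) near_box k r s <= strip_count)%N.
Proof.
have m0 := mesh_gt0 k.
apply: (@has_count (fun r z => normc ((node k s)%:C - z * (node k r)%:C) < T * mesh k)) => z zs.
apply: (@count_near (fun r => normc ((node k s)%:C - z * (node k r)%:C) < T * mesh k)).
move=> r t hr ht rt; apply: gap_le; rewrite -DE.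
have z0 := normc_gt0 zs.
have : normc (z * ((node k t)%:C - (node k r)%:C)) < 2 * T * mesh k.
  have -> : z * ((node k t)%:C - (node k r)%:C) = ((node k s)%:C - z * (node k r)%:C) -
    ((node k s)%:C - z * (node k t)%:C) by ring.
  by apply: (le_lt_trans (normcB _ _)); move: hr ht; lra.
rewrite real_complexB Normc.normcM normc_real /node => h.
have {}h : (t%:R - r%:R) * mesh k < 2 * T * (normc z)^-1 * mesh k.
  rewrite mulrAC ltr_pdivlMr// mulrC.
  apply: le_lt_trans h; rewrite ler_pM2l//.
  by rewrite (le_trans _ (ler_norm _))// le_eqVlt; apply/orP; left; apply/eqP; ring.
rewrite ltr_pM2r// in h.
apply: (lt_le_trans h); apply: ler_wpM2l; first by rewrite mulr_ge0.
by rewrite (le_trans (le_Kinv zs))// lerDr.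
Qed.

End DyadicGrid.

(** * The bilinear bound with its decay *)

Section BilinearBound.
Context {R : realType}.

(** Cutting the kernel off near the diagonal makes it bounded; below the finest
    mesh size in use, the cut-off does not meet any good box. *)
Definition cut_kernel n (a : nat -> R) (b : R * R -> R) (lam c eps : R) (z : R * R) : R :=
  cos (lam * phase n a z.1 z.2 + c) * b z * \1_[set w : R * R | eps <= `|w.1 - w.2|] z.

Lemma cut_kernel_bound n a b b1 mu M lam c eps x y : amplitude mu M b b1 -> 0 <= M ->
  `|cut_kernel n a b lam c eps (x, y)| <= M * `|x - y| `^ (- mu).
Proof.
move=> ampb M0; rewrite /cut_kernel !normrM -[leRHS]mulr1; apply: ler_pM => //.
  rewrite -[leRHS]mul1r; apply: ler_pM => //; first exact: cos_max.
  exact: amp_bound ampb _ _.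
by rewrite indicE; case: (_ \in _); rewrite ?normr1 ?normr0.
Qed.

Lemma cut_kernel_bounded n a b b1 mu M lam c eps : amplitude mu M b b1 -> 0 <= M ->
  0 < mu -> 0 < eps -> bounded_meas (cut_kernel n a b lam c eps).
Proof.
move=> ampb M0 mu0 e0; split.
  apply: measurable_funM.
    apply: measurable_funM; first exact: measurable_cos_phase.
    exact: amp_meas ampb.
  apply: measurable_indic.
  have mf : measurable_fun setT (fun w : R * R => `|w.1 - w.2|).
    by apply: measurableT_comp => //; exact: measurable_funB.
  rewrite (_ : [set w | _] = setT `&` (fun w : R * R => `|w.1 - w.2|) @^-1` `[eps, +oo[).
    by apply: mf => //; exact: measurable_itv.
  by rewrite setTI; apply/seteqP; split => w /=; rewrite in_itv/= andbT.
exists (M * eps `^ (- mu)) => -[x y].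
have [h|h] := leP eps `|x - y|; last first.
  rewrite /cut_kernel indicE memNset/= ?mulr0 ?normr0 ?mulr_ge0 ?powR_ge0//.
  by apply/negP; rewrite -ltNge.
apply: (le_trans (cut_kernel_bound _ _ _ _ _ _ _ ampb M0)).
rewrite ler_wpM2l// !powRN lef_pV2 ?posrE ?powR_gt0//; last exact: lt_le_trans h.
by rewrite ge0_ler_powR ?nnegrE ?(ltW mu0) ?(ltW e0).
Qed.

Lemma powR2_gt1 (gam : R) : 0 < gam -> 1 < 2 `^ gam.
Proof.
move=> gam0; by rewrite /powR pnatr_eq0/= expR_gt1 mulr_gt0// ln_gt0// ltr1n.
Qed.

Lemma geometric_bound (r : R) N : 0 <= r -> r < 1 -> \sum_(j < N) r ^+ j <= (1 - r)^-1.
Proof.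
move=> r0 r1; have r1' : 0 < 1 - r by rewrite subr_gt0.
rewrite -[leRHS]mul1r ler_pdivlMr// mulrC.
have -> : (1 - r) * \sum_(j < N) r ^+ j = 1 - r ^+ N.
  have := subrXX 1 r N; rewrite expr1n => ->; congr (_ * _).
  by apply: eq_bigr => j _; rewrite expr1n mul1r.
by rewrite lerBlDr lerDl exprn_ge0.
Qed.

(** The mesh sizes decrease geometrically, so a sum of negative powers is
    comparable to its last term. *)
Lemma sum_mesh_powR (A gam : R) N : 0 < A -> 0 < gam ->
  \sum_(k < N.+1) mesh A k `^ (- gam) <= (1 - 2 `^ (- gam))^-1 * mesh A N `^ (- gam).
Proof.
move=> A0 gam0; pose r : R := 2 `^ (- gam).
have r0 : 0 <= r by exact: powR_ge0.
have r1 : r < 1.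
  rewrite /r powRN invf_lt1 ?powR_gt0//.
  exact: powR2_gt1.
have E k : (k <= N)%N -> mesh A k `^ (- gam) = r ^+ (N - k) * mesh A N `^ (- gam).
  move=> kN; have -> : mesh A k = 2 ^+ (N - k) * mesh A N.
    have -> : mesh A N = 2 * A / (2 ^+ (N - k) * 2 ^+ k) by rewrite -exprD subnK.
    by rewrite /mesh; field; rewrite !expf_neq0.
  rewrite powRM ?exprn_ge0 ?(ltW (mesh_gt0 A0 _))//; congr (_ * _).
  by rewrite -powR_mulrn// -powRrM mulrC powRrM powR_mulrn.
rewrite (eq_bigr (fun k : 'I_N.+1 => r ^+ (N - k) * mesh A N `^ (- gam))); last first.
  by move=> k _; apply: E; rewrite -ltnS.
rewrite -mulr_suml ler_wpM2r ?powR_ge0//.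
rewrite (reindex_inj rev_ord_inj)/=.
rewrite (eq_bigr (fun k : 'I_N.+1 => r ^+ k)).
  exact: geometric_bound.
by move=> k _; rewrite subSS subKn// -ltnS.
Qed.

Lemma dyadic_level (A T : R) : 0 < A -> 0 < T -> 1 <= 2 * A * T ->
  exists N, T^-1 <= mesh A N <= 2 * T^-1.
Proof.
move=> A0 T0 h; pose t := Num.truncn (2 * A * T).
have h0 : 0 <= 2 * A * T by exact: le_trans h.
have t0 : (0 < t)%N by rewrite truncn_gt0.
have /andP[t1 t2] := trunc_log_bounds (isT : (1 < 2)%N) t0.
set N := trunc_log 2 t in t1 t2; exists N.
have /andP[u1 u2] := truncn_itv h0; rewrite -/t in u1 u2.
have l1 : 2 ^+ N <= 2 * A * T by apply: le_trans u1; rewrite -natrX ler_nat.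
have l2 : 2 * A * T < 2 ^+ N * 2.
  by apply: (lt_le_trans u2); rewrite -exprSr -natrX ler_nat.
have P0 : 0 < 2 ^+ N :> R by rewrite exprn_gt0.
rewrite /mesh; apply/andP; split.
  by rewrite ler_pdivlMr// mulrC ler_pdivrMr.
by rewrite ler_pdivrMr// mulrAC ler_pdivlMr// [leRHS]mulrC ltW.
Qed.

Variables (m : nat) (a : nat -> R) (mu M A beta p q : R).
Local Notation n := m.+2.
Hypothesis a1am : a 1%N * a m.+1 != 0.
Hypotheses (mu0 : 0 < mu) (mu1 : mu < 1) (M0 : 0 <= M) (A1 : 1 <= 2 * A).
Hypotheses (beta0 : 0 < beta) (beta1 : beta < 1).
Hypotheses (p1 : 1 < p) (q1 : 1 < q) (pq : p^-1 + q^-1 = 1).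
Let s := Num.min p^-1 q^-1.
Hypothesis sbeta : 1 - mu < n%:R * beta * s.

(** Good boxes of mesh [d] contribute [lam ^ (- beta s) d ^ (- gam)] with [gam > 0],
    which grows as [d] decreases; below [d = lam ^ (- 1 / n)] there is no
    oscillation left and the sizes [d ^ (1 - mu)] decrease.  Both regimes meet
    at [lam ^ (- (1 - mu) / n)]. *)
Lemma dyadic_bilinear_bound : exists C : R, 0 <= C /\
  forall b b1, amplitude mu M b b1 -> forall lam c : R, 1 <= lam ->
  exists eps0 : R, 0 < eps0 /\ forall eps, 0 < eps -> eps <= eps0 ->
  forall f g : R -> R, bounded_meas f -> bounded_meas g ->
  `|bform (leb_itv (- A) A) (leb_itv (- A) A) (cut_kernel n a b lam c eps) f g| <=
  C * lam `^ (- ((1 - mu) / n%:R)) *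
   (\int[leb_itv (- A) A]_y (`|f y| `^ p) + \int[leb_itv (- A) A]_x (`|g x| `^ q)).
Proof.
have A20 : 0 < 2 * A by exact: lt_le_trans A1.
have A0 : 0 < A by rewrite -(pmulr_rgt0 _ (ltr0Sn R 1)).
have p0 : 0 < p by exact: lt_trans p1.
have q0 : 0 < q by exact: lt_trans q1.
have mu1' : 0 < 1 - mu by rewrite subr_gt0.
have beta1' : 0 < 1 - beta by rewrite subr_gt0.
have [cs [c0 [C1 [c00 C10 ncs structure]]]] := phase_structure a1am.
pose slopes := (1 : R[i]) :: cs.
have nslopes : 0 \notin slopes by rewrite inE negb_or eq_sym oner_neq0 ncs.
pose Cf := 1 + (2 + (4 + C1) / c0) * (1 + 2 / (1 - beta)).
have Cf0 : 0 <= Cf.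
  have k0 : 0 <= (4 + C1) / c0 by rewrite divr_ge0 ?(ltW c00)// addr_ge0.
  have k1 : 0 <= 2 / (1 - beta) by rewrite divr_ge0 ?(ltW beta1').
  by rewrite addr_ge0// mulr_ge0// addr_ge0.
pose gam := n%:R * beta * s - (1 - mu).
have gam0 : 0 < gam by rewrite subr_gt0.
pose Cg := (1 - 2 `^ (- gam))^-1.
pose Cmu := 1 + 2 / (1 - mu).
have Cmu0 : 0 <= Cmu by rewrite addr_ge0// divr_ge0// (ltW mu1').
pose D : R := (strip_count slopes)%:R.
pose C2 := (2 + 2 * Cf) * M.
have C20 : 0 <= C2 by rewrite mulr_ge0// addr_ge0// mulr_ge0.
have Cg0 : 0 <= Cg.
  by rewrite invr_ge0 subr_ge0 powRN invf_le1 ?powR_gt0// ltW// powR2_gt1.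
exists ((C2 * Cg + M * (Cmu * 2 `^ (1 - mu))) * D); split.
  rewrite mulr_ge0// addr_ge0// mulr_ge0// mulr_ge0// powR_ge0.
move=> b b1 ampb lam c lam1.
have lam0 : 0 < lam by exact: lt_le_trans lam1.
pose T := lam `^ (n%:R^-1).
have T0 : 0 < T by exact: powR_gt0.
have T1 : 1 <= T by rewrite powR_ge1 ?invr_ge0.
have Tn : T ^+ n = lam.
  by rewrite -powR_mulrn ?(ltW T0)// -powRrM mulVf ?powRr1 ?(ltW lam0)// pnatr_eq0.
have [N /andP[dN1 dN2]] : exists N, T^-1 <= mesh A N <= 2 * T^-1.
  apply: dyadic_level => //; apply: (le_trans A1); rewrite ler_peMr//; exact: ltW.
exists (mesh A N); split; first exact: mesh_gt0.
move=> eps eps0 epsN f g bf bg.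
set u := cut_kernel n a b lam c eps.
have bu : bounded_meas u by exact: cut_kernel_bounded ampb M0 mu0 eps0.
have uM x y : `|u (x, y)| <= M * `|x - y| `^ (- mu) by exact: cut_kernel_bound ampb M0.
have bfp : bounded_meas (fun y => `|f y| `^ p) by apply: bounded_meas_powR => //; exact: ltW.
have bgq : bounded_meas (fun x => `|g x| `^ q) by apply: bounded_meas_powR => //; exact: ltW.
pose lebn k r := leb_itv (node A k r) (node A k r + mesh A k).
pose Fk k r := \int[lebn k r]_y (`|f y| `^ p).
pose Gk k r := \int[lebn k r]_x (`|g x| `^ q).
pose bk k r s := bform (lebn k r) (lebn k s) u f g.
pose w k := C2 * (lam `^ (- (beta * s)) * mesh A k `^ (- gam)).
pose W := M * (Cmu * mesh A N `^ (1 - mu)).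
have h1 k r : node A k r <= node A k r + mesh A k.+1 by rewrite lerDl ltW// mesh_gt0.
have h2 k r : node A k r + mesh A k.+1 <= node A k r + mesh A k.
  by rewrite [mesh A k]meshS addrA lerDl ltW// mesh_gt0.
have ml k r : lebn k.+1 r.*2 = leb_itv (node A k r) (node A k r + mesh A k.+1).
  by rewrite /lebn node_double.
have mr k r : lebn k.+1 r.*2.+1 = leb_itv (node A k r + mesh A k.+1) (node A k r + mesh A k).
  by rewrite /lebn -nodeS node_doubleS.
have root : lebn 0%N 0%N = leb_itv (- A) A.
  rewrite /lebn /node /mesh expr0 mul0r addr0; congr leb_itv; by field.
apply: (@le_trans _ _ ((\sum_(k < N.+1) w k + W) * D * (Fk 0%N 0%N + Gk 0%N 0%N))).
have <- : bk 0%N 0%N 0%N = bform (leb_itv (- A) A) (leb_itv (- A) A) u f g.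
  by rewrite /bk root.
apply: (@stopping_tree_bound R bk Fk Gk (bad_box slopes A) (near_box slopes A)
  (strip_count slopes) N w W).
- move=> k r t; rewrite /bk.
  rewrite [lebn k r]/lebn (@bform_split1 _ _ (node A k r + mesh A k.+1))//.
  have split2 x x' : bform (leb_itv x x') (leb_itv (node A k t) (node A k t + mesh A k)) u f g =
      bform (leb_itv x x') (lebn k.+1 t.*2) u f g + bform (leb_itv x x') (lebn k.+1 t.*2.+1) u f g.
    by rewrite ml mr; exact: bform_split2.
  by rewrite !split2 !ml !mr.
- by move=> k r; rewrite /Fk ml mr -Rintegral_leb_itv_split.
- by move=> k r; rewrite /Gk ml mr -Rintegral_leb_itv_split.
- by move=> k r; apply: Rintegral_ge0 => ? _; exact: powR_ge0.
- by move=> k r; apply: Rintegral_ge0 => ? _; exact: powR_ge0.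
- by move=> k; rewrite mulr_ge0// mulr_ge0// powR_ge0.
- by rewrite mulr_ge0// mulr_ge0// powR_ge0.
- by apply: bad_box_root => //; rewrite mem_head.
- by move=> k r t; exact: bad_box_near.
- by move=> k r t; exact: bad_box_near_child.
- by move=> k r; exact: near_box_row.
- by move=> k r; exact: near_box_col.
- move=> k r t kN good.
  have del0 := mesh_gt0 A0 k.
  have delN : mesh A N <= mesh A k.
    rewrite /mesh ler_pM2l ?mulr_gt0// lef_pV2 ?posrE ?exprn_gt0//.
    by rewrite ler_eXn2l// ltr1n.
  have sep x y z : node A k r <= x <= node A k r + mesh A k /\ node A k t <= y <= node A k t + mesh A k ->
     z \in slopes -> mesh A k <= Normc.normc (y%:C - z * x%:C)%C.
    by move=> [xI yI] zs; exact: good_box_separated good zs xI yI.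
  have sepd x y : node A k r <= x <= node A k r + mesh A k /\ node A k t <= y <= node A k t + mesh A k ->
     mesh A k <= `|x - y|.
    move=> xy; have := sep x y 1 xy (mem_head _ _).
    by rewrite mul1r real_complexB normc_real distrC.
  have Lam1 : 1 <= lam * mesh A k ^+ n.
    rewrite -Tn -exprMn; apply: exprn_ege1.
    by rewrite -ler_pdivrMl// mulr1; exact: le_trans delN.
  have uE x y : node A k r <= x <= node A k r + mesh A k /\ node A k t <= y <= node A k t + mesh A k ->
    u (x, y) = cos (lam * phase n a x y + c) * b (x, y).
    move=> xy; rewrite /u /cut_kernel indicE mem_set ?mulr1//=.
    exact: le_trans epsN (le_trans delN (sepd _ _ xy)).
  have sepc x y z : node A k r <= x <= node A k r + mesh A k /\ node A k t <= y <= node A k t + mesh A k ->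
     z \in cs -> mesh A k <= Normc.normc (y%:C - z * x%:C)%C.
    by move=> xy zs; apply: sep => //; rewrite inE zs orbT.
  have := @good_box_bound R m a mu M beta c0 C1 cs mu0 beta0 beta1 c00 C10 M0 structure
    b b1 ampb (node A k r) (node A k t) (mesh A k) lam c del0 lam0 sepc sepd
    u p q f g Lam1 bu uE p1 q1 pq bf bg.
  rewrite -/Cf => H; apply: (le_trans H).
  rewrite le_eqVlt; apply/orP; left; apply/eqP; congr (_ * _).
  rewrite /w /C2 -/s.
  have -> : ((lam * mesh A k ^+ n) `^ (- beta)) `^ s =
     lam `^ (- (beta * s)) * mesh A k `^ (- (n%:R * beta * s)).
    rewrite -powRrM mulNr powRM ?exprn_ge0 ?(ltW lam0) ?(ltW del0)//; congr (_ * _).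
    by rewrite -powR_mulrn ?(ltW del0)// -powRrM; congr (_ `^ _); ring.
  have -> : mesh A k `^ (- gam) = mesh A k `^ (- mu) * mesh A k * mesh A k `^ (- (n%:R * beta * s)).
    rewrite -{3}[mesh A k]powRr1 ?(ltW del0)// -!powRD ?(gt_eqF del0) ?implybT//.
    by congr (_ `^ _); rewrite /gam; ring.
  by ring.
- by move=> r t; apply: any_box_bound => //; [rewrite mu0 mu1|exact: mesh_gt0].
rewrite /Fk /Gk root ler_wpM2r//.
  by rewrite addr_ge0//; apply: Rintegral_ge0 => ? _; exact: powR_ge0.
rewrite [leRHS]mulrAC ler_wpM2r ?ler0n// mulrDl.
have TE (e : R) : T `^ e = lam `^ (e / n%:R) by rewrite -powRrM mulrC.
have sE : lam `^ (- ((1 - mu) / n%:R)) = T `^ (- (1 - mu)) by rewrite TE mulNr.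
rewrite sE; apply: lerD.
  rewrite /w -mulr_sumr -mulr_sumr -[C2 * Cg * _]mulrA; apply: ler_wpM2l => //.
  apply: (@le_trans _ _ (lam `^ (- (beta * s)) * (Cg * T `^ gam))).
    apply: ler_wpM2l; first exact: powR_ge0.
    apply: (le_trans (sum_mesh_powR _ A0 gam0)); apply: ler_wpM2l => //.
    rewrite powRN -[leRHS]invrK lef_pV2 ?posrE ?invr_gt0 ?powR_gt0 ?mesh_gt0//.
    rewrite -powR_inv1 ?powR_ge0// -powRrM mulrC powRrM powR_inv1 ?(ltW T0)//.
    by rewrite ge0_ler_powR ?nnegrE ?invr_ge0 ?(ltW gam0) ?(ltW T0) ?(ltW (mesh_gt0 A0 N)).
  rewrite mulrCA; apply: ler_wpM2l => //; rewrite le_eqVlt; apply/orP; left; apply/eqP.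
  have -> : lam `^ (- (beta * s)) = T `^ (- (n%:R * beta * s)).
    rewrite TE; congr (_ `^ _).
    by rewrite mulNr -[n%:R * beta * s]mulrA [_ * (beta * s) / _]mulrAC divff ?mul1r// pnatr_eq0.
  by rewrite -powRD ?(gt_eqF T0) ?implybT//; congr (_ `^ _); rewrite /gam; ring.
rewrite /W -mulrA; apply: ler_wpM2l => //; rewrite -mulrA; apply: ler_wpM2l => //.
have -> : 2 `^ (1 - mu) * T `^ (- (1 - mu)) = (2 * T^-1) `^ (1 - mu).
  rewrite powRM ?invr_ge0 ?(ltW T0)//; congr (_ * _).
  by rewrite powR_inv.
apply: ge0_ler_powR => //; rewrite ?nnegrE ?(ltW mu1')//.
- exact: ltW (mesh_gt0 A0 N).
- by apply: mulr_ge0 => //; rewrite invr_ge0 ltW.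
Qed.

End BilinearBound.

(** * Duality *)

Section Duality.
Context {R : realType}.

Lemma normr_sg_powR (x p : R) : 1 < p -> (Num.sg x * `|x| `^ (p - 1)) * x = `|x| `^ p.
Proof.
move=> p1; have p0 : 0 < p by exact: lt_trans p1.
by rewrite mulrAC -normrEsg -(mulr_powRB1 (normr_ge0 x) p0).
Qed.

(** A bound for the bilinear form is turned into a norm bound by testing against
    [tau * sgn h * |h| ^ (p - 1)], with [tau] such that the second term on the
    right is half of the left-hand side. *)
Lemma dual_norm_bound d (T : measurableType d) (m : {finite_measure set T -> \bar R})
    (h : T -> R) (N F p q : R) :
  bounded_meas h -> 0 < N -> 1 < p -> 1 < q -> p^-1 + q^-1 = 1 ->
  (forall g, bounded_meas g ->
    `|\int[m]_x (h x * g x)| <= N * (F + \int[m]_x (`|g x| `^ q))) ->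
  \int[m]_x (`|h x| `^ p) <= (2 * N) `^ p * F.
Proof.
move=> bh N0 p1 q1 pq H.
have p0 : 0 < p by exact: lt_trans p1.
have q0 : 0 < q by exact: lt_trans q1.
have pq1 : (p - 1) * q = p.
  have -> : p = p * (p^-1 + q^-1) * 1 by rewrite pq !mulr1.
  have : p * q != 0 by rewrite mulf_neq0 ?gt_eqF.
  have E : p + q = p * q.
    rewrite -[RHS]mulr1 -pq; field; rewrite !gt_eqF//.
  by rewrite pq !mulr1; move: E; lra.
have pq2 : (p - 1) * (q - 1) = 1 by rewrite mulrBr pq1; ring.
pose tau := (2 * N) `^ (- (p - 1)).
have N20 : 0 < 2 * N by rewrite mulr_gt0.
have tau0 : 0 < tau by exact: powR_gt0.
have tauq : N * tau `^ q = tau / 2.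
  have -> : q = 1 + (q - 1) by ring.
  rewrite powRD ?(gt_eqF tau0) ?implybT// powRr1 ?(ltW tau0)//.
  by rewrite -powRrM mulNr pq2 powR_inv1 ?(ltW N20)//; field; rewrite gt_eqF.
pose g x := tau * (Num.sg (h x) * `|h x| `^ (p - 1)).
have [mh hM] := bh.
have bsg : bounded_meas (fun x => Num.sg (h x)).
  split; last by exists 1 => x; rewrite normr_sg; case: (_ != 0).
  have -> : (fun x => Num.sg (h x)) =
      (fun x => \1_(`]0, +oo[%classic) (h x) - \1_(`]-oo, 0[%classic) (h x)).
    apply/funext => x; rewrite !indicE !mem_setE !in_itv/= andbT.
    by case: sgrP; rewrite ?subrr ?subr0 ?sub0r.
  have mI (i : interval R) : measurable_fun setT (\1_[set` i] : measurableTypeR R -> R).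
    by apply: measurable_indic; exact: measurable_itv.
  by apply: measurable_funB; apply: measurableT_comp (mI _) mh.
have bhp1 : bounded_meas (fun x => `|h x| `^ (p - 1)).
  by apply: bounded_meas_powR => //; rewrite subr_ge0 ltW.
have bhp : bounded_meas (fun x => `|h x| `^ p) by apply: bounded_meas_powR => //; exact: ltW.
have bg : bounded_meas g.
  by apply: bounded_measM; [exact: bounded_meas_cst|exact: bounded_measM].
set X := \int[m]_x (`|h x| `^ p).
have X0 : 0 <= X by apply: Rintegral_ge0 => ? _; exact: powR_ge0.
have := H g bg.
have -> : \int[m]_x (h x * g x) = tau * X.
  rewrite -RintegralZb//; apply: eq_Rintegral => x _.
  by rewrite /g mulrCA [h x * _]mulrC normr_sg_powR.
have Gq : \int[m]_x (`|g x| `^ q) <= tau `^ q * X.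
  rewrite -RintegralZb//; apply: le_Rintegralb.
  - by apply: bounded_meas_powR => //; exact: ltW.
  - by apply: bounded_measM => //; exact: bounded_meas_cst.
  move=> x; rewrite /g normrM (gtr0_norm tau0) powRM ?(ltW tau0)//.
  rewrite ler_wpM2l ?powR_ge0// normrM (ger0_norm (powR_ge0 _ _)).
  have -> : `|h x| `^ p = (`|h x| `^ (p - 1)) `^ q by rewrite -powRrM pq1.
  apply: ge0_ler_powR; rewrite ?nnegrE ?(ltW q0) ?mulr_ge0 ?powR_ge0//.
  by rewrite ler_piMl ?powR_ge0// normr_sg; case: (_ != 0).
rewrite ger0_norm ?mulr_ge0 ?(ltW tau0)// => HX.
have HX2 : tau * X <= N * F + (N * tau `^ q) * X.
  apply: (le_trans HX); rewrite mulrDr lerD2l -mulrA.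
  by rewrite ler_wpM2l// ltW.
rewrite tauq in HX2.
have HX3 : X <= 2 * N * F / tau by rewrite ler_pdivlMr// mulrC; lra.
apply: (le_trans HX3); rewrite le_eqVlt; apply/orP; left; apply/eqP.
rewrite /tau powRN invrK mulrAC; congr (_ * _).
by rewrite (mulr_powRB1 (ltW N20) p0).
Qed.

Lemma limn_einf_le (u : (\bar R)^nat) (c : \bar R) : (forall n, (u n <= c)%E) ->
  (limn_einf u <= c)%E.
Proof.
move=> H; rewrite limn_einf_lim; apply: lime_le.
  by apply/cvg_ex; eexists; apply/ereal_nondecreasing_cvgn; exact: nondecreasing_einfs.
by apply: nearW => n; apply: le_trans (H n); apply: ereal_inf_lbound; exists n => //=.
Qed.

Lemma continuous_abs_powR (p : R) : 0 < p -> continuous (fun x : R => `|x| `^ p).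
Proof.
move=> p0 x.
have [->|x0] := eqVneq x 0.
  rewrite /continuous_at normr0 powR0 ?gt_eqF//.
  apply/cvgrPdist_lt => e e0; near=> y.
  rewrite sub0r normrN ger0_norm ?powR_ge0//.
  have -> : e = (e `^ p^-1) `^ p by rewrite -powRrM mulVf ?gt_eqF// powRr1// ltW.
  rewrite gt0_ltr_powR ?nnegrE ?powR_ge0//.
  near: y.
  exists (e `^ p^-1) => /=; first exact: powR_gt0.
  by move=> t /=; rewrite sub0r normrN.
apply: (continuous_comp (g := @powR R ^~ p)); first exact: norm_continuous.
apply: differentiable_continuous; apply/derivable1_diffP.
have nz : 0 < `|x| by rewrite normr_gt0.
by case: (is_derive1_powR p nz).
Unshelve. all: by end_near. Qed.

Lemma measurable_int_leb_itv (x0 x1 : R) (u : R * R -> R) : measurable_fun setT u ->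
  measurable_fun setT (fun x => \int[leb_itv x0 x1]_y u (x, y)).
Proof.
move=> mu; have mU : measurable_fun setT (EFin \o u) by exact/measurable_EFinP.
rewrite /Rintegral; apply: (measurableT_comp (f := @fine R)) => //.
have -> : (fun x => \int[leb_itv x0 x1]_y (u (x, y))%:E)%E =
   (fun x => (\int[leb_itv x0 x1]_y (fun z => (EFin \o u)^\+ z) (x, y)) -
     (\int[leb_itv x0 x1]_y (fun z => (EFin \o u)^\- z) (x, y)))%E.
  apply/funext => x; rewrite integralE; congr (_ - _)%E.
    by apply: eq_integral => y _; rewrite !funeposE.
  by apply: eq_integral => y _; rewrite !funenegE.
apply: emeasurable_funB.
  exact: (measurable_fun_fubini_tonelli_F (m2 := leb_itv x0 x1) (EFin \o u)^\+%E
    (measurable_funepos mU) (fun z => funepos_ge0 _ z)).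
exact: (measurable_fun_fubini_tonelli_F (m2 := leb_itv x0 x1) (EFin \o u)^\-%E
  (measurable_funeneg mU) (fun z => funeneg_ge0 _ z)).
Qed.

End Duality.

(** * From the bilinear form to the operator with a real kernel *)

Section RealOperator.
Context {R : realType}.
Variables (n : nat) (a : nat -> R) (mu M A p q : R).
Variables (b : R * R -> R) (b1 : R -> R -> R) (lam c : R).
Hypotheses (mu0 : 0 < mu) (mu1 : mu < 1) (M0 : 0 <= M) (A0 : 0 < A).
Hypotheses (p1 : 1 < p) (q1 : 1 < q) (pq : p^-1 + q^-1 = 1).
Hypothesis ampb : amplitude mu M b b1.
Local Notation mA := (leb_itv (- A) A).

Definition osc_kernel (z : R * R) : R := cos (lam * phase n a z.1 z.2 + c) * b z.
Definition real_op (f : R -> R) (x : R) : R := \int[mA]_y (osc_kernel (x, y) * f y).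

Lemma measurable_osc_kernel : measurable_fun setT osc_kernel.
Proof.
by apply: measurable_funM; [exact: measurable_cos_phase|exact: amp_meas ampb].
Qed.

Lemma measurable_osc_kernel_fun (f : R -> R) : measurable_fun setT f ->
  measurable_fun setT (fun z : R * R => osc_kernel z * f z.2).
Proof.
move=> mf; apply: measurable_funM; first exact: measurable_osc_kernel.
exact: measurableT_comp.
Qed.

Lemma measurable_real_op f : measurable_fun setT f -> measurable_fun setT (real_op f).
Proof.
move=> mf; exact: (measurable_int_leb_itv _ _ (measurable_osc_kernel_fun mf)).
Qed.

(** Integrating in [x] first leaves a multiple of [|f y|], which is integrable
    because [|f| <= 1 + |f| ^ p] and the measure is finite. *)
Lemma amplitude_integrable (f : R -> R) : measurable_fun setT f ->
  (\int[mA]_y (`|f y| `^ p)%:E < +oo)%E ->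
  (mA \x mA)%E.-integrable setT (fun z : R * R => (b z * f z.2)%:E).
Proof.
move=> mf fp; apply/integrable21ltyP.
  apply/measurable_EFinP; apply: measurable_funM; first exact: amp_meas ampb.
  exact: measurableT_comp.
have mnf : measurable_fun setT (fun y => `|f y|) by exact: measurableT_comp.
pose C := M * ((1 + 2 / (1 - mu)) * (A + A) `^ (1 - mu)).
have C0 : 0 <= C.
  rewrite mulr_ge0// mulr_ge0 ?powR_ge0// addr_ge0// divr_ge0// subr_ge0.
  exact: ltW.
have step y : (\int[mA]_x `|(b (x, y) * f y)%:E| <= C%:E * (`|f y|)%:E)%E.
  have mby : measurable_fun setT (fun x => b (x, y)).
    by apply: measurableT_comp (amp_meas ampb) _; exact: pair2_measurable.
  have -> : (\int[mA]_x `|(b (x, y) * f y)%:E| =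
             \int[mA]_x ((`|f y|)%:E * (`|b (x, y)|)%:E))%E.
    by apply: eq_integral => x _; rewrite -EFinM/= normrM mulrC.
  rewrite ge0_integralZl_EFin//; last first.
    by apply/measurable_EFinP; exact: measurableT_comp.
  rewrite muleC; apply: lee_wpmul2r; first by rewrite lee_fin.
  have -> : mA = leb_itv (- A) (- A + (A + A)) by congr leb_itv; ring.
  apply: integral_singular_le => //.
  - by rewrite mu0 mu1.
  - exact: addr_gt0.
  - by move=> x; exact: amp_bound ampb _ _.
have mfp : measurable_fun setT (fun y => `|f y| `^ p).
  exact: measurableT_comp (@measurable_powR R p) mnf.
apply: (@le_lt_trans _ _ (\int[mA]_y (C%:E * (1%:E + (`|f y| `^ p)%:E)))%E).
  apply: ge0_le_integral => //.
  - by move=> y _; apply: integral_ge0.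
  - apply: (measurable_fun_fubini_tonelli_G (m1 := mA) (fun z : R * R => `|(b z * f z.2)%:E|%E)) => //.
    apply: measurableT_comp => //; apply/measurable_EFinP.
    apply: measurable_funM; first exact: amp_meas ampb.
    exact: measurableT_comp.
  - apply: emeasurable_funM => //; apply: emeasurable_funD => //.
    exact/measurable_EFinP.
  move=> y _; apply: (le_trans (step y)); apply: lee_wpmul2l; first by rewrite lee_fin.
  by rewrite -EFinD lee_fin ler_1powR// ltW.
rewrite ge0_integralZl_EFin//; last 2 first.
- by move=> y _; rewrite -EFinD lee_fin addr_ge0// powR_ge0.
- by apply: emeasurable_funD => //; exact/measurable_EFinP.
rewrite ge0_integralD//; last exact/measurable_EFinP.
rewrite integral_cst// mul1e.
apply: lte_mul_pinfty => //; rewrite lte_add_pinfty//.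
by apply: fin_num_fun_lty; exact: fin_num_measure.
Qed.

Lemma cos_amplitude_integrable (f : R -> R) x : measurable_fun setT f ->
  mA.-integrable setT (fun y => (b (x, y) * f y)%:E) ->
  mA.-integrable setT (fun y => (osc_kernel (x, y) * f y)%:E).
Proof.
move=> mf; apply: le_integrable => //.
  apply/measurable_EFinP.
  apply: (measurableT_comp (measurable_osc_kernel_fun mf)).
  exact: pair1_measurable.
move=> y _; rewrite lee_fin /osc_kernel -mulrA normrM.
by rewrite ler_piMl// cos_max.
Qed.

Variables (N eps0 : R).
Hypotheses (N0 : 0 < N) (eps00 : 0 < eps0).
Hypothesis form_bound : forall eps, 0 < eps -> eps <= eps0 ->
  forall f g : R -> R, bounded_meas f -> bounded_meas g ->
  `|bform mA mA (cut_kernel n a b lam c eps) f g| <=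
  N * (\int[mA]_y (`|f y| `^ p) + \int[mA]_x (`|g x| `^ q)).

(** The kernel is cut off at distance [eps0 / (j + 1)] from the diagonal and [f] is
    truncated at height [j].  The bound for the form, which is uniform in the
    cut-off, passes through duality to each approximation; dominated convergence
    in [y] and Fatou's lemma in [x] carry it to the limit. *)
Lemma real_op_bound (f : R -> R) : measurable_fun setT f ->
  (\int[mA]_y (`|f y| `^ p)%:E < +oo)%E ->
  (\int[mA]_x (`|real_op f x| `^ p)%:E <=
    ((2 * N) `^ p)%:E * \int[mA]_y (`|f y| `^ p)%:E)%E.
Proof.
move=> mf fp.
have p0 : 0 < p by exact: lt_trans p1.
have mnf : measurable_fun setT (fun y => `|f y|) by exact: measurableT_comp.
have mfp : measurable_fun setT (fun y => `|f y| `^ p).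
  exact: measurableT_comp (@measurable_powR R p) mnf.
pose S (j : nat) := [set y | `|f y| <= j%:R].
have mS j : measurable (S j : set (measurableTypeR R)).
  rewrite -[X in measurable X]setTI (_ : S j = (fun y => `|f y|) @^-1` `]-oo, j%:R]).
    by apply: mnf => //; exact: measurable_itv.
  by apply/seteqP; split => y /=; rewrite in_itv.
pose fj j y := f y * \1_(S j) y.
have mind j : measurable_fun setT (\1_(S j) : measurableTypeR R -> R).
  by apply: measurable_indic; exact: mS.
have bfj j : bounded_meas (fj j).
  split; first by apply: measurable_funM => //; exact: mind.
  exists j%:R => y; rewrite /fj indicE; have [yS|_] := boolP (y \in S j).
    by rewrite mulr1; move: yS; rewrite inE.
  by rewrite mulr0 normr0.
pose ej (j : nat) := eps0 / j.+1%:R.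
have ej0 j : 0 < ej j by rewrite divr_gt0.
have ej1 j : ej j <= eps0 by rewrite ler_pdivrMr// ler_peMr ?(ltW eps00)// ler1n.
pose kj j := cut_kernel n a b lam c (ej j).
have bkj j : bounded_meas (kj j) by exact: cut_kernel_bounded ampb M0 mu0 (ej0 j).
have bkf j : bounded_meas (fun z : R * R => kj j z * fj j z.2).
  by apply: bounded_measM => //; exact: (bounded_meas_snd _ (bfj j)).
pose hj j x := \int[mA]_y (kj j (x, y) * fj j y).
have bhj j : bounded_meas (hj j) by exact: (bounded_meas_int mA (bkf j)).
have bhp j : bounded_meas (fun x => `|hj j x| `^ p).
  by apply: bounded_meas_powR => //; exact: ltW.
have bfp j : bounded_meas (fun x => `|fj j x| `^ p).
  by apply: bounded_meas_powR => //; exact: ltW.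
have step1 j : (\int[mA]_x (`|hj j x| `^ p)%:E <=
    ((2 * N) `^ p)%:E * \int[mA]_y (`|f y| `^ p)%:E)%E.
  rewrite -EFin_Rintegralb; last exact: bhp.
  apply: (@le_trans _ _ ((2 * N) `^ p * \int[mA]_y (`|fj j y| `^ p))%:E).
    rewrite lee_fin; apply: (@dual_norm_bound _ _ _ mA (hj j) N _ p q (bhj j) N0 p1 q1 pq) => g bg.
    have -> : \int[mA]_x (hj j x * g x) = bform mA mA (kj j) (fj j) g.
      apply: eq_Rintegral => x _; rewrite mulrC -RintegralZb.
        by apply: eq_Rintegral => y _; rewrite mulrC.
      exact: (bounded_meas_slice1 x (bkf j)).
    exact: form_bound.
  rewrite EFinM EFin_Rintegralb; last exact: bfp.
  apply: lee_wpmul2l; first by rewrite lee_fin powR_ge0.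
  apply: ge0_le_integral => //.
  - by apply/measurable_EFinP; case: (bfp j).
  - exact/measurable_EFinP.
  move=> y _; rewrite lee_fin ge0_ler_powR ?nnegrE ?(ltW p0)//.
  rewrite /fj normrM ler_piMr// indicE.
  by case: (_ \in _); rewrite ?normr1 ?normr0.
have [Z [mZ Z0 subZ]] := ae_integrable1 (amplitude_integrable mf fp).
have good x : ~ Z x -> mA.-integrable setT (fun y => (b (x, y) * f y)%:E).
  by move=> Zx; apply: contrapT => H; apply: Zx; apply: subZ.
have cvgh x : ~ Z x -> hj ^~ x @ \oo --> real_op f x.
  move=> Zx; have ib := good x Zx.
  have iT := cos_amplitude_integrable mf ib.
  have dom : mA.-integrable setT (fun y => (`|b (x, y) * f y|)%:E) by exact: integrable_norm ib.
  have kle j y : `|kj j (x, y) * fj j y| <= `|b (x, y) * f y|.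
    rewrite /kj /cut_kernel /fj !normrM.
    have i1 : `|\1_(S j) y : R| <= 1 by rewrite indicE; case: (_ \in _); rewrite ?normr1 ?normr0.
    have i2 : `|\1_[set w : R * R | ej j <= `|w.1 - w.2|] (x, y) : R| <= 1.
      by rewrite indicE; case: (_ \in _); rewrite ?normr1 ?normr0.
    have i3 := cos_max (lam * phase n a (x, y).1 (x, y).2 + c).
    apply: (@le_trans _ _ ((1 * `|b (x, y)| * 1) * (`|f y| * 1))); last first.
      by rewrite mul1r !mulr1.
    apply: ler_pM; rewrite ?mulr_ge0//; last by rewrite ler_wpM2l.
    by apply: ler_pM; rewrite ?mulr_ge0//; apply: ler_pM.
  pose F j y := (kj j (x, y) * fj j y)%:E.
  pose F0 y := (osc_kernel (x, y) * f y)%:E.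
  have mF j : measurable_fun setT (F j).
    by apply/measurable_EFinP; have [] := bounded_meas_slice1 x (bkf j).
  have mF0 : measurable_fun setT F0 by case/integrableP: iT.
  have FF0 : {ae mA, forall y, setT y -> F ^~ y @ \oo --> F0 y}.
    apply: aeW => y _; apply: cvg_near_cst.
    have [xy|xy] := eqVneq x y.
      apply: nearW => j; congr (_%:E).
      have b0 : b (x, y) = 0.
        apply/eqP; rewrite -normr_le0; apply: (le_trans (amp_bound ampb x y)).
        by rewrite xy subrr normr0 powR0 ?mulr0// oppr_eq0 gt_eqF.
      by rewrite /kj /cut_kernel /osc_kernel b0 !(mulr0, mul0r).
    have xy0 : 0 < `|x - y| by rewrite normr_gt0 subr_eq0.
    near=> j; congr (_%:E).
    rewrite /kj /cut_kernel /osc_kernel /fj !indicE !mem_set ?mulr1//=.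
      near: j; exists (Num.truncn (`|f y|)).+1 => //= j /=.
      by rewrite -(ler_nat R); apply: le_trans; exact: ltW (truncnS_gt _).
    near: j; exists (Num.truncn (eps0 / `|x - y|)).+1 => //= j /=.
    rewrite -(ler_nat R) => hj'; rewrite /ej ler_pdivrMr// mulrC -ler_pdivrMr//.
    apply: le_trans (ltW (truncnS_gt _)) _; apply: (le_trans hj').
    by rewrite ler_nat.
  have Fle : {ae mA, forall y j, setT y -> (`|F j y| <= (`|b (x, y) * f y|)%:E)%E}.
    by apply: aeW => y j _; rewrite lee_fin kle.
  have [_ _ H] := @dominated_convergence _ (measurableTypeR R) R mA setT measurableT
    F F0 (fun y => (`|b (x, y) * f y|)%:E) mF mF0 FF0 dom Fle.
  by apply: fine_cvg; rewrite fineK; [exact: H|exact: integrable_fin_num iT].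
have mT : measurable_fun setT (fun x => `|real_op f x| `^ p).
  apply: measurableT_comp (@measurable_powR R p) _; apply: measurableT_comp => //.
  exact: measurable_real_op.
rewrite (ge0_negligible_integral _ _ _ _ Z0)//; last exact/measurable_EFinP.
have -> : (\int[mA]_(x in setT `\` Z) (`|real_op f x| `^ p)%:E =
    \int[mA]_(x in setT `\` Z) limn_einf (fun j => (`|hj j x| `^ p)%:E))%E.
  apply: eq_integral => x; rewrite inE => -[_ Zx].
  have cv : (fun j => (`|hj j x| `^ p)%:E) @ \oo --> (`|real_op f x| `^ p)%:E.
    apply: cvg_EFin; first by apply: nearW.
    exact: (continuous_cvg _ (continuous_abs_powR p0 (x := real_op f x)) (cvgh x Zx)).
  rewrite is_cvg_limn_einfE; last by apply/cvg_ex; eexists; exact: cv.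
  by apply/esym/cvg_lim.
have mD : measurable ([set: measurableTypeR R] `\` Z) by exact: measurableD.
apply: le_trans (fatou mA mD _ _) _.
- by move=> j; apply: measurable_funTS; apply/measurable_EFinP; case: (bhp j).
- by move=> j x _; rewrite lee_fin powR_ge0.
apply: limn_einf_le => j; apply: le_trans (step1 j).
apply: ge0_subset_integral => //.
by apply/measurable_EFinP; case: (bhp j).
Unshelve. all: by end_near. Qed.

End RealOperator.

(** * Amplitudes from the real and imaginary parts of the kernel *)

Section PlaneMeasurability.
Context {R : realType}.

(** The measurable sets of the plane are generated by rectangles, so an open set is
    exhibited as a countable union of boxes with rational centres. *)
Lemma open_measurable_plane (O : set (R * R)) : open O -> measurable O.
Proof.
move=> oO.
pose box (q1 q2 : rat) (j : nat) : set (R * R) :=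
  `]ratr q1 - j.+1%:R^-1, ratr q1 + j.+1%:R^-1[%classic `*`
  `]ratr q2 - j.+1%:R^-1, ratr q2 + j.+1%:R^-1[%classic.
have mbox q1 q2 j : measurable (box q1 q2 j).
  by apply: measurableX; exact: measurable_itv.
pose F q1 q2 j : set (R * R) := if pselect (box q1 q2 j `<=` O) then box q1 q2 j else set0.
have -> : O = \bigcup_(q1 : rat) \bigcup_(q2 : rat) \bigcup_j F q1 q2 j.
  apply/seteqP; split => [z Oz|z [q1 _ [q2 _ [j _]]]]; last first.
    by rewrite /F; case: pselect => [H /H|_ []].
  move: oO; rewrite openE => /(_ _ Oz) /nbhs_ballP[e /= e0 be].
  pose j := Num.truncn (2 / e).
  have j0 : 0 < j.+1%:R^-1 :> R by rewrite invr_gt0.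
  have je : 2 * j.+1%:R^-1 < e.
    rewrite -ltr_pdivlMl// invf_plt ?posrE ?mulr_gt0 ?invr_gt0//.
    by rewrite invfM invrK; exact: truncnS_gt.
  have rat_near (t : R) : t - j.+1%:R^-1 < t + j.+1%:R^-1.
    by rewrite ltrBlDr -addrA ltrDl addr_gt0.
  have [q1] := rat_in_itvoo (rat_near z.1); have [q2] := rat_in_itvoo (rat_near z.2).
  rewrite !in_itv/= => /andP[a3 a4] /andP[a1 a2].
  set d := j.+1%:R^-1 in j0 je a1 a2 a3 a4 *.
  exists q1 => //; exists q2 => //; exists j => //; rewrite /F.
  case: pselect => [sub|nsub] /=.
    by rewrite /box -/d; split => /=; rewrite in_itv/=; apply/andP; split; lra.
  exfalso; apply: nsub => w; rewrite /box -/d => -[] /=.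
  rewrite !in_itv/= => /andP[w1 w2] /andP[w3 w4].
  by apply: be; split => /=; rewrite /ball/= ltr_norml; apply/andP; split; lra.
apply: bigcupT_measurable_rat => q1; apply: bigcupT_measurable_rat => q2.
apply: bigcupT_measurable => j; rewrite /F; case: pselect => [s|ns] /=.
  exact: mbox.
exact: measurable0.
Qed.

Lemma open_off_diagonal : open (@off_diagonal R).
Proof.
rewrite openE => z /= zd; have zd0 : 0 < `|z.1 - z.2| by rewrite normr_gt0 subr_eq0.
apply/nbhs_ballP; exists (`|z.1 - z.2| / 2) => /=; first by rewrite divr_gt0.
move=> w [/=]; rewrite /ball/= => w1 w2; apply/eqP => ww.
have : `|z.1 - z.2| <= `|z.1 - w.1| + `|z.2 - w.2|.
  have -> : z.1 - z.2 = (z.1 - w.1) - (z.2 - w.2) by rewrite ww; ring.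
  exact: ler_normB.
by lra.
Qed.

Lemma measurable_off_diagonal_continuous (h : R * R -> R) :
  (forall z, off_diagonal z -> {for z, continuous h}) ->
  measurable_fun setT (fun z => if z.1 == z.2 then 0 else h z).
Proof.
move=> ch; apply: (measurability _ (RGenOInfty.measurableE R)).
move=> /= _ [_ [r ->] <-]; rewrite setTI preimage_itvoy.
have oP : open [set z | off_diagonal z /\ r < h z].
  rewrite openE => z [zd rz]; apply: filterI.
    by move: open_off_diagonal; rewrite openE; apply.
  exact: (cvgr_gt (h z) (ch z zd) r rz).
have mD : measurable (@off_diagonal R) by exact: open_measurable_plane open_off_diagonal.
have -> : [set z : R * R | r < (if z.1 == z.2 then 0 else h z)] =
   [set z | off_diagonal z /\ r < h z] `|` (~` (@off_diagonal R) `&` [set z | r < 0]).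
  apply/seteqP; split => z /=.
    have [zz|zz] := eqVneq z.1 z.2.
      by move=> r0; right; split => //; rewrite /off_diagonal/= zz eqxx.
    by move=> rh; left.
  move=> [[/negPf zz rh]|[/negP]]; first by rewrite zz.
  by rewrite negbK => -> .
apply: measurableU; first exact: open_measurable_plane.
apply: measurableI; first exact: measurableC.
have [r0|r0] := pselect (r < 0).
  by rewrite (_ : [set _ | _] = setT)//; apply/seteqP; split.
by rewrite (_ : [set _ | _] = set0)//; apply/seteqP; split.
Qed.

End PlaneMeasurability.

Section Amplitudes.
Context {R : realType}.

Lemma is_derive_diry (g : R * R -> R) (x y : R) : derivable g (x, y) diry ->
  is_derive y 1 (fun t => g (x, t)) ('D_diry g (x, y)).
Proof.
move=> dg.
have E : (fun h : R => h^-1 *: ((g \o shift (x, y)) (h *: diry) - g (x, y))) =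
         (fun h : R => h^-1 *: (((fun t => g (x, t)) \o shift y) (h *: (1 : R)) - g (x, y))).
  apply/funext => h /=; congr (_ *: (g _ - _)).
  rewrite /diry /GRing.scale/= /GRing.add/=; congr (_, _).
  by rewrite -[LHS]/(h * 0 + x) mulr0 add0r.
split; first by rewrite /derivable -E.
by rewrite /derive -E.
Qed.

(** What is retained of the real and imaginary parts of [psi].  The last clause
    replaces the condition on the support: it holds when the support lies in the
    square of half-side [A]. *)
Record cutoff (A B : R) (u : R * R -> R) : Prop := Cutoff {
  cut_cont : continuous u ;
  cut_derivable : forall q, derivable u q diry ;
  cut_derive_cont : continuous ('D_diry u) ;
  cut_bound : forall q, `|u q| <= B ;
  cut_derive_bound : forall q, `|'D_diry u q| <= B ;
  cut_derive_supp : forall x y, 2 * A < `|x - y| -> 'D_diry u (x, y) = 0 }.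

Lemma cutoffN A B u : cutoff A B u -> cutoff A B (fun z => - u z).
Proof.
move=> [c1 c2 c3 c4 c5 c6].
have E : 'D_diry (fun z => - u z) = (fun z => - 'D_diry u z).
  by apply/funext => q; exact: (deriveN (c2 q)).
split.
- by move=> z; apply: continuousN; exact: c1.
- by move=> q; exact: (derivableN (c2 q)).
- pose g := 'D_diry (fun z => - u z); rewrite -/g (_ : g = (fun z => - 'D_diry u z))//.
  by move=> z; exact: (cvgN (c3 z)).
- by move=> q; rewrite normrN.
- by move=> q; rewrite (congr1 (@^~ q) E) normrN.
- by move=> x y xy; rewrite (congr1 (@^~ (x, y)) E) c6// oppr0.
Qed.

Record singular_part (mu E : R) (k : R * R -> R) : Prop := SingularPart {
  sing_cont : forall q, off_diagonal q -> {for q, continuous k} ;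
  sing_derivable : forall q, off_diagonal q -> derivable k q diry ;
  sing_derive_cont : forall q, off_diagonal q -> {for q, continuous ('D_diry k)} ;
  sing_bound : forall x y, x != y -> `|k (x, y)| <= E * `|x - y| `^ (- mu) ;
  sing_derive_bound : forall x y, x != y ->
    `|'D_diry k (x, y)| <= E * `|x - y| `^ (- mu - 1) }.

(** The real part of [K psi] when [k1], [k2], [u], [v] are the real and imaginary
    parts of [K] and of [psi], and the imaginary part of [K psi] when [u], [v] are
    replaced by [v], [- u].  It is set to zero on the diagonal, where [K] is
    arbitrary. *)
Definition pair_amp (k1 k2 u v : R * R -> R) (z : R * R) : R :=
  if z.1 == z.2 then 0 else k1 z * u z - k2 z * v z.

Definition pair_amp_y (k1 k2 u v : R * R -> R) (x y : R) : R :=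
  (k1 (x, y) * 'D_diry u (x, y) + u (x, y) * 'D_diry k1 (x, y)) -
  (k2 (x, y) * 'D_diry v (x, y) + v (x, y) * 'D_diry k2 (x, y)).

(** A [y]-derivative falling on the cut-off costs only a constant, which is
    absorbed in [|x - y| ^ - 1] because the cut-off has bounded support. *)
Lemma amplitude_pair mu E A B k1 k2 u v : 0 < mu -> 0 <= E -> 0 <= A -> 0 <= B ->
  singular_part mu E k1 -> singular_part mu E k2 ->
  cutoff A B u -> cutoff A B v ->
  amplitude mu (2 * E * B * (1 + 2 * A)) (pair_amp k1 k2 u v) (pair_amp_y k1 k2 u v).
Proof.
move=> mu0 E0 A0 B0 s1 s2 cu cv.
have cpair (g : R * R -> R) x y : {for (x, y), continuous g} -> {for y, continuous (fun t => g (x, t))}.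
  move=> cg; apply: (continuous_comp (f := fun t => (x, t))) cg.
  apply: (@cvg_pair _ _ _ (nbhs y) (nbhs x) (nbhs y) _ _ _ (cst x) id); last exact: cvg_id.
  exact: cvg_cst.
have EB0 : 0 <= E * B by exact: mulr_ge0.
have bound_term k w x y : singular_part mu E k -> cutoff A B w -> x != y ->
    `|k (x, y) * w (x, y)| <= E * B * `|x - y| `^ (- mu).
  move=> sk cw xy; rewrite normrM mulrAC; apply: ler_pM => //.
    exact: sing_bound sk _ _ xy.
  exact: cut_bound cw _.
have bound_term1 k w x y : singular_part mu E k -> cutoff A B w -> x != y ->
    `|k (x, y) * 'D_diry w (x, y) + w (x, y) * 'D_diry k (x, y)| <=
    E * B * (1 + 2 * A) * `|x - y| `^ (- mu - 1).
  move=> sk cw xy; have xy0 : 0 < `|x - y| by rewrite normr_gt0 subr_eq0.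
  apply: (le_trans (ler_normD _ _)).
  have P0 : 0 <= `|x - y| `^ (- mu - 1) by exact: powR_ge0.
  have t2 : `|w (x, y) * 'D_diry k (x, y)| <= E * B * `|x - y| `^ (- mu - 1).
    rewrite normrM mulrC mulrAC; apply: ler_pM => //.
      exact: sing_derive_bound sk _ _ xy.
    exact: cut_bound cw _.
  have t1 : `|k (x, y) * 'D_diry w (x, y)| <= E * B * (2 * A) * `|x - y| `^ (- mu - 1).
    have [h|h] := ltP (2 * A) `|x - y|.
      by rewrite (cut_derive_supp cw h) mulr0 normr0 !mulr_ge0.
    rewrite normrM; apply: (@le_trans _ _ ((E * `|x - y| `^ (- mu)) * B)).
      apply: ler_pM => //; first exact: sing_bound sk _ _ xy.
      exact: cut_derive_bound cw _.
    have -> : `|x - y| `^ (- mu) = `|x - y| * `|x - y| `^ (- mu - 1).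
      rewrite -{2}[`|x - y|]powRr1 ?(ltW xy0)// -powRD ?(gt_eqF xy0) ?implybT//.
      by congr (_ `^ _); ring.
    have -> : E * B * (2 * A) * `|x - y| `^ (- mu - 1) = E * B * ((2 * A) * `|x - y| `^ (- mu - 1)) by ring.
    have -> : E * (`|x - y| * `|x - y| `^ (- mu - 1)) * B = E * B * (`|x - y| * `|x - y| `^ (- mu - 1)) by ring.
    by rewrite ler_wpM2l// ler_wpM2r.
  by rewrite mulrDr mulr1 mulrDl addrC lerD.
split.
- apply: measurable_off_diagonal_continuous => z zd.
  apply: continuousB; apply: continuousM.
  + exact: sing_cont s1 _ zd.
  + exact: cut_cont cu _.
  + exact: sing_cont s2 _ zd.
  + exact: cut_cont cv _.
- move=> x y; rewrite /pair_amp/=; have [->|xy] := eqVneq x y.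
    by rewrite normr0 !mulr_ge0 ?powR_ge0// addr_ge0// mulr_ge0.
  apply: (le_trans (ler_normB _ _)).
  apply: (le_trans (lerD (bound_term _ _ _ _ s1 cu xy) (bound_term _ _ _ _ s2 cv xy))).
  have P0 : 0 <= `|x - y| `^ (- mu) by exact: powR_ge0.
  rewrite -mulrDl ler_wpM2r// -[leLHS]mulr1.
  have -> : E * B + E * B = 2 * E * B by ring.
  by rewrite ler_wpM2l ?mulr_ge0// lerDl mulr_ge0.
- move=> x y xy; rewrite /pair_amp_y.
  have od : off_diagonal (x, y) by [].
  have du : derivable u (x, y) diry by have [_ h _ _ _ _] := cu; exact: h.
  have dv : derivable v (x, y) diry by have [_ h _ _ _ _] := cv; exact: h.
  have dk1 : derivable k1 (x, y) diry by have [_ h _ _ _] := s1; exact: h.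
  have dk2 : derivable k2 (x, y) diry by have [_ h _ _ _] := s2; exact: h.
  have D1 := is_deriveM (is_derive_diry dk1) (is_derive_diry du).
  have D2 := is_deriveM (is_derive_diry dk2) (is_derive_diry dv).
  have D3 := is_deriveB D1 D2.
  apply: (near_eq_is_derive _ D3).
  have tx : \forall t \near y, t - x != 0.
    apply: (@cvgr_neq0 R R R (nbhs y) _ (fun t => t - x) (y - x)).
      by apply: cvgB; [exact: cvg_id|exact: cvg_cst].
    by rewrite subr_eq0 eq_sym.
  by apply: filterS tx => t; rewrite subr_eq0 /pair_amp/= eq_sym => /negPf ->.
- move=> x y xy; apply: (le_trans (ler_normB _ _)).
  apply: (le_trans (lerD (bound_term1 _ _ _ _ s1 cu xy) (bound_term1 _ _ _ _ s2 cv xy))).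
  by rewrite le_eqVlt; apply/orP; left; apply/eqP; ring.
- move=> x y xy; have od : off_diagonal (x, y) by [].
  apply: continuousB; apply: continuousD; apply: continuousM.
  + exact: cpair (sing_cont s1 od).
  + exact: cpair (cut_derive_cont cu (x := (x, y))).
  + exact: cpair (cut_cont cu (x := (x, y))).
  + exact: cpair (sing_derive_cont s1 od).
  + exact: cpair (sing_cont s2 od).
  + exact: cpair (cut_derive_cont cv (x := (x, y))).
  + exact: cpair (cut_cont cv (x := (x, y))).
  + exact: cpair (sing_derive_cont s2 od).
Qed.

End Amplitudes.

Section Reduction.
Context {R : realType}.

Lemma compact_bound (V : normedModType R) (D : set V) (u : V -> R) :
  compact D -> continuous u -> exists2 B, 0 <= B & forall q, D q -> `|u q| <= B.
Proof.
move=> cD cu.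
have /compact_bounded[B [_ HB]] : compact (u @` D).
  apply: continuous_compact => //; exact: continuous_subspaceT.
exists (`|B| + 1); first by rewrite addr_ge0.
move=> q Dq; apply: (HB (`|B| + 1)); last by exists q.
by rewrite (le_lt_trans (ler_norm B))// ltrDl.
Qed.

Lemma derive_off_closed (D : set (R * R)) (u : R * R -> R) q :
  closed D -> (forall z, ~ D z -> u z = 0) -> ~ D q -> 'D_diry u q = 0.
Proof.
move=> clD u0 Dq.
have nq : \forall z \near q, (cst 0 : R * R -> R) z = u z.
  have : open (~` D) by exact: closed_openC.
  rewrite openE => /(_ q Dq); apply: filterS => z zD.
  by rewrite u0.
have dq : is_derive q diry u 0.
  by apply: (near_eq_is_derive nq); exact: is_derive_cst.
exact: derive_val.
Qed.

Lemma cutoff_exists (D : set (R * R)) (A : R) (u : R * R -> R) :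
  compact D -> closed D -> (forall z, D z -> `|z.1| <= A /\ `|z.2| <= A) ->
  (forall z, ~ D z -> u z = 0) -> realCk 1 setT u ->
  exists2 B, 0 <= B & forall B', B <= B' -> cutoff A B' u.
Proof.
move=> cD clD DA u0 [cu [du [_ [cdu _]]]].
have cu' : continuous u by move=> q; apply: cu; rewrite inE.
have cdu' : continuous ('D_diry u) by move=> q; apply: cdu; rewrite inE.
have [B1 B10 uB] := compact_bound cD cu'.
have [B2 B20 duB] := compact_bound cD cdu'.
have Dd q : ~ D q -> 'D_diry u q = 0 by exact: derive_off_closed.
exists (Num.max B1 B2); first by rewrite le_max B10.
move=> B; rewrite ge_max => /andP[B1B B2B]; split => //.
- by move=> q; have [] := du q (mem_set I).
- move=> q; have [Dq|/u0->] := pselect (D q); first exact: le_trans (uB q Dq) B1B.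
  by rewrite normr0 (le_trans B10).
- move=> q; have [Dq|/Dd->] := pselect (D q); first exact: le_trans (duB q Dq) B2B.
  by rewrite normr0 (le_trans B20).
move=> x y xy; apply: Dd => /DA[/= xA yA].
have := ler_normB x y; lra.
Qed.

Lemma smooth_cutoffs (psi : R * R -> R[i]) : smooth_compact_support psi ->
  exists A B, [/\ 1 <= 2 * A, 0 <= B,
    cutoff A B (fun z => complex.Re (psi z)), cutoff A B (fun z => complex.Im (psi z)) &
    forall x y, psi (x, y) != 0 -> (- A <= x < A) /\ (- A <= y < A)].
Proof.
move=> [sm cD]; set D := closure _ in cD.
have clD : closed D by exact: closed_closure.
have psiD z : psi z != 0 -> D z by move=> h; apply: subset_closure.
have psi0 z : ~ D z -> psi z = 0.
  by move=> Dz; apply/eqP; apply: contrapT => /negP/psiD.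
have c1 : continuous (@fst R R) by move=> z; exact: cvg_fst.
have c2 : continuous (@snd R R) by move=> z; exact: cvg_snd.
have [A1 A10 h1] := compact_bound cD c1.
have [A2 A20 h2] := compact_bound cD c2.
pose A := A1 + A2 + 1.
have DA z : D z -> `|z.1| < A /\ `|z.2| < A.
  by move=> Dz; split; [have := h1 z Dz|have := h2 z Dz]; rewrite /A; lra.
have DA' z : D z -> `|z.1| <= A /\ `|z.2| <= A by move=> /DA[/ltW ? /ltW ?].
have [sr si] := sm 1%N.
have [B1 B10 cut1] := cutoff_exists cD clD DA' (fun z h => congr1 (@complex.Re R) (psi0 z h)) sr.
have [B2 B20 cut2] := cutoff_exists cD clD DA' (fun z h => congr1 (@complex.Im R) (psi0 z h)) si.
exists A, (Num.max B1 B2); split.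
- by rewrite /A; lra.
- by rewrite le_max B10.
- by apply: cut1; rewrite le_max lexx.
- by apply: cut2; rewrite le_max lexx orbT.
move=> x y /psiD/DA[/=]; rewrite !ltr_norml => /andP[x1 x2] /andP[y1 y2].
by rewrite x2 y2 !ltW.
Qed.

Lemma singular_parts mu E (K : R * R -> R[i]) : singular_kernel mu E K ->
  singular_part mu E (fun z => complex.Re (K z)) /\
  singular_part mu E (fun z => complex.Im (K z)).
Proof.
move=> [[[cr [dr [_ [cdr _]]]] [ci [di [_ [cdi _]]]]] bK]; split; split.
- by move=> q qd; apply: cr; rewrite inE.
- by move=> q qd; have [] := dr q (mem_set qd).
- by move=> q qd; apply: cdr; rewrite inE.
- by move=> x y /bK[h _ _]; exact: le_trans (normc_Re _) h.
- by move=> x y /bK[_ h _]; exact: le_trans (normc_Re (cderive diry K (x, y))) h.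
- by move=> q qd; apply: ci; rewrite inE.
- by move=> q qd; have [] := di q (mem_set qd).
- by move=> q qd; apply: cdi; rewrite inE.
- by move=> x y /bK[h _ _]; exact: le_trans (normc_Im _) h.
- by move=> x y /bK[_ h _]; exact: le_trans (normc_Im (cderive diry K (x, y))) h.
Qed.

End Reduction.

(** * The complex operator *)

Section Supports.
Context {R : realType}.
Local Notation leb := (@lebesgue_measure R).

Lemma ge0_integral_supported (x0 x1 : R) (h : R -> \bar R) :
  measurable_fun setT h -> (forall y, 0 <= h y)%E ->
  (forall y, ~~ (x0 <= y < x1) -> h y = 0%E) ->
  (\int[leb]_y h y = \int[leb_itv x0 x1]_y h y)%E.
Proof.
move=> mh h0 hs; rewrite ge0_integral_leb_itv// [RHS]integral_mkcond.
apply: eq_integral => y _; rewrite patchE.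
case: ifPn => // yI; apply: hs; apply: contra yI => yI.
by rewrite inE/= in_itv.
Qed.

Lemma Rintegral_supported (x0 x1 : R) (h : R -> R) : measurable_fun setT h ->
  (forall y, ~~ (x0 <= y < x1) -> h y = 0) ->
  \int[leb]_y h y = \int[leb_itv x0 x1]_y h y.
Proof.
move=> mh hs; have mh' : measurable_fun setT (EFin \o h) by exact/measurable_EFinP.
rewrite /Rintegral; congr fine; rewrite integralE [RHS]integralE.
congr (_ - _)%E; apply: ge0_integral_supported.
- exact: measurable_funepos.
- by move=> y; exact: funepos_ge0.
- by move=> y /hs hy; rewrite funeposE /= hy maxxx.
- exact: measurable_funeneg.
- by move=> y; exact: funeneg_ge0.
- by move=> y /hs hy; rewrite funenegE /= hy oppr0 maxxx.
Qed.

(** For a fixed [x], the value of the kernel at the single point [y = x] does not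
    affect the integral. *)
Lemma Rintegral_eq_off_point (h g : R -> R) x : measurable_fun setT g ->
  (forall y, x != y -> h y = g y) -> \int[leb]_y h y = \int[leb]_y g y.
Proof.
move=> mg hg.
have m1 : measurable_fun setT (\1_[set x] : measurableTypeR R -> R).
  by apply: measurable_indic; exact: measurable_set1.
have mh : measurable_fun setT h.
  rewrite (_ : h = fun y => g y + (h x - g x) * (\1_[set x] : measurableTypeR R -> R) y).
    by apply: measurable_funD => //; apply: measurable_funM.
  apply/funext => y; rewrite indicE; have [<-|xy] := eqVneq x y.
    by rewrite mem_set//= mulr1 addrC subrK.
  rewrite memNset/= ?mulr0 ?addr0 ?hg//.
  by move=> /esym /eqP; rewrite (negPf xy).
rewrite /Rintegral; congr fine; apply: ae_eq_integral => //.
- exact/measurable_EFinP.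
- exact/measurable_EFinP.
exists [set x]; split; first exact: measurable_set1.
  exact: lebesgue_measure_set1.
move=> y /= ny; apply: contrapT => yx; apply: ny => _.
by rewrite hg//; apply/eqP => xy; apply: yx.
Qed.

Lemma powR_sum_le (I : finType) (i0 : I) (u : I -> R) p : 0 <= p ->
  (forall i, 0 <= u i) ->
  (\sum_i u i) `^ p <= \sum_i (#|I|%:R * u i) `^ p.
Proof.
move=> p0 u0.
have [j _ hj] := arg_maxP u (isT : (fun=> true) i0).
apply: (@le_trans _ _ ((#|I|%:R * u j) `^ p)).
  rewrite ge0_ler_powR ?nnegrE ?mulr_ge0// ?sumr_ge0//.
  apply: (@le_trans _ _ (\sum_(i : I) u j)).
    by apply: ler_sum => i _; exact: hj.
  by rewrite sumr_const mulr_natl.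
by rewrite (bigD1 j)//= lerDl sumr_ge0// => i _; exact: powR_ge0.
Qed.

End Supports.

Section OscillatoryOperator.
Context {R : realType}.
Local Open Scope complex_scope.
Variables (n : nat) (a : nat -> R) (mu M A p q lam : R).
Variables (K psi : R * R -> R[i]) (br bi : R * R -> R) (br1 bi1 : R -> R -> R).
Hypotheses (mu0 : 0 < mu) (mu1 : mu < 1) (M0 : 0 <= M) (A0 : 0 < A).
Hypotheses (p1 : 1 < p) (q1 : 1 < q) (pq : p^-1 + q^-1 = 1).
Hypotheses (ampr : amplitude mu M br br1) (ampi : amplitude mu M bi bi1).
Hypothesis Kpsi : forall x y, x != y -> K (x, y) * psi (x, y) = br (x, y) +i* bi (x, y).
Hypothesis suppr : forall x y, ~~ ((- A <= x < A) && (- A <= y < A)) -> br (x, y) = 0.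
Hypothesis suppi : forall x y, ~~ ((- A <= x < A) && (- A <= y < A)) -> bi (x, y) = 0.
Variable f : R -> R[i].
Hypothesis fLp : in_Lp p f.

Local Notation mA := (leb_itv (- A) A).
Local Notation leb := (@lebesgue_measure R).
Local Notation normc := (@Normc.normc R).
Let fr y := complex.Re (f y).
Let fi y := complex.Im (f y).
Let T := osc_op (phase n a) K psi lam f.

(* [cos (t - pi / 2) = sin t], so that sines need no separate treatment. *)
Let kcos b := osc_kernel n a b lam 0.
Let ksin b := osc_kernel n a b lam (- (pi / 2)).

Let gr z := (kcos br z * fr z.2 - ksin bi z * fr z.2) - (kcos bi z * fi z.2 + ksin br z * fi z.2).
Let gi z := (kcos br z * fi z.2 - ksin bi z * fi z.2) + (kcos bi z * fr z.2 + ksin br z * fr z.2).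

Let mfr : measurable_fun setT fr. Proof. by case: fLp. Qed.
Let mfi : measurable_fun setT fi. Proof. by case: fLp. Qed.

Let mk b b1 c (h : R -> R) : amplitude mu M b b1 -> measurable_fun setT h ->
  measurable_fun setT (fun z : R * R => osc_kernel n a b lam c z * h z.2).
Proof. by move=> am mh; exact: (measurable_osc_kernel_fun _ _ _ _ am mh). Qed.

Let mgr : measurable_fun setT gr.
Proof.
by apply: measurable_funB; [apply: measurable_funB|apply: measurable_funD];
  apply: mk; eassumption.
Qed.

Let mgi : measurable_fun setT gi.
Proof.
by apply: measurable_funD; [apply: measurable_funB|apply: measurable_funD];
  apply: mk; eassumption.
Qed.

Lemma osc_integrandE x y : x != y ->
  cis (lam * phase n a x y) * K (x, y) * psi (x, y) * f y = gr (x, y) +i* gi (x, y).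
Proof.
move=> xy; rewrite -(mulrA _ (K _)) Kpsi// /gr /gi /kcos /ksin /osc_kernel /fr /fi /cis /=.
rewrite addr0 cosBpihalf; case: (f y) => u v.
by apply/eqP; rewrite eq_complex/=; apply/andP; split; apply/eqP; ring.
Qed.

Let g_supp x y : ~~ ((- A <= x < A) && (- A <= y < A)) -> gr (x, y) = 0 /\ gi (x, y) = 0.
Proof.
move=> s; rewrite /gr /gi /kcos /ksin /osc_kernel suppr// suppi//.
by split; rewrite !(mulr0, mul0r) !(addr0, subr0).
Qed.

Lemma osc_opE x : T x = (\int[mA]_y gr (x, y)) +i* (\int[mA]_y gi (x, y)).
Proof.
have sl (g : R * R -> R) : measurable_fun setT g -> measurable_fun setT (fun y => g (x, y)).
  by move=> mg; apply: (measurableT_comp mg); exact: pair1_measurable.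
rewrite /T /osc_op /cintegral; congr (_ +i* _).
  rewrite (@Rintegral_eq_off_point _ _ (fun y => gr (x, y)) x); first last.
  - by move=> y xy; rewrite osc_integrandE.
  - exact: sl.
  apply: Rintegral_supported; first exact: sl.
  by move=> y ny; case: (@g_supp x y) => //; rewrite negb_and ny orbT.
rewrite (@Rintegral_eq_off_point _ _ (fun y => gi (x, y)) x); first last.
- by move=> y xy; rewrite osc_integrandE.
- exact: sl.
apply: Rintegral_supported; first exact: sl.
by move=> y ny; case: (@g_supp x y) => //; rewrite negb_and ny orbT.
Qed.

Let normT_meas : measurable_fun setT (fun x => normc (T x)).
Proof.
have -> : (fun x => normc (T x)) =
    (fun x => Num.sqrt ((\int[mA]_y gr (x, y)) ^+ 2 + (\int[mA]_y gi (x, y)) ^+ 2)).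
  by apply/funext => x; rewrite osc_opE.
apply: (measurableT_comp (f := @Num.sqrt R)).
  by apply: continuous_measurable_fun; exact: sqrt_continuous.
by apply: measurable_funD; apply: measurable_funX; exact: measurable_int_leb_itv.
Qed.

Let Tsupp x : ~~ (- A <= x < A) -> T x = 0.
Proof.
move=> nx; rewrite osc_opE; have h y : gr (x, y) = 0 /\ gi (x, y) = 0.
  by apply: g_supp; rewrite negb_and nx.
have -> : \int[mA]_y gr (x, y) = 0.
  by under eq_Rintegral do rewrite (h _).1; rewrite Rintegral_cst// mul0r.
have -> : \int[mA]_y gi (x, y) = 0.
  by under eq_Rintegral do rewrite (h _).2; rewrite Rintegral_cst// mul0r.
by [].
Qed.

Definition real_parts (i : bool * bool * bool) (x : R) : R :=
  `|real_op n a A (if i.1.1 then br else bi) lam (if i.1.2 then 0 else - (pi / 2))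
     (if i.2 then fr else fi) x|.

Let mfp (h : R -> R) : measurable_fun setT h -> measurable_fun setT (fun y => (`|h y| `^ p)%:E).
Proof.
move=> mh; apply/measurable_EFinP; apply: measurableT_comp (@measurable_powR R p) _.
exact: measurableT_comp.
Qed.

Let p0 : 0 < p. Proof. exact: lt_trans p1. Qed.

Let mnf : measurable_fun setT (fun y => (normc (f y))).
Proof.
have -> : (fun y => normc (f y)) = (fun y => Num.sqrt ((fr y) ^+ 2 + (fi y) ^+ 2)).
  by apply/funext => y; rewrite /fr /fi; case: (f y).
apply: (measurableT_comp (f := @Num.sqrt R)).
  by apply: continuous_measurable_fun; exact: sqrt_continuous.
by apply: measurable_funD; exact: measurable_funX.
Qed.

Local Notation If := (\int[leb]_y (normc (f y) `^ p)%:E)%E.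

Let mnfp : measurable_fun setT (fun y => (normc (f y) `^ p)%:E).
Proof.
by apply/measurable_EFinP; exact: measurableT_comp (@measurable_powR R p) mnf.
Qed.

Lemma cLnormE (h : R -> R[i]) :
  cLnorm p h = ((\int[leb]_y (normc (h y) `^ p)%:E) `^ p^-1)%E.
Proof.
rewrite /cLnorm unlock /=; congr (_ `^ _)%E; apply: eq_integral => y _ /=.
by rewrite ger0_norm// normc_ge0.
Qed.

Let If_lty : (If < +oo)%E.
Proof.
case: fLp => _ _; rewrite cLnormE ltey => h; rewrite ltey.
by apply: contra h => /eqP ->; rewrite poweRyr// invr_eq0 gt_eqF.
Qed.

Let part_le (h : R -> R) : measurable_fun setT h -> (forall y, `|h y| <= normc (f y)) ->
  (\int[mA]_y (`|h y| `^ p)%:E <= If)%E.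
Proof.
move=> mh hf; rewrite ge0_integral_leb_itv//; last exact: mfp.
apply: (@le_trans _ _ (\int[leb]_y (`|h y| `^ p)%:E)%E).
  apply: ge0_subset_integral => //; exact: mfp.
apply: ge0_le_integral => //; first exact: mfp.
by move=> y _; rewrite lee_fin ge0_ler_powR ?nnegrE ?normc_ge0 ?(ltW p0).
Qed.

Let fr_le := part_le mfr (fun y => normc_Re (f y)).
Let fi_le := part_le mfi (fun y => normc_Im (f y)).

(** The integral of a sum can be split only where every term is integrable, that
    is for almost every [x]. *)
Lemma osc_op_le_parts : {ae mA, forall x, normc (T x) <= \sum_i real_parts i x}.
Proof.
pose P b (h : R -> R) x :=
  forall c, mA.-integrable setT (fun y => (osc_kernel n a b lam c (x, y) * h y)%:E).
have ae_int b b1 (h : R -> R) : amplitude mu M b b1 -> measurable_fun setT h ->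
    (\int[mA]_y (`|h y| `^ p)%:E < +oo)%E ->
    {ae mA, forall x, P b h x}.
  move=> am mh hp.
  have H := ae_integrable1 (amplitude_integrable mu0 mu1 M0 A0 p1 am mh hp).
  apply: filterS H => x ib c.
  exact: (cos_amplitude_integrable _ _ _ _ am mh ib).
have frp := le_lt_trans fr_le If_lty; have fip := le_lt_trans fi_le If_lty.
have I1 := ae_int _ _ _ ampr mfr frp; have I2 := ae_int _ _ _ ampr mfi fip.
have I3 := ae_int _ _ _ ampi mfr frp; have I4 := ae_int _ _ _ ampi mfi fip.
have F := ae_filter_ringOfSetsType mA.
have I12 := @filterI _ _ F _ _ I1 I2; have I34 := @filterI _ _ F _ _ I3 I4.
apply: (@filterS _ _ F _ _ _ (@filterI _ _ F _ _ I12 I34)) => x [[i1 i2] [i3 i4]].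
rewrite osc_opE; apply: (le_trans (normc_le_ReIm _)) => /=.
rewrite /gr /gi /kcos /ksin /=.
have E (h1 h2 h3 h4 : R -> R) (s : bool) : mA.-integrable setT (EFin \o h1) ->
    mA.-integrable setT (EFin \o h2) -> mA.-integrable setT (EFin \o h3) ->
    mA.-integrable setT (EFin \o h4) ->
    `|\int[mA]_y ((h1 y - h2 y) + (-1) ^+ s * (h3 y + h4 y))| <=
    `|\int[mA]_y h1 y| + `|\int[mA]_y h2 y| + (`|\int[mA]_y h3 y| + `|\int[mA]_y h4 y|).
  move=> j1 j2 j3 j4.
  have j12 : mA.-integrable setT (EFin \o (fun y => h1 y - h2 y)).
    exact: (@integrableB _ (measurableTypeR R) R mA setT measurableT _ _ j1 j2).
  have j34 : mA.-integrable setT (EFin \o (fun y => h3 y + h4 y)).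
    exact: (@integrableD _ (measurableTypeR R) R mA setT measurableT _ _ j3 j4).
  have j34' : mA.-integrable setT (EFin \o (fun y => (-1) ^+ s * (h3 y + h4 y))).
    exact: (@integrableZl _ (measurableTypeR R) R mA setT measurableT ((-1) ^+ s) _ j34).
  rewrite RintegralD//; apply: (le_trans (ler_normD _ _)); apply: lerD.
    by rewrite RintegralB//; exact: ler_normB.
  by rewrite RintegralZl// normrM normrX normrN1 expr1n mul1r RintegralD//; exact: ler_normD.
have E1 := E _ _ _ _ true (i1 0) (i3 (- (pi / 2))) (i4 0) (i2 (- (pi / 2))).
have E2 := E _ _ _ _ false (i2 0) (i4 (- (pi / 2))) (i3 0) (i1 (- (pi / 2))).
have -> : \sum_i real_parts i x =
   \sum_(i <- [:: (true, true, true); (false, false, true); (false, true, false); (true, false, false);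
     (true, true, false); (false, false, false); (false, true, true); (true, false, true)])
     real_parts i x.
  rewrite -[LHS]big_enum; apply: perm_big; apply: uniq_perm => //; first exact: enum_uniq.
  by move=> [[[] []] []]; rewrite mem_enum.
rewrite !big_cons big_nil /real_parts /real_op /=.
under eq_Rintegral do rewrite -[X in _ + X]mulN1r.
under [in X in _ + `|X| <= _]eq_Rintegral do rewrite -[X in _ + X]mul1r.
apply: (le_trans (lerD E1 E2)).
by rewrite addr0 !addrA.
Qed.

Variable N : R.
Hypothesis N0 : 0 < N.
Hypothesis parts_bound : forall b c (h : R -> R), b = br \/ b = bi ->
  measurable_fun setT h -> (\int[mA]_y (`|h y| `^ p)%:E < +oo)%E ->
  (\int[mA]_x (`|real_op n a A b lam c h x| `^ p)%:E <=
    ((2 * N) `^ p)%:E * \int[mA]_y (`|h y| `^ p)%:E)%E.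

(** Each of the eight parts contributes [8 ^ p (2 N) ^ p], and [8 <= 8 ^ p], whence
    the constant [8 * 8 * 2]. *)
Lemma osc_op_bound : (cLnorm p T <= (128 * N)%:E * cLnorm p f)%E.
Proof.
have mparts i : measurable_fun setT (real_parts i).
  have mop b b1 c (h : R -> R) : amplitude mu M b b1 -> measurable_fun setT h ->
      measurable_fun setT (fun x => `|real_op n a A b lam c h x|).
    move=> am mh; apply: measurableT_comp => //.
    exact: (measurable_real_op _ _ _ _ _ am mh).
  by rewrite /real_parts; case: i => [[[] []] []] /=; apply: mop; eassumption.
have parts_le i : (\int[mA]_x ((real_parts i x) `^ p)%:E <= ((2 * N) `^ p)%:E * If)%E.
  pose h := if i.2 then fr else fi.
  have mh : measurable_fun setT h by rewrite /h; case: ifP.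
  have hle : (\int[mA]_y (`|h y| `^ p)%:E <= If)%E.
    by rewrite /h; case: ifP => _; [exact: fr_le|exact: fi_le].
  apply: (@le_trans _ _ (((2 * N) `^ p)%:E * \int[mA]_y (`|h y| `^ p)%:E)%E).
    apply: parts_bound => //; last exact: le_lt_trans hle If_lty.
    by case: ifP => _; [left|right].
  by apply: lee_wpmul2l => //; rewrite lee_fin powR_ge0.
have parts0 i x : 0 <= real_parts i x by exact: normr_ge0.
have m8 i : measurable_fun setT (fun x => (8 * real_parts i x) `^ p).
  by apply: measurableT_comp (@measurable_powR R p) _; exact: measurable_funM.
have mS : measurable_fun setT (fun x => \sum_i (8 * real_parts i x) `^ p).
  exact: measurable_sum.
have main : (\int[leb]_x (normc (T x) `^ p)%:E <= ((128 * N) `^ p)%:E * If)%E.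
  have mT : measurable_fun setT (fun x => (normc (T x) `^ p)%:E).
    by apply/measurable_EFinP; exact: measurableT_comp (@measurable_powR R p) normT_meas.
  rewrite (@ge0_integral_supported _ (- A) A)//; first last.
  - move=> x /Tsupp ->; congr EFin.
    by rewrite /Normc.normc/= expr0n/= addr0 sqrtr0 powR0// gt_eqF.
  - by move=> x; rewrite lee_fin powR_ge0.
  apply: (@le_trans _ _ (\int[mA]_x (\sum_i (8 * real_parts i x) `^ p)%:E)%E).
    apply: ae_ge0_le_integral => //.
    - by move=> x _; rewrite lee_fin powR_ge0.
    - by move=> x _; rewrite lee_fin sumr_ge0// => i _; exact: powR_ge0.
    - exact/measurable_EFinP.
    apply: (@filterS _ _ (ae_filter_ringOfSetsType mA) _ _ _ osc_op_le_parts) => x Tx _.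
    rewrite lee_fin.
    have -> : 8 = #|{: bool * bool * bool}|%:R :> R by rewrite !card_prod card_bool.
    apply: le_trans (powR_sum_le (true, true, true) (ltW p0) (parts0 ^~ x)).
    by rewrite ge0_ler_powR ?nnegrE ?normc_ge0 ?(ltW p0)// sumr_ge0.
  have -> : (\int[mA]_x (\sum_i (8 * real_parts i x) `^ p)%:E =
             \sum_i (8 `^ p)%:E * \int[mA]_x ((real_parts i x) `^ p)%:E)%E.
    under eq_integral do rewrite -sumEFin.
    rewrite ge0_integral_sum//.
    - apply: eq_bigr => i _; under eq_integral do rewrite powRM// EFinM.
      rewrite ge0_integralZl_EFin//.
      + by move=> x _; rewrite lee_fin powR_ge0.
      + by apply/measurable_EFinP; exact: measurableT_comp (@measurable_powR R p) (mparts i).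
    - by move=> i; apply/measurable_EFinP; exact: m8.
    - by move=> i x _; rewrite lee_fin powR_ge0.
  apply: (@le_trans _ _ (\sum_(i : bool * bool * bool) (8 `^ p)%:E * (((2 * N) `^ p)%:E * If))%E).
    by apply: lee_sum => i _; apply: lee_wpmul2l => //; rewrite lee_fin powR_ge0.
  have If0 : (0 <= If)%E by apply: integral_ge0 => y _; rewrite lee_fin powR_ge0.
  rewrite big_const !card_prod card_bool.
  have -> (z : \bar R) : iter (2 * 2 * 2) (fun t => z + t)%E 0%E = (8%:E * z)%E.
    by rewrite -[8]/(8%:R) mule_natl /= !addeA adde0.
  rewrite !muleA -!EFinM; apply: lee_wpmul2r => //; rewrite lee_fin.
  have -> : 128 * N = 8 * (8 * (2 * N)) by ring.
  rewrite !(@powRM _ _ _ p) ?mulr_ge0 ?(ltW N0)// !mulrA.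
  do 3! (rewrite ler_wpM2r ?powR_ge0//).
  have e1 : (1 : R) <= 8 by rewrite ler1n.
  by rewrite -[leLHS]powRr1//; exact: ler_powR e1 _ _ (ltW p1).
rewrite !cLnormE.
have If0 : (0 <= If)%E by apply: integral_ge0 => y _; rewrite lee_fin powR_ge0.
have -> : (128 * N)%:E = ((((128 * N) `^ p)%:E) `^ p^-1)%E.
  by rewrite poweR_EFin -powRrM mulfV ?gt_eqF// powRr1// mulr_ge0// ltW.
rewrite -poweRM//; last by rewrite lee_fin powR_ge0.
apply: gt0_ler_poweR main.
- by rewrite invr_ge0 ltW.
- by rewrite in_itv/= leey andbT; apply: integral_ge0 => y _; rewrite lee_fin powR_ge0.
- by rewrite in_itv/= leey andbT mule_ge0// lee_fin powR_ge0.
Qed.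

End OscillatoryOperator.

(** * The range of exponents *)

Section StrongBound.
Context {R : realType}.
Local Open Scope complex_scope.

(** The range of [p] bounds both [1 / p] and [1 / q] below by
    [(1 - mu) / (n - 2 mu)], while [n (1 - mu / n) = n - mu] exceeds [n - 2 mu]. *)
Lemma conjugate_exponent_range (p mu n : R) : 0 < mu -> mu < 1 -> 2 <= n ->
  (n - 2 * mu) / (n - 1 - mu) <= p -> p <= (n - 2 * mu) / (1 - mu) ->
  1 < p /\ exists q, [/\ 1 < q, p^-1 + q^-1 = 1 &
    1 - mu < n * (1 - mu / n) * Num.min p^-1 q^-1].
Proof.
move=> mu0 mu1 n2 lo hi.
have d1 : 0 < n - 1 - mu by lra.
have d2 : 0 < 1 - mu by lra.
have d3 : 0 < n - 2 * mu by lra.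
have n0 : 0 < n by lra.
have p1 : 1 < p by apply: lt_le_trans lo; rewrite ltr_pdivlMr//; lra.
have p0 : 0 < p by exact: lt_trans p1.
have ip1 : p^-1 < 1 by rewrite invf_lt1.
have ip0 : 0 < p^-1 by rewrite invr_gt0.
split => //; exists ((1 - p^-1)^-1).
have e2 : (1 - mu) / (n - 2 * mu) <= p^-1.
  by rewrite -[leLHS]invrK invf_div lef_pV2 ?posrE ?divr_gt0.
have e1 : p^-1 <= (n - 1 - mu) / (n - 2 * mu).
  by rewrite -[leRHS]invrK invf_div lef_pV2 ?posrE ?divr_gt0.
have e3 : (1 - mu) / (n - 2 * mu) <= 1 - p^-1.
  have -> : (1 - mu) / (n - 2 * mu) = 1 - (n - 1 - mu) / (n - 2 * mu) by field; lra.
  by rewrite lerD2l lerN2.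
split.
- by rewrite invf_gt1 ?subr_gt0// gtrBl.
- by rewrite invrK addrC subrK.
rewrite invrK; apply: (@lt_le_trans _ _ ((n - mu) * ((1 - mu) / (n - 2 * mu)))).
  rewrite mulrA ltr_pdivlMr// mulrC ltr_pM2r//; lra.
have -> : n * (1 - mu / n) = n - mu by field; lra.
by rewrite ler_wpM2l ?le_min ?e2 ?e3//; lra.
Qed.

(** The constant depends on [K] through [mu] and [E] only, because the constant of
    the bilinear bound depends on the amplitude only through [mu] and [M]. *)
Lemma osc_op_Lp_bound (m : nat) (mu : R) (a : nat -> R) (psi : R * R -> R[i]) (E p : R) :
  0 < mu -> mu < 1 -> a 1%N * a m.+1 != 0 -> smooth_compact_support psi -> 0 < E ->
  (m.+2%:R - 2 * mu) / (m.+2%:R - 1 - mu) <= p -> p <= (m.+2%:R - 2 * mu) / (1 - mu) ->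
  exists C : R, 0 < C /\ forall K : R * R -> R[i], singular_kernel mu E K ->
    forall lambda : R, 1 <= lambda -> forall f : R -> R[i], in_Lp p f ->
    (cLnorm p (osc_op (phase m.+2 a) K psi lambda f)
       <= (C * lambda `^ (- ((1 - mu) / m.+2%:R)))%:E * cLnorm p f)%E.
Proof.
move=> mu0 mu1 a1am spsi E0 lo hi.
have n2 : 2 <= m.+2%:R :> R by rewrite ler_nat.
have n0 : 0 < m.+2%:R :> R by [].
have [p1 [q [q1 pq sb]]] := conjugate_exponent_range mu0 mu1 n2 lo hi.
have [A [B [A1 B0 cutr cuti supp]]] := smooth_cutoffs spsi.
have A0 : 0 < A by lra.
pose M := 2 * E * B * (1 + 2 * A).
have M0 : 0 <= M by rewrite /M !mulr_ge0 ?(ltW E0)// addr_ge0// mulr_ge0// ltW.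
have b0 : 0 < 1 - mu / m.+2%:R by rewrite subr_gt0 ltr_pdivrMr//; lra.
have b1 : 1 - mu / m.+2%:R < 1 by rewrite gtrBl divr_gt0.
have [C [C0 HC]] := dyadic_bilinear_bound a1am mu0 mu1 M0 A1 b0 b1 p1 q1 pq sb.
exists (128 * (C + 1)); split; first by rewrite mulr_gt0// ltr_wpDl.
move=> K sK lam lam1 f fLp.
have [skr ski] := singular_parts sK.
have cutN := cutoffN cutr.
pose Kr z := complex.Re (K z); pose Ki z := complex.Im (K z).
pose ur z := complex.Re (psi z); pose ui z := complex.Im (psi z).
have ampr := amplitude_pair mu0 (ltW E0) (ltW A0) B0 skr ski cutr cuti.
have ampi := amplitude_pair mu0 (ltW E0) (ltW A0) B0 skr ski cuti cutN.
have lam0 : 0 < lam by lra.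
have N0 : 0 < (C + 1) * lam `^ (- ((1 - mu) / m.+2%:R)).
  by rewrite mulr_gt0 ?powR_gt0// ltr_wpDl.
have psi0 x y : ~~ ((- A <= x < A) && (- A <= y < A)) -> psi (x, y) = 0.
  by move=> h; apply/eqP; apply: contraNT h => /supp[-> ->].
rewrite -mulrA; apply: (osc_op_bound mu0 mu1 M0 A0 p1 ampr ampi) => //.
- move=> x y xy; rewrite /pair_amp /= (negPf xy).
  case: (K (x, y)) => k1 k2; case: (psi (x, y)) => u1 u2 /=.
  by rewrite mulrN opprK.
- by move=> x y h; rewrite /pair_amp psi0//= !mulr0 subr0 if_same.
- by move=> x y h; rewrite /pair_amp psi0//= oppr0 !mulr0 subr0 if_same.
have bnd b bb c (h : R -> R) : amplitude mu M b bb -> measurable_fun setT h ->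
    (\int[leb_itv (- A) A]_y (`|h y| `^ p)%:E < +oo)%E ->
    (\int[leb_itv (- A) A]_x (`|real_op m.+2 a A b lam c h x| `^ p)%:E <=
      ((2 * ((C + 1) * lam `^ (- ((1 - mu) / m.+2%:R)))) `^ p)%:E *
      \int[leb_itv (- A) A]_y (`|h y| `^ p)%:E)%E.
  move=> ab mh hp; have [eps0 [eps00 H]] := HC b bb ab lam c lam1.
  apply: (real_op_bound mu0 mu1 M0 A0 p1 q1 pq ab N0 eps00) => //.
  move=> eps e0 e1 u v bu bv; apply: (le_trans (H eps e0 e1 u v bu bv)).
  apply: ler_wpM2r.
    by rewrite addr_ge0// Rintegral_ge0// => x _; exact: powR_ge0.
  by rewrite ler_wpM2r ?powR_ge0// lerDl.
by move=> b c h [->|->]; [exact: bnd ampr|exact: bnd ampi].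
Qed.

End StrongBound.

Theorem theorem7p1 (R : realType) (n : nat) (hn : (2 <= n)%N)
    (mu : R) (hmu : 0 < mu < 1)
    (a : nat -> R) (ha : a 1%N * a (n - 1)%N != 0)
    (psi : R * R -> R[i]) (hpsi : smooth_compact_support psi)
    (E : R) (hE : 0 < E) :
  (forall p : R,
     (n%:R - 2 * mu) / (n%:R - 1 - mu) < p < (n%:R - 2 * mu) / (1 - mu) ->
     exists C : R, forall K : R * R -> R[i], singular_kernel mu E K ->
       forall lambda : R, 2 <= lambda ->
       forall f : R -> R[i], in_Lp p f ->
         (cLnorm p (osc_op (phase n a) K psi lambda f)
          <= (C * lambda `^ (- ((1 - mu) / n%:R)))%:E * cLnorm p f)%E)
  /\
  (forall p : R,
     p = (n%:R - 2 * mu) / (n%:R - 1 - mu) ->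
     exists C : R, forall K : R * R -> R[i], singular_kernel mu E K ->
       forall lambda : R, 2 <= lambda ->
       forall f : R -> R[i], in_Lp p f ->
         (cLnorm p (osc_op (phase n a) K psi lambda f)
          <= (C * lambda `^ (- ((1 - mu) / n%:R))
              * `|log2 lambda| `^ ((2 - 2 * mu) / (n%:R - 2 * mu)))%:E
             * cLnorm p f)%E).
Proof.
case: n hn ha => [|[|m]]// _; rewrite subn1/= => ha.
have /andP[mu0 mu1] := hmu.
have n2 : 2 <= m.+2%:R :> R by rewrite ler_nat.
split=> p.
  move=> /andP[lo hi].
  have [C [_ HC]] := osc_op_Lp_bound mu0 mu1 ha hpsi hE (ltW lo) (ltW hi).
  by exists C => K sK lam lam2 f fp; apply: HC => //; lra.
move=> pE.
have hi : p <= (m.+2%:R - 2 * mu) / (1 - mu).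
  rewrite pE ler_wpM2l//; first by lra.
  by rewrite lef_pV2 ?posrE; lra.
have lo : (m.+2%:R - 2 * mu) / (m.+2%:R - 1 - mu) <= p by rewrite pE.
have [C [C0 HC]] := osc_op_Lp_bound mu0 mu1 ha hpsi hE lo hi.
exists C => K sK lam lam2 f fp.
have lam0 : 0 < lam by lra.
apply: (le_trans (HC K sK lam _ f fp)); first by lra.
apply: lee_wpmul2r; first exact: Lnorm_ge0.
rewrite lee_fin ler_peMr ?mulr_ge0 ?powR_ge0 ?(ltW C0)//.
(* [2 <= lambda] makes the logarithmic factor at least one. *)
have l2 : 0 < ln (2 : R) by rewrite ln_gt0// ltr1n.
have L1 : 1 <= log2 lam by rewrite /log2 ler_pdivlMr// mul1r ler_ln ?posrE.
rewrite ger0_norm ?(le_trans ler01 L1)// powR_ge1// divr_ge0//; lra.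
Qed.
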